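(* Assume that $H$ is a Gorenstein ring. With respect to the short $I$-exact sequences the category $\mathcal{C}(G)$ is a weakly idempotent complete Frobenius category and the functors $\mathbb{F}:\mathrm{GProj}(H)\rightleftarrows\mathcal{C}(G):U$ are exact inverse equivalences.
   Context: Let $k$ be a field of characteristic $p>0$ and $G$ a topological group (possibly discrete) admitting an open pro-$p$ subgroup $I$. $\mathrm{Rep}_k^\infty(G)$ is the category of smooth $k$-linear $G$-representations (stabilizers of vectors are open). $\mathbb{X}=\mathrm{ind}_I^G(k)$ is the space of compactly supported $f:G\to k$ with $f(gi)=f(g)$ for $i\in I$, with action $(gf)(g')=f(g^{-1}g')$; $H=\mathrm{End}_G(\mathbb{X})^{\mathrm{op}}$; $\mathrm{Mod}(H)$ is the category of left $H$-modules; $FM=\mathbb{X}\otimes_HM$ is left adjoint to $UV=V^I\cong\mathrm{Hom}_G(\mathbb{X},V)$; both are extended termwise to complexes. A ring is Gorenstein if it is left and right noetherian with finite injective dimension as a left and right module over itself. An $H$-module $M$ is Gorenstein projective if $M=\ker(d_0)=\mathrm{im}(d_1)$ for an acyclic complex $(Y_\bullet,d_\bullet)$ of projectives which stays exact under $\mathrm{Hom}_H(\cdot,P)$ for all projective $P$. $\mathrm{GProj}(H)$ is the full subcategory of Gorenstein projective $H$-modules, with the exact structure given by the short exact sequences of $\mathrm{Mod}(H)$ with terms in $\mathrm{GProj}(H)$. A $G$-representation is $I$-projective if it is a direct summand of $FP$ for a projective $H$-module $P$. A sequence in $\mathrm{Rep}^\infty_k(G)$ is $I$-exact if it is a complex and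 becomes exact after applying $U$; a short $I$-exact sequence is an $I$-exact sequence $0\to X\to Y\to Z\to0$. $\mathcal{C}(G)$ is the full subcategory of $\mathrm{Rep}^\infty_k(G)$ of representations isomorphic to $B_0X=\mathrm{im}(X_1\to X_0)$ for some $I$-exact (unbounded) complex $X$ of $I$-projective representations. Functorial factorizations in the Gorenstein projective model structure on $\mathrm{Mod}(H)$ yield a (fixed) functor $M\mapsto Y^M$ to chain complexes of $H$-modules such that $Y^M$ is acyclic with $\mathrm{im}(d_1)=\ker(d_0)=M$, $Y^M_i$ is projective for $i\ge1$ and of finite projective dimension for $i\le0$, and $M$ is Gorenstein projective iff all $Y_i^M$ are projective. $\mathbb{F}M=B_0FY^M$. An exact category (Quillen) is Frobenius if it has enough projectives and enough injectives (relative to the admissible exact sequences) and the classes of projectives and injectives coincide. It is weakly idempotent complete if every retraction has a kernel (equivalently every section has a cokernel). *)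

(* Defs.v *)
From HB Require Import structures.
From mathcomp Require Import all_boot all_order all_algebra.
From mathcomp Require Import finmap all_classical.
From mathcomp Require Import topology.

Set Implicit Arguments.
Unset Strict Implicit.
Unset Printing Implicit Defensive.

Import GRing.Theory.
Local Open Scope classical_set_scope.
Local Open Scope ring_scope.

Lemma linear_ext (R : pzRingType) (M N : lmodType R) (f g : {linear M -> N}) :
  f =1 g -> f = g.
Proof.
case: f g => f [[Hf1] [Hf2]] [g [[Hg1] [Hg2]]] /= /funext fg.
by subst g; congr (GRing.Linear.Pack (GRing.Linear.Class _ _)); congr (_ _); apply: Prop_irrelevance.
Qed.

Section linear_zmod.
Variables (R : pzRingType) (M N : lmodType R).
HB.instance Definition _ := gen_eqMixin {linear M -> N}.
HB.instance Definition _ := gen_choiceMixin {linear M -> N}.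

Definition lin_zero : {linear M -> N} := \0%R.
Definition lin_add (f g : {linear M -> N}) : {linear M -> N} := f \+ g.
Definition lin_opp (f : {linear M -> N}) : {linear M -> N} := \- f.

Lemma lin_addA : associative lin_add.
Proof. by move=> f g h; apply: linear_ext => x; exact: addrA. Qed.
Lemma lin_addC : commutative lin_add.
Proof. by move=> f g; apply: linear_ext => x; exact: addrC. Qed.
Lemma lin_add0 : left_id lin_zero lin_add.
Proof. by move=> f; apply: linear_ext => x; exact: add0r. Qed.
Lemma lin_addN : left_inverse lin_zero lin_opp lin_add.
Proof. by move=> f; apply: linear_ext => x; exact: addNr. Qed.
HB.instance Definition _ := GRing.isZmodule.Build {linear M -> N}
  lin_addA lin_addC lin_add0 lin_addN.
End linear_zmod.

HB.mixin Record isTopologicalGroup G & Topological G & Group G := {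
  mulg_continuous : continuous (fun x : G * G => (x.1 * x.2)%g);
  invg_continuous : continuous (fun x : G => x^-1%g)
}.
#[short(type="topGroupType")]
HB.structure Definition TopologicalGroup :=
  {G of Topological G & Group G & isTopologicalGroup G}.

Record category := Category {
  obj :> Type;
  hom : obj -> obj -> Type;
  idm : forall a, hom a a;
  comp : forall a b c, hom b c -> hom a b -> hom a c;
  comp1m : forall a b (f : hom a b), comp (idm b) f = f;
  compm1 : forall a b (f : hom a b), comp f (idm a) = f;
  compmA : forall a b c d (f : hom c d) (g : hom b c) (h : hom a b),
    comp f (comp g h) = comp (comp f g) h
}.
Arguments hom {_} _ _.
Arguments idm {_} _.
Arguments comp {_ _ _ _} _ _.
Notation "g ** f" := (comp g f) (at level 40, left associativity).

Definition is_iso (C : category) (a b : C) (f : hom a b) :=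
  exists g : hom b a, g ** f = idm a /\ f ** g = idm b.

Definition isomorphic (C : category) (a b : C) :=
  exists f : hom a b, is_iso f.

Record functor (C D : category) := Functor {
  fob :> C -> D;
  fmap : forall a b, hom a b -> hom (fob a) (fob b);
  fmap1 : forall a, fmap (idm a) = idm (fob a);
  fmapM : forall a b c (g : hom b c) (f : hom a b),
    fmap (g ** f) = fmap g ** fmap f
}.
Arguments fmap {C D} _ {a b} _.

Section functor_ops.
Variables C D E : category.

Definition id_functor : functor C C :=
  @Functor C C id (fun _ _ f => f) (fun _ => erefl) (fun _ _ _ _ _ => erefl).

Lemma comp_functor1 (F : functor D E) (K : functor C D) a :
  fmap F (fmap K (idm a)) = idm (F (K a)).
Proof. by rewrite !fmap1. Qed.

Lemma comp_functorM (F : functor D E) (K : functor C D) a b c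
    (g : hom b c) (f : hom a b) :
  fmap F (fmap K (g ** f)) = fmap F (fmap K g) ** fmap F (fmap K f).
Proof. by rewrite !fmapM. Qed.

Definition comp_functor (F : functor D E) (K : functor C D) : functor C E :=
  Functor (comp_functor1 F K) (@comp_functorM F K).

Definition naturally_isomorphic (F K : functor C D) :=
  exists t : forall a, hom (F a) (K a),
    (forall a, is_iso (t a)) /\
    (forall a b (f : hom a b), t b ** fmap F f = fmap K f ** t a).
End functor_ops.

Definition inverse_equivalences (C D : category)
    (F : functor C D) (K : functor D C) :=
  naturally_isomorphic (comp_functor K F) (id_functor C) /\
  naturally_isomorphic (comp_functor F K) (id_functor D).

Record preadditive := Preadditive {
  pobj :> Type;
  phom : pobj -> pobj -> zmodType;
  pidm : forall a, phom a a;
  pcomp : forall a b c, phom b c -> phom a b -> phom a c;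
  pcomp1m : forall a b (f : phom a b), pcomp (pidm b) f = f;
  pcompm1 : forall a b (f : phom a b), pcomp f (pidm a) = f;
  pcompmA : forall a b c d (f : phom c d) (g : phom b c) (h : phom a b),
    pcomp f (pcomp g h) = pcomp (pcomp f g) h;
  pcompDl : forall a b c (f g : phom b c) (h : phom a b),
    pcomp (f + g) h = pcomp f h + pcomp g h;
  pcompDr : forall a b c (f : phom b c) (g h : phom a b),
    pcomp f (g + h) = pcomp f g + pcomp f h
}.

Definition category_of (A : preadditive) : category :=
  @Category (pobj A) (fun a b => @phom A a b) (@pidm A) (@pcomp A)
    (@pcomp1m A) (@pcompm1 A) (@pcompmA A).
Coercion category_of : preadditive >-> category.
Canonical category_of.

Section full_subcategory.
Variables (A : preadditive) (P : A -> Prop).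

Definition full_sub : preadditive :=
  @Preadditive {x : A | P x} (fun a b => @phom A (sval a) (sval b))
    (fun a => pidm (sval a)) (fun _ _ _ g f => pcomp g f)
    (fun _ _ f => pcomp1m f) (fun _ _ f => pcompm1 f)
    (fun _ _ _ _ f g h => pcompmA f g h)
    (fun _ _ _ f g h => pcompDl f g h) (fun _ _ _ f g h => pcompDr f g h).
End full_subcategory.

Definition restrict_functor (A B : preadditive) (F : functor A B)
    (P : A -> Prop) (Q : B -> Prop) (PQ : forall x, P x -> Q (F x)) :
    functor (full_sub P) (full_sub Q) :=
  @Functor (full_sub P) (full_sub Q)
    (fun x => exist Q (F (sval x)) (PQ _ (svalP x)))
    (fun _ _ f => fmap F f) (fun _ => fmap1 F _) (fun _ _ _ g f => fmapM F g f).

Definition additive_functor (A B : preadditive) (F : functor A B) :=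
  forall (a b : A) (f g : @phom A a b),
    fmap F (f + g) = fmap F f + fmap F g.

(* Exact categories in the sense of Quillen, in the axiomatization of Keller
   and Buehler: a class of kernel-cokernel pairs a -> b -> c (the admissible
   short exact sequences) closed under isomorphisms and satisfying E0, E1, E2
   and their duals. *)
Section exact_category.
Variable A : preadditive.

Definition is_zero_object (z : A) := idm z = 0.

Definition is_biproduct (a b s : A) :=
  exists (ia : hom a s) (ib : hom b s) (pa : hom s a) (pb : hom s b),
    [/\ pa ** ia = idm a, pb ** ib = idm b, pa ** ib = 0, pb ** ia = 0
      & ia ** pa + ib ** pb = idm s].

Definition is_additive_category :=
  (exists z : A, is_zero_object z) /\
  (forall a b : A, exists s, is_biproduct a b s).

Definition is_kernel (a b c : A) (i : hom a b) (p : hom b c) :=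
  p ** i = 0 /\
  forall x (f : hom x b), p ** f = 0 -> exists! g : hom x a, i ** g = f.

Definition is_cokernel (a b c : A) (i : hom a b) (p : hom b c) :=
  p ** i = 0 /\
  forall x (f : hom b x), f ** i = 0 -> exists! g : hom c x, g ** p = f.

Definition is_pushout (a b a' b' : A) (i : hom a b) (f : hom a a')
    (i' : hom a' b') (f' : hom b b') :=
  i' ** f = f' ** i /\
  forall x (u : hom a' x) (v : hom b x), u ** f = v ** i ->
    exists! w : hom b' x, w ** i' = u /\ w ** f' = v.

Definition is_pullback (b c b' c' : A) (p : hom b c) (f : hom c' c)
    (p' : hom b' c') (f' : hom b' b) :=
  f ** p' = p ** f' /\
  forall x (u : hom x c') (v : hom x b), f ** u = p ** v ->
    exists! w : hom x b', p' ** w = u /\ f' ** w = v.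

Definition sequence_class := forall a b c : A, hom a b -> hom b c -> Prop.

Variable E : sequence_class.

Definition admissible_mono (a b : A) (i : hom a b) :=
  exists c (p : hom b c), E i p.

Definition admissible_epi (b c : A) (p : hom b c) :=
  exists a (i : hom a b), E i p.

Definition closed_under_iso :=
  forall (a b c a' b' c' : A) (i : hom a b) (p : hom b c)
      (i' : hom a' b') (p' : hom b' c')
      (u : hom a a') (v : hom b b') (w : hom c c'),
    is_iso u -> is_iso v -> is_iso w ->
    i' ** u = v ** i -> p' ** v = w ** p -> E i p -> E i' p'.

Record is_exact_category : Prop := IsExactCategory {
  exact_additive : is_additive_category;
  exact_kernel : forall a b c (i : hom a b) (p : hom b c),
    E i p -> is_kernel i p;
  exact_cokernel : forall a b c (i : hom a b) (p : hom b c),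
    E i p -> is_cokernel i p;
  exact_iso : closed_under_iso;
  exact_E0 : forall a : A, admissible_mono (idm a);
  exact_E0op : forall a : A, admissible_epi (idm a);
  exact_E1 : forall (a b c : A) (i : hom a b) (j : hom b c),
    admissible_mono i -> admissible_mono j -> admissible_mono (j ** i);
  exact_E1op : forall (a b c : A) (p : hom a b) (q : hom b c),
    admissible_epi p -> admissible_epi q -> admissible_epi (q ** p);
  exact_E2 : forall (a b a' : A) (i : hom a b) (f : hom a a'),
    admissible_mono i -> exists b' (i' : hom a' b') (f' : hom b b'),
      is_pushout i f i' f' /\ admissible_mono i';
  exact_E2op : forall (b c c' : A) (p : hom b c) (f : hom c' c),
    admissible_epi p -> exists b' (p' : hom b' c') (f' : hom b' b),
      is_pullback p f p' f' /\ admissible_epi p'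
}.

Definition rel_projective (x : A) :=
  forall (b c : A) (p : hom b c), admissible_epi p ->
  forall f : hom x c, exists g : hom x b, p ** g = f.

Definition rel_injective (x : A) :=
  forall (a b : A) (i : hom a b), admissible_mono i ->
  forall f : hom a x, exists g : hom b x, g ** i = f.

Definition enough_projectives :=
  forall c : A, exists b (p : hom b c), rel_projective b /\ admissible_epi p.

Definition enough_injectives :=
  forall a : A, exists b (i : hom a b), rel_injective b /\ admissible_mono i.

Record is_frobenius_category : Prop := IsFrobeniusCategory {
  frobenius_exact : is_exact_category;
  frobenius_projectives : enough_projectives;
  frobenius_injectives : enough_injectives;
  frobenius_coincide : forall x, rel_projective x <-> rel_injective x
}.

End exact_category.

Definition weakly_idempotent_complete (A : preadditive) :=
  forall (b c : A) (r : hom b c) (s : hom c b), r ** s = idm c ->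
    exists a (i : hom a b), is_kernel i r.

Definition is_exact_functor (A B : preadditive)
    (EA : sequence_class A) (EB : sequence_class B) (F : functor A B) :=
  additive_functor F /\
  forall (a b c : A) (i : hom a b) (p : hom b c),
    EA _ _ _ i p -> EB _ _ _ (fmap F i) (fmap F p).

Definition sub_sequence_class (A : preadditive) (P : A -> Prop)
    (E : sequence_class A) : sequence_class (full_sub P) :=
  fun a b c i p => E (sval a) (sval b) (sval c) i p.

(* The differential [diff i] is d_(i+1). *)
Record complex (A : preadditive) := Complex {
  cx :> int -> A;
  diff : forall i : int, hom (cx (i + 1)) (cx i);
  diff2 : forall i : int, diff i ** diff (i + 1) = 0
}.

Record chain_map (A : preadditive) (X Y : complex A) := ChainMap {
  cmap :> forall i : int, hom (X i) (Y i);
  cmap_diff : forall i : int, cmap i ** diff X i = diff Y i ** cmap (i + 1)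
}.

Section chain_complexes.
Variable A : preadditive.

Lemma chain_map_ext (X Y : complex A) (f g : chain_map X Y) :
  (forall i, f i = g i) -> f = g.
Proof.
case: f g => f Hf [g Hg] /= fg.
have {}fg : f = g by apply: functional_extensionality_dep.
by subst g; congr ChainMap; apply: Prop_irrelevance.
Qed.

Lemma chain_id_diff (X : complex A) i :
  idm (X i) ** diff X i = diff X i ** idm (X (i + 1)).
Proof. by rewrite comp1m compm1. Qed.
Definition chain_id (X : complex A) : chain_map X X := ChainMap (chain_id_diff X).

Lemma chain_comp_diff (X Y Z : complex A) (g : chain_map Y Z)
    (f : chain_map X Y) i :
  (g i ** f i) ** diff X i = diff Z i ** (g (i + 1) ** f (i + 1)).
Proof. by rewrite -compmA cmap_diff compmA cmap_diff compmA. Qed.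
Definition chain_comp (X Y Z : complex A) (g : chain_map Y Z)
  (f : chain_map X Y) : chain_map X Z := ChainMap (chain_comp_diff g f).

Lemma chain_comp1m (X Y : complex A) (f : chain_map X Y) :
  chain_comp (chain_id Y) f = f.
Proof. by apply: chain_map_ext => i; exact: comp1m. Qed.
Lemma chain_compm1 (X Y : complex A) (f : chain_map X Y) :
  chain_comp f (chain_id X) = f.
Proof. by apply: chain_map_ext => i; exact: compm1. Qed.
Lemma chain_compmA (X Y Z T : complex A) (f : chain_map Z T)
    (g : chain_map Y Z) (h : chain_map X Y) :
  chain_comp f (chain_comp g h) = chain_comp (chain_comp f g) h.
Proof. by apply: chain_map_ext => i; exact: compmA. Qed.

Definition Ch : category :=
  Category chain_comp1m chain_compm1 chain_compmA.
End chain_complexes.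

Section termwise.
Variables (A B : preadditive) (F : functor A B) (addF : additive_functor F).

Lemma additive_functor0 (a b : A) : fmap F (0 : hom a b) = 0.
Proof. by apply: (addIr (fmap F (0 : hom a b))); rewrite -addF !add0r. Qed.

Lemma map_diff2 (X : complex A) i :
  fmap F (diff X i) ** fmap F (diff X (i + 1)) = 0.
Proof. by rewrite -fmapM diff2 additive_functor0. Qed.
Definition map_complex (X : complex A) : complex B :=
  @Complex B (fun i => F (X i)) _ (map_diff2 X).

Lemma map_cmap_diff (X Y : complex A) (f : chain_map X Y) i :
  fmap F (f i) ** diff (map_complex X) i =
  diff (map_complex Y) i ** fmap F (f (i + 1)).
Proof. by rewrite /= -!fmapM cmap_diff. Qed.
Definition map_chain_map (X Y : complex A) (f : chain_map X Y) :
  chain_map (map_complex X) (map_complex Y) :=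
  @ChainMap B (map_complex X) (map_complex Y) (fun i => fmap F (f i))
    (map_cmap_diff f).

Lemma map_chain_map1 (X : complex A) :
  map_chain_map (chain_id X) = chain_id (map_complex X).
Proof. by apply: chain_map_ext => i; exact: fmap1. Qed.
Lemma map_chain_mapM (X Y Z : complex A) (g : chain_map Y Z)
    (f : chain_map X Y) :
  map_chain_map (chain_comp g f) =
  chain_comp (map_chain_map g) (map_chain_map f).
Proof. by apply: chain_map_ext => i; exact: fmapM. Qed.

Definition Ch_functor : functor (Ch A) (Ch B) :=
  @Functor (Ch A) (Ch B) _ _ map_chain_map1 map_chain_mapM.
End termwise.

Section modules.
Variable R : pzRingType.
Implicit Types M N P : lmodType R.

Lemma mod_comp1m M N (f : {linear M -> N}) :
  ((idfun : {linear N -> N}) \o f : {linear M -> N}) = f.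
Proof. exact: linear_ext. Qed.
Lemma mod_compm1 M N (f : {linear M -> N}) :
  (f \o (idfun : {linear M -> M}) : {linear M -> N}) = f.
Proof. exact: linear_ext. Qed.
Lemma mod_compmA M N P (Q : lmodType R) (f : {linear P -> Q})
    (g : {linear N -> P}) (h : {linear M -> N}) :
  (f \o (g \o h : {linear M -> P}) : {linear M -> Q}) =
  ((f \o g : {linear N -> Q}) \o h : {linear M -> Q}).
Proof. exact: linear_ext. Qed.
Lemma mod_compDl M N P (f g : {linear N -> P}) (h : {linear M -> N}) :
  ((f + g : {linear N -> P}) \o h : {linear M -> P}) =
  (f \o h : {linear M -> P}) + (g \o h : {linear M -> P}).
Proof. exact: linear_ext. Qed.
Lemma mod_compDr M N P (f : {linear N -> P}) (g h : {linear M -> N}) :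
  (f \o (g + h : {linear M -> N}) : {linear M -> P}) =
  (f \o g : {linear M -> P}) + (f \o h : {linear M -> P}).
Proof. by apply: linear_ext => x; exact: linearD. Qed.

Definition Mod : preadditive :=
  @Preadditive (lmodType R) (fun M N => {linear M -> N} : zmodType)
    (fun M => idfun) (fun M N P g f => g \o f)
    mod_comp1m mod_compm1 mod_compmA mod_compDl mod_compDr.

Definition exact_at M N P (f : {linear M -> N}) (g : {linear N -> P}) :=
  forall y, g y = 0 <-> exists x, f x = y.

Definition short_exact M N P (f : {linear M -> N}) (g : {linear N -> P}) :=
  [/\ injective f, exact_at f g & forall z, exists y, g y = z].

Definition projective P :=
  forall M N (g : {linear M -> N}), (forall y, exists x, g x = y) ->
  forall f : {linear P -> N}, exists h : {linear P -> M}, g \o h =1 f.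

Definition injective_module (E : lmodType R) :=
  forall M N (g : {linear M -> N}), injective g ->
  forall f : {linear M -> E}, exists h : {linear N -> E}, h \o g =1 f.

Definition trivial_module M := forall x : M, x = 0.

Definition finite_projective_dimension M :=
  exists (P : nat -> lmodType R) (d : forall n, {linear P n.+1 -> P n})
      (eps : {linear P 0 -> M}),
    [/\ forall n, projective (P n),
        forall y, exists x, eps x = y,
        exact_at (d 0) eps,
        forall n, exact_at (d n.+1) (d n)
      & exists n, forall i, (n < i)%N -> trivial_module (P i)].

Definition finite_injective_dimension M :=
  exists (E : nat -> lmodType R) (d : forall n, {linear E n -> E n.+1})
      (eta : {linear M -> E 0}),
    [/\ forall n, injective_module (E n),
        injective eta,
        exact_at eta (d 0),
        forall n, exact_at (d n) (d n.+1)
      & exists n, forall i, (n < i)%N -> trivial_module (E i)].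

Definition left_ideal (J : set R) :=
  [/\ J 0, forall x y, J x -> J y -> J (x + y) & forall a x, J x -> J (a * x)].

Definition left_noetherian :=
  forall J : nat -> set R, (forall n, left_ideal (J n)) ->
    (forall n, J n `<=` J n.+1) ->
  exists m, forall n, (m <= n)%N -> J n = J m.

Definition acyclic (Y : complex Mod) :=
  forall i : int, exact_at (diff Y (i + 1)) (diff Y i).

Definition hom_exact (Y : complex Mod) P :=
  forall (i : int) (f : {linear Y (i + 1) -> P}),
    f \o diff Y (i + 1) =1 (fun _ => 0) ->
  exists g : {linear Y i -> P}, g \o diff Y i =1 f.

(* [i] identifies [M] with im(d_1); for [Y] acyclic also with ker(d_0). *)
Definition is_boundaries (Y : complex Mod) M (i : {linear M -> Y 0}) :=
  injective i /\
  forall y : Y 0, (exists m, i m = y) <-> (exists x, diff Y 0 x = y).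

Definition gorenstein_projective M :=
  exists Y : complex Mod,
    [/\ acyclic Y, forall i, projective (Y i),
        forall P, projective P -> hom_exact Y P
      & exists i : {linear M -> Y 0}, is_boundaries i].

End modules.

(* Right modules over [R] are left modules over the opposite ring [R^c];
   [R^o] is the regular module. *)
Definition gorenstein_ring (R : pzRingType) :=
  [/\ left_noetherian R, left_noetherian R^c,
      finite_injective_dimension (R^o : lmodType R)
    & finite_injective_dimension ((R^c)^o : lmodType R^c)].

Record submod (R : pzRingType) (V : lmodType R) := Submod {
  submod_pred :> {pred V};
  submodP : submod_closed submod_pred
}.

Section submodule.
Variables (R : pzRingType) (V : lmodType R) (S : submod V).
HB.instance Definition _ := GRing.isSubmodClosed.Build R V (submod_pred S) (submodP S).

Definition submod_of := {x : V | x \in submod_pred S}.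
HB.instance Definition _ := SubChoice.on submod_of.
HB.instance Definition _ := [SubChoice_isSubLmodule of submod_of by <:].
End submodule.

Section groups.
Variable G : topGroupType.

Definition is_subgroup (J : set G) :=
  [/\ J 1%g, forall x y, J x -> J y -> J (x * y)%g & forall x, J x -> J x^-1%g].

(* open for the subspace topology of [J] *)
Definition open_normal_subgroup (J N : set G) :=
  [/\ is_subgroup N, N `<=` J,
      forall x n, J x -> N n -> N (x * n * x^-1)%g
    & open (set_val @^-1` N : set (set_type J))].

Definition left_cosets (J N : set G) : set (set G) :=
  [set [set (x * n)%g | n in N] | x in J].

(* pro-p groups: profinite groups all of whose open normal subgroups have
   p-power index *)
Definition pro_p (p : nat) (J : set G) :=
  [/\ compact J, hausdorff_space (set_type J), totally_disconnected J
    & forall N, open_normal_subgroup J N ->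
        exists n : nat, (left_cosets J N #= `I_(p ^ n))%card].
End groups.

Record open_pro_p_subgroup (p : nat) (G : topGroupType) := OpenProPSubgroup {
  opp_set : set G;
  opp_subgroup : is_subgroup opp_set;
  opp_open : open opp_set;
  opp_pro_p : pro_p p opp_set
}.

Record smooth_rep (k : fieldType) (G : topGroupType) := SmoothRep {
  rep_mod :> lmodType k;
  act : G -> rep_mod -> rep_mod;
  act_linear : forall g, linear (act g);
  act1 : forall v, act 1%g v = v;
  actM : forall g h v, act (g * h)%g v = act g (act h v);
  act_smooth : forall v, open [set g | act g v = v]
}.
Arguments act {k G} _ _ _.

Record rep_hom (k : fieldType) (G : topGroupType) (V W : smooth_rep k G) :=
  RepHom {
    rep_map :> {linear V -> W};
    rep_mapJ : forall g v, rep_map (act V g v) = act W g (rep_map v)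
  }.

Section rep_category.
Variables (k : fieldType) (G : topGroupType).
Implicit Types V W Z : smooth_rep k G.

Lemma rep_ext V W (f g : rep_hom V W) : f =1 g -> f = g.
Proof.
case: f g => f Hf [g Hg] /= fg; have {}fg : f = g by exact: linear_ext.
by subst g; congr RepHom; apply: Prop_irrelevance.
Qed.

HB.instance Definition _ V g :=
  GRing.isLinear.Build k V V *:%R (act V g) (@act_linear k G V g).

HB.instance Definition _ V W := gen_eqMixin (rep_hom V W).
HB.instance Definition _ V W := gen_choiceMixin (rep_hom V W).

Lemma rep_zeroJ V W g v : (\0%R : {linear V -> W}) (act V g v) = act W g 0.
Proof. by rewrite linear0. Qed.
Definition rep_zero V W : rep_hom V W := RepHom (@rep_zeroJ V W).

Lemma rep_addJ V W (f h : rep_hom V W) g v :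
  (f \+ h : {linear V -> W}) (act V g v) = act W g (f v + h v).
Proof. by rewrite /= !rep_mapJ linearD. Qed.
Definition rep_add V W (f h : rep_hom V W) : rep_hom V W := RepHom (rep_addJ f h).

Lemma rep_oppJ V W (f : rep_hom V W) g v :
  (\- f : {linear V -> W}) (act V g v) = act W g (- f v).
Proof. by rewrite /= rep_mapJ linearN. Qed.
Definition rep_opp V W (f : rep_hom V W) : rep_hom V W := RepHom (rep_oppJ f).

Lemma rep_addA V W : associative (@rep_add V W).
Proof. by move=> f g h; apply: rep_ext => x; exact: addrA. Qed.
Lemma rep_addC V W : commutative (@rep_add V W).
Proof. by move=> f g; apply: rep_ext => x; exact: addrC. Qed.
Lemma rep_add0 V W : left_id (rep_zero V W) (@rep_add V W).
Proof. by move=> f; apply: rep_ext => x; exact: add0r. Qed.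
Lemma rep_addN V W : left_inverse (rep_zero V W) (@rep_opp V W) (@rep_add V W).
Proof. by move=> f; apply: rep_ext => x; exact: addNr. Qed.
HB.instance Definition _ V W := GRing.isZmodule.Build (rep_hom V W)
  (@rep_addA V W) (@rep_addC V W) (@rep_add0 V W) (@rep_addN V W).

Definition rep_id V : rep_hom V V := @RepHom k G V V idfun (fun _ _ => erefl).

Lemma rep_compJ V W Z (f : rep_hom W Z) (h : rep_hom V W) g v :
  (f \o h : {linear V -> Z}) (act V g v) = act Z g (f (h v)).
Proof. by rewrite /= !rep_mapJ. Qed.
Definition rep_comp V W Z (f : rep_hom W Z) (h : rep_hom V W) : rep_hom V Z :=
  RepHom (rep_compJ f h).

Lemma rep_comp1m V W (f : rep_hom V W) : rep_comp (rep_id W) f = f.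
Proof. exact: rep_ext. Qed.
Lemma rep_compm1 V W (f : rep_hom V W) : rep_comp f (rep_id V) = f.
Proof. exact: rep_ext. Qed.
Lemma rep_compmA V W Z (T : smooth_rep k G) (f : rep_hom Z T)
    (g : rep_hom W Z) (h : rep_hom V W) :
  rep_comp f (rep_comp g h) = rep_comp (rep_comp f g) h.
Proof. exact: rep_ext. Qed.
Lemma rep_compDl V W Z (f g : rep_hom W Z) (h : rep_hom V W) :
  rep_comp (f + g) h = rep_comp f h + rep_comp g h.
Proof. exact: rep_ext. Qed.
Lemma rep_compDr V W Z (f : rep_hom W Z) (g h : rep_hom V W) :
  rep_comp f (g + h) = rep_comp f g + rep_comp f h.
Proof. by apply: rep_ext => x; exact: linearD. Qed.

Definition Rep : preadditive :=
  Preadditive rep_comp1m rep_compm1 rep_compmA rep_compDl rep_compDr.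

End rep_category.

Section endomorphism_ring.
Variables (k : fieldType) (G : topGroupType) (V : smooth_rep k G).

Definition End_G := rep_hom V V.
HB.instance Definition _ := GRing.Zmodule.on End_G.
HB.instance Definition _ := GRing.Zmodule_isPzRing.Build End_G
  (@rep_compmA k G V V V V) (@rep_comp1m k G V V) (@rep_compm1 k G V V)
  (@rep_compDl k G V V V) (@rep_compDr k G V V V).

Lemma End_mulE (f g : End_G) (v : V) : (f * g : End_G) v = f (g v).
Proof. by []. Qed.
End endomorphism_ring.

Section image.
Variables (k : fieldType) (G : topGroupType) (V W : smooth_rep k G).
Variable f : rep_hom V W.

Definition im_pred : {pred W} := fun w => `[< exists v, f v = w >].

Lemma im_closed : submod_closed im_pred.
Proof.
split; first by apply/asboolP; exists 0; rewrite linear0.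
move=> a x y /asboolP[u <-] /asboolP[v <-]; apply/asboolP.
by exists (a *: u + v); rewrite linearP.
Qed.
Definition im_submod := Submod im_closed.

Lemma im_act_subproof g (w : submod_of im_submod) : act W g (val w) \in im_pred.
Proof.
by case: w => w /= /asboolP[v <-]; apply/asboolP; exists (act V g v); rewrite rep_mapJ.
Qed.
Definition im_act g (w : submod_of im_submod) : submod_of im_submod :=
  exist _ (act W g (val w)) (im_act_subproof g w).

Lemma im_act_linear g : linear (im_act g).
Proof. by move=> a x y; apply: val_inj; rewrite /= linearP. Qed.
Lemma im_act1 w : im_act 1%g w = w.
Proof. by apply: val_inj; exact: act1. Qed.
Lemma im_actM g h w : im_act (g * h)%g w = im_act g (im_act h w).
Proof. by apply: val_inj; exact: actM. Qed.
Lemma im_act_smooth w : open [set g | im_act g w = w].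
Proof.
rewrite (_ : [set _ | _] = [set g | act W g (val w) = val w]); first exact: act_smooth.
by apply/seteqP; split => g /=; [move/(congr1 val)|move=> E; apply: val_inj].
Qed.
Definition im : smooth_rep k G :=
  SmoothRep im_act_linear im_act1 im_actM im_act_smooth.
End image.

Section image_map.
Variables (k : fieldType) (G : topGroupType).
Variables (V W V' W' : smooth_rep k G).
Variables (f : rep_hom V W) (f' : rep_hom V' W').
Variables (u : rep_hom V V') (v : rep_hom W W').
Hypothesis uv : forall x, v (f x) = f' (u x).

Lemma im_map_subproof (w : im f) : v (val w) \in im_pred f'.
Proof.
by case: w => w /= /asboolP[x <-]; apply/asboolP; exists (u x); rewrite uv.
Qed.
Definition im_map_fun (w : im f) : im f' := exist _ (v (val w)) (im_map_subproof w).
Lemma im_map_linear : linear im_map_fun.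
Proof. by move=> a x y; apply: val_inj; rewrite /= linearP. Qed.
HB.instance Definition _ :=
  GRing.isLinear.Build k (im f) (im f') *:%R im_map_fun im_map_linear.
Lemma im_mapJ g w : im_map_fun (act (im f) g w) = act (im f') g (im_map_fun w).
Proof. by apply: val_inj; rewrite /= rep_mapJ. Qed.
Definition im_map : rep_hom (im f) (im f') := RepHom im_mapJ.
End image_map.

Section topological_groups.
Variable G : topGroupType.

Lemma mulg_left_continuous (a : G) : continuous (fun x : G => (a * x)%g).
Proof.
move=> x; apply: (@continuous_comp _ _ _ (fun y => (a, y))
  (fun y : G * G => (y.1 * y.2)%g)); last exact: mulg_continuous.
by apply: cvg_pair; [exact: cvg_cst|exact: cvg_id].
Qed.

Lemma mulg_right_continuous (a : G) : continuous (fun x : G => (x * a)%g).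
Proof.
move=> x; apply: (@continuous_comp _ _ _ (fun y => (y, a))
  (fun y : G * G => (y.1 * y.2)%g)); last exact: mulg_continuous.
by apply: cvg_pair; [exact: cvg_id|exact: cvg_cst].
Qed.

Lemma open_translate (a b : G) (U : set G) : open U ->
  open [set x | U (a * x * b)%g].
Proof.
move=> oU; apply: (@open_comp _ _ (fun x => (a * x * b)%g)) => // x _.
apply: (@continuous_comp _ _ _ (fun y => (a * y)%g) (fun y => (y * b)%g)).
  exact: mulg_left_continuous.
exact: mulg_right_continuous.
Qed.

Lemma open_of_subgroup (S U : set G) :
  (forall x y, S x -> S y -> S (x * y)%g) ->
  open U -> U 1%g -> U `<=` S -> open S.
Proof.
move=> SM oU U1 US; rewrite openE => s Ss; rewrite /interior nbhsE.
exists [set x | U (s^-1 * x * 1)%g].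
  by split; [exact: open_translate|rewrite /= mulVg mulg1].
by move=> x /=; rewrite mulg1 => /US Sx; rewrite -[x](mulVKg s); exact: SM.
Qed.

Lemma compact_cover_compact (A : set G) : compact A -> cover_compact A.
Proof.
pose G' : ptopologicalType := HB.pack (G : Type) (Topological.class G)
  (isPointed.Build (G : Type) 1%g).
by change (@compact G' A -> @cover_compact G' A); rewrite compact_cover.
Qed.

Lemma open_subgroup_closed (J : set G) : is_subgroup J -> open J -> closed J.
Proof.
move=> [J1 JM JV] oJ x clJ.
have /clJ [y [Jy /= Jxy]] : nbhs x [set y | J (x^-1 * y * 1)%g].
  apply: open_nbhs_nbhs; split; first exact: open_translate.
  by rewrite /= mulVg mulg1.
rewrite mulg1 in Jxy.
have -> : (x = y * (x^-1 * y)^-1)%g by rewrite invgM invgK mulVKg.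
by apply: JM => //; exact: JV.
Qed.

End topological_groups.

Section induced.
Variables (k : fieldType) (G : topGroupType) (p : nat).
Variable I : open_pro_p_subgroup p G.
Local Notation J := (opp_set I).

Definition ind_pred : {pred G -> k^o} := fun f =>
  `[< compact (closure [set g | f g != 0]) /\
      forall g i, J i -> f (g * i)%g = f g >].

Lemma ind_closed : submod_closed ind_pred.
Proof.
split.
  apply/asboolP; split => //.
  rewrite (_ : [set _ | _] = set0) ?closure0; first exact: compact0.
  by apply/seteqP; split => g /=; rewrite ?eqxx.
move=> a f h /asboolP[cf Jf] /asboolP[ch Jh]; apply/asboolP; split.
  apply: (subclosed_compact (@closed_closure _ _) (compactU cf ch)).
  rewrite -closureU; apply: closureS => g /= nz.
  have [f0|] := eqVneq (f g) 0; last by left.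
  have [h0|] := eqVneq (h g) 0; last by right.
  suff fh0 : (a *: f + h) g = 0 by rewrite fh0 eqxx in nz.
  by change (a *: f g + h g = 0); rewrite f0 h0 scaler0 addr0.
move=> g i Ji; change (a *: f (g * i)%g + h (g * i)%g = a *: f g + h g).
by rewrite Jf // Jh.
Qed.
Definition ind_submod := Submod ind_closed.

Lemma ind_coset_cover f : f \in ind_pred ->
  exists s : seq G, forall g, f g != 0 -> exists2 a, a \in s & J (a^-1 * g)%g.
Proof.
move=> /asboolP[/compact_cover_compact cf _].
have [J1 JM JV] := opp_subgroup I.
have [] := cf G setT (fun a => [set g | J (a^-1 * g * 1)%g]).
- by move=> a _; apply: open_translate; exact: opp_open.
- by move=> g _; exists g => //=; rewrite mulVg mulg1.
move=> s _ cov; exists (enum_fset s) => g fg.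
have [|a /= sa] := cov g; first exact: subset_closure.
by rewrite mulg1 => Ja; exists a.
Qed.

Lemma ind_act_subproof g (f : submod_of ind_submod) :
  (fun x => val f (g^-1 * x)%g) \in ind_pred.
Proof.
case: f => f /= /asboolP[cf Jf]; apply/asboolP; split; last first.
  by move=> x i Ji; rewrite mulgA Jf.
set A := closure _.
have cA : compact ((fun x => (g * x)%g) @` closure [set x | f x != 0]).
  apply: continuous_compact => //.
  by apply: continuous_subspaceT; exact: mulg_left_continuous.
apply: (subclosed_compact (@closed_closure _ _) cA) => x Ax.
exists (g^-1 * x)%g; last by rewrite mulVKg.
have cl : closed [set y | closure [set z | f z != 0] (g^-1 * y)%g].
  apply: (@closed_comp _ _ (fun y => (g^-1 * y)%g)); last exact: closed_closure.
  by move=> y _; exact: mulg_left_continuous.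
move: Ax; rewrite /A => Ax; apply: cl; move: x Ax; apply: closureS => y /= fy.
exact: subset_closure.
Qed.
Definition ind_act g (f : submod_of ind_submod) : submod_of ind_submod :=
  exist (fun h => h \in ind_pred) _ (ind_act_subproof g f).

Lemma ind_act_linear g : linear (ind_act g).
Proof. by move=> a x y; exact: val_inj. Qed.
Lemma ind_act1 f : ind_act 1%g f = f.
Proof. by apply: val_inj; apply/funext => x /=; rewrite invg1 mul1g. Qed.
Lemma ind_actM g h f : ind_act (g * h)%g f = ind_act g (ind_act h f).
Proof. by apply: val_inj; apply/funext => x /=; rewrite invgM mulgA. Qed.
Lemma ind_act_smooth f : open [set g | ind_act g f = f].
Proof.
have [J1 JM JV] := opp_subgroup I.
have /ind_coset_cover [s cov] := valP f.
have /asboolP [_ Jf] := valP f.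
pose U := [set g | forall a, a \in s -> J (a^-1 * g * a)%g].
apply: (@open_of_subgroup _ _ U).
- by move=> g h /= Hg Hh; rewrite ind_actM Hh.
- rewrite /U; elim: (s) => [|a t IH].
    by rewrite (_ : [set _ | _] = setT); [exact: openT|apply/seteqP; split].
  rewrite (_ : [set _ | _] = [set g | J (a^-1 * g * a)%g] `&`
     [set g | forall b, b \in t -> J (b^-1 * g * b)%g]).
    by apply: openI => //; apply: open_translate; exact: opp_open.
  apply/seteqP; split => g /=.
    move=> H; split; first by apply: H; rewrite mem_head.
    by move=> b bt; apply: H; rewrite inE bt orbT.
  by move=> [Ha Ht] b; rewrite inE => /predU1P[->//|]; exact: Ht.
- by move=> a _; rewrite mulg1 mulVg.
move=> g Ug; apply: val_inj; apply/funext => x /=.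
have eqJ a y z : J (a^-1 * y)%g -> J (a^-1 * z)%g -> val f y = val f z.
  move=> Jy Jz; rewrite -[z](mulVKg y) Jf //.
  have -> : (y^-1 * z = (a^-1 * y)^-1 * (a^-1 * z))%g.
    by rewrite invgM invgK -mulgA mulVKg.
  by apply: JM => //; exact: JV.
have [fx0|/cov[a sa Ja]] := eqVneq (val f x) 0.
  have [//|/cov[a sa Ja]] := eqVneq (val f (g^-1 * x)%g) 0; first by rewrite fx0.
  apply: (eqJ a) => //.
  have -> : (a^-1 * x = a^-1 * g * a * (a^-1 * (g^-1 * x)))%g.
    by rewrite -!mulgA mulVKg mulVKg.
  by apply: JM => //; exact: Ug.
apply: (eqJ a) => //.
have -> : (a^-1 * (g^-1 * x) = (a^-1 * g * a)^-1 * (a^-1 * x))%g.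
  by rewrite !invgM !invgK -!mulgA mulVKg.
by apply: JM => //; apply: JV; exact: Ug.
Qed.

Definition ind : smooth_rep k G :=
  SmoothRep ind_act_linear ind_act1 ind_actM ind_act_smooth.

Definition char_fun : G -> k^o := fun g => if `[< J g >] then 1 else 0.

Lemma char_fun_ind : char_fun \in ind_pred.
Proof.
have [J1 JM JV] := opp_subgroup I.
apply/asboolP; split.
  have [cJ _ _ _] := opp_pro_p I.
  rewrite (_ : [set _ | _] = J :> set G).
    rewrite -(closure_id _).1 //; exact: open_subgroup_closed (opp_subgroup I) (opp_open I).
  apply/seteqP; split => g; rewrite /= /char_fun; case: asboolP => //; rewrite ?eqxx //.
  by rewrite oner_neq0.
move=> g i Ji; rewrite /char_fun; congr (if _ then _ else _).
apply: asbool_equiv_eq; split => [Jgi|Jg]; last exact: JM.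
by rewrite -[g](mulgK i); apply: JM => //; exact: JV.
Qed.
Definition char_I : ind := exist (fun h => h \in ind_pred) char_fun char_fun_ind.

End induced.

(* I-invariants and Frobenius reciprocity: V^I is identified with
   Hom_G(ind I, V) through evaluation at the characteristic function of I *)
Section frobenius_reciprocity.
Variables (k : fieldType) (G : topGroupType) (p : nat).
Variable I : open_pro_p_subgroup p G.
Local Notation J := (opp_set I).

Definition coset_repr (g : G) : G := xget 1%g [set x | J (g^-1 * x)%g].
Local Notation crep := coset_repr.

Lemma coset_reprP g : J (g^-1 * crep g)%g.
Proof.
apply: (@xgetPex _ 1%g [set x | J (g^-1 * x)%g]); exists g; rewrite /= mulVg.
by case: (opp_subgroup I).
Qed.

Lemma coset_repr_eq g h : J (g^-1 * h)%g -> crep g = crep h.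
Proof.
have [J1 JM JV] := opp_subgroup I => Jgh.
rewrite /crep; congr xget; apply/seteqP; split => x /= Jx.
  have -> : (h^-1 * x = (g^-1 * h)^-1 * (g^-1 * x))%g.
    by rewrite invgM invgK -mulgA mulVKg.
  by apply: JM => //; exact: JV.
have -> : (g^-1 * x = (g^-1 * h) * (h^-1 * x))%g by rewrite -mulgA mulVKg.
exact: JM.
Qed.

Lemma coset_repr_inj g h : crep g = crep h -> J (g^-1 * h)%g.
Proof.
have [J1 JM JV] := opp_subgroup I => gh.
have -> : (g^-1 * h = (g^-1 * crep g) * (h^-1 * crep h)^-1)%g.
  by rewrite gh invgM invgK -mulgA mulVKg.
by apply: JM; [|apply: JV]; exact: coset_reprP.
Qed.

Lemma coset_repr_idem g : crep (crep g) = crep g.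
Proof. by apply/esym/coset_repr_eq/coset_reprP. Qed.

Definition coset_reprs := [set g | crep g = g].

Lemma ind_coset (f : ind k I) g h : J (g^-1 * h)%g -> val f h = val f g.
Proof.
by have /asboolP[_ Jf] := valP f => Jgh; rewrite -[h](mulVKg g) Jf.
Qed.

Lemma ind_val_linear a (f h : ind k I) g :
  val (a *: f + h) g = a *: val f g + val h g.
Proof. exact: (congr1 (fun u : G -> k^o => u g) (linearP val a f h)). Qed.

Lemma ind_finite_support (f : ind k I) :
  finite_set [set g | coset_reprs g /\ val f g != 0].
Proof.
have /ind_coset_cover[s cov] := valP f.
apply: (@sub_finite_set _ _ (crep @` [set` s])); last exact/finite_image/finite_seq.
move=> g /= [Rg /cov[a sa Ja]]; exists a => //.
by rewrite (coset_repr_eq Ja).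
Qed.

Section homs.
Variable V : smooth_rep k G.

Definition inv_pred : {pred V} := fun v => `[< forall i, J i -> act V i v = v >].

Lemma inv_closed : submod_closed inv_pred.
Proof.
split; first by apply/asboolP => i _; rewrite linear0.
move=> a x y /asboolP Hx /asboolP Hy; apply/asboolP => i Ji.
by rewrite linearP /= Hx // Hy.
Qed.
Definition inv_submod := Submod inv_closed.
Definition inv := submod_of inv_submod.
HB.instance Definition _ := GRing.Zmodule.on inv.

Lemma invP (v : inv) i : J i -> act V i (val v) = val v.
Proof. by have /asboolP := valP v; apply. Qed.

Definition frob_fun (v : inv) (f : ind k I) : V :=
  \sum_(r \in coset_reprs) (val f r : k) *: act V r (val v).

Lemma frob_funE v f (D : set G) : finite_set D -> D `<=` coset_reprs ->
  (forall r, coset_reprs r -> val f r != 0 -> D r) ->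
  frob_fun v f = \sum_(r <- fset_set D) (val f r : k) *: act V r (val v).
Proof.
move=> fD DR suppf; rewrite -fsbig_finite // /frob_fun; apply/esym/fsbig_widen => //.
move=> r [Rr /= nDr]; apply: contrapT => nz; apply: nDr; apply: suppf => //.
by apply/eqP => fr0; apply: nz; rewrite fr0 scale0r.
Qed.

Lemma frob_fun_linear v : linear (frob_fun v).
Proof.
move=> a f h.
pose D := [set g | coset_reprs g /\ val f g != 0] `|`
  [set g | coset_reprs g /\ val h g != 0].
have fD : finite_set D by rewrite finite_setU; split; exact: ind_finite_support.
have DR : D `<=` coset_reprs by move=> r [[]|[]].
rewrite !(@frob_funE v _ D) //.
- rewrite scaler_sumr -big_split; apply: eq_bigr => r _.
  by rewrite ind_val_linear scalerDl -scalerA.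
- by move=> r Rr hr; right.
- by move=> r Rr fr; left.
move=> r Rr nz.
have [f0|] := eqVneq (val f r) 0; last by left.
have [h0|] := eqVneq (val h r) 0; last by right.
by move: nz; rewrite ind_val_linear f0 h0 scaler0 addr0 eqxx.
Qed.
HB.instance Definition _ v :=
  GRing.isLinear.Build k (ind k I) V *:%R (frob_fun v) (frob_fun_linear v).

Lemma coset_translate_bij (g : G) :
  set_bij coset_reprs coset_reprs (fun r => crep (g * r)%g).
Proof.
split.
- by move=> r _ /=; rewrite /coset_reprs /= coset_repr_idem.
- move=> r r'; rewrite !inE => Rr Rr' /coset_repr_inj.
  by rewrite invgM -mulgA mulKg => /coset_repr_eq; rewrite Rr Rr'.
move=> r Rr /=; exists (crep (g^-1 * r)%g); first exact: coset_repr_idem.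
rewrite -[RHS]Rr; apply/esym/coset_repr_eq.
by have := coset_reprP (g^-1 * r)%g; rewrite invgM invgK -mulgA.
Qed.

Lemma frob_funJ v g f :
  frob_fun v (act (ind k I) g f) = act V g (frob_fun v f).
Proof.
rewrite {1}/frob_fun (reindex_fsbig _ _ _ _ (coset_translate_bij g)).
transitivity (\sum_(r \in coset_reprs) act V g ((val f r : k) *: act V r (val v))).
  apply: eq_fsbigr => r _.
  rewrite linearZ /=; congr (_ *: _).
    apply: ind_coset; have := coset_reprP (g * r)%g.
    by rewrite invgM -!mulgA.
  rewrite -actM -{2}(invP v (coset_reprP (g * r)%g)) -actM.
  by rewrite mulVKg.
have fD := ind_finite_support f.
rewrite (@frob_funE v f _ fD) => [|r []//|//].
rewrite linear_sum -fsbig_finite //; apply/esym/fsbig_widen.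
  by move=> r [].
move=> r [Rr /= nDr]; apply: contrapT => nz; apply: nDr; split => //.
by apply/eqP => fr0; apply: nz; rewrite fr0 scale0r linear0.
Qed.

Definition hom_of_inv (v : inv) : rep_hom (ind k I) V := RepHom (frob_funJ v).
End homs.

Lemma char_I_J i : J i -> act (ind k I) i (char_I k I) = char_I k I.
Proof.
have [J1 JM JV] := opp_subgroup I.
move=> Ji; apply: val_inj; apply/funext => x /=; rewrite /char_fun.
congr (if _ then _ else _); apply: asbool_equiv_eq; split => Jx.
  by rewrite -[x](mulVKg i); exact: JM.
by apply: JM => //; exact: JV.
Qed.

Lemma eval_char_subproof (V : smooth_rep k G) (f : rep_hom (ind k I) V) :
  f (char_I k I) \in submod_pred (inv_submod V).
Proof. by apply/asboolP => i Ji; rewrite -rep_mapJ char_I_J. Qed.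
Definition eval_char (V : smooth_rep k G) (f : rep_hom (ind k I) V) : inv V :=
  exist _ (f (char_I k I)) (eval_char_subproof f).

Lemma hom_of_invK (V : smooth_rep k G) : cancel (@hom_of_inv V) (@eval_char V).
Proof.
have [J1 JM JV] := opp_subgroup I.
have J1' : J (crep 1%g) by have := coset_reprP 1%g; rewrite invg1 mul1g.
move=> v; apply: val_inj => /=.
rewrite (@frob_funE V v _ [set crep 1%g]) //=.
- by rewrite fset_set1 big_seq_fset1 /char_fun asboolT // scale1r invP.
- by move=> _ -> /=; exact: coset_repr_idem.
move=> r Rr /=; rewrite /char_fun; case: asboolP; rewrite ?eqxx // => Jr _.
by rewrite -Rr; apply/esym/coset_repr_eq; rewrite invg1 mul1g.
Qed.

Lemma ind_generated (f : ind k I) :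
  f = frob_fun (eval_char (rep_id (ind k I))) f.
Proof.
have [J1 JM JV] := opp_subgroup I.
apply: val_inj; apply/funext => x.
pose D := [set g | coset_reprs g /\ val f g != 0] `|` [set crep x].
rewrite (@frob_funE _ _ _ D); last first.
- by move=> r Rr fr; left.
- by move=> r [[]//|/= ->]; exact: coset_repr_idem.
- by rewrite finite_setU; split => //; exact: ind_finite_support.
have fD : finite_set D.
  by rewrite finite_setU; split => //; exact: ind_finite_support.
rewrite raddf_sum fct_sumE (bigD1_seq (crep x)) /=; last first.
- exact: fset_uniq.
- by rewrite in_fset_set // inE; right.
rewrite big1_seq => [|r /andP[rx rD]].
  rewrite addr0; change (val f x = val f (crep x) * char_fun k I ((crep x)^-1 * x)%g).
  rewrite /char_fun asboolT ?mulr1.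
    by apply/esym/ind_coset/coset_reprP.
  by have := JV _ (coset_reprP x); rewrite invgM invgK.
change (val f r * char_fun k I (r^-1 * x)%g = 0).
rewrite /char_fun asboolF ?mulr0 // => /coset_repr_eq rxE; move/eqP: rx; apply.
by rewrite -rxE; move: rD; rewrite in_fset_set // inE => -[[->]|/= ->]//;
   rewrite coset_repr_idem.
Qed.

Lemma eval_charK (V : smooth_rep k G) : cancel (@eval_char V) (@hom_of_inv V).
Proof.
move=> f; apply: rep_ext => x /=.
have fD := ind_finite_support x.
rewrite [in RHS](ind_generated x) !(@frob_funE _ _ _ _ fD) => [|r []//|//|r []//|//].
by rewrite linear_sum; apply: eq_bigr => r _; rewrite linearZ /= rep_mapJ.
Qed.

Lemma hom_of_inv_natural (V W : smooth_rep k G) (f : rep_hom V W)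
    (v : inv V) (w : inv W) : f (val v) = val w ->
  rep_comp f (hom_of_inv v) = hom_of_inv w.
Proof.
move=> fvw; apply: (can_inj (@eval_charK W)); apply: val_inj => /=.
rewrite -/(eval_char (hom_of_inv v)).
have /(congr1 val) /= -> := hom_of_invK v.
by have /(congr1 val) /= -> := hom_of_invK w.
Qed.

End frobenius_reciprocity.

(* H = End_G(ind I)^op; [R^c] is the opposite ring of [R]. *)
Definition hecke (k : fieldType) (G : topGroupType) (p : nat)
    (I : open_pro_p_subgroup p G) : pzRingType := (End_G (ind k I))^c.

Section invariants.
Variables (k : fieldType) (G : topGroupType) (p : nat).
Variable I : open_pro_p_subgroup p G.
Implicit Types V W : smooth_rep k G.

Section module_structure.
Variable V : smooth_rep k G.

(* In Hom_G(ind I, V) the Hecke algebra acts by precomposition. *)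
Definition inv_scale (h : hecke k I) (v : inv I V) : inv I V :=
  eval_char (rep_comp (hom_of_inv v) h).

Lemma hom_of_inv_add (v w : inv I V) :
  hom_of_inv (v + w) = hom_of_inv v + hom_of_inv w.
Proof.
apply: (can_inj (@eval_charK _ _ _ I V)); rewrite hom_of_invK; apply: val_inj => /=.
have /(congr1 val) /= -> := hom_of_invK v.
by have /(congr1 val) /= -> := hom_of_invK w.
Qed.

Lemma inv_scaleA a b v : inv_scale a (inv_scale b v) = inv_scale (a * b) v.
Proof. by rewrite /inv_scale eval_charK -rep_compmA. Qed.
Lemma inv_scale1 : left_id 1 inv_scale.
Proof.
by move=> v; rewrite /inv_scale (@rep_compm1 _ _ (ind k I) V) hom_of_invK.
Qed.
Lemma inv_scaleDr : right_distributive inv_scale +%R.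
Proof.
move=> h v w; rewrite /inv_scale hom_of_inv_add rep_compDl; exact: val_inj.
Qed.
Lemma inv_scaleDl v : {morph inv_scale^~ v : a b / a + b}.
Proof.
move=> a b; rewrite /inv_scale (@rep_compDr _ _ (ind k I) (ind k I) V).
exact: val_inj.
Qed.
HB.instance Definition _ := GRing.Zmodule_isLmodule.Build (hecke k I) (inv I V)
  inv_scaleA inv_scale1 inv_scaleDr inv_scaleDl.
End module_structure.

Lemma inv_map_subproof V W (f : rep_hom V W) (v : inv I V) :
  f (val v) \in submod_pred (inv_submod I W).
Proof. by apply/asboolP => i Ji; rewrite -rep_mapJ invP. Qed.
Definition inv_map_fun V W (f : rep_hom V W) (v : inv I V) : inv I W :=
  exist _ (f (val v)) (inv_map_subproof f v).

Lemma inv_map_linear V W (f : rep_hom V W) :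
  linear (inv_map_fun f : inv I V -> inv I W).
Proof.
move=> h v w; apply: val_inj => /=; rewrite linearD /=; congr (_ + _).
have fv := @hom_of_inv_natural _ _ _ I V W f v (inv_map_fun f v) erefl.
change (f (hom_of_inv v ((h : End_G (ind k I)) (char_I k I))) =
  hom_of_inv (inv_map_fun f v) ((h : End_G (ind k I)) (char_I k I))).
by rewrite -fv.
Qed.
HB.instance Definition _ V W (f : rep_hom V W) :=
  GRing.isLinear.Build (hecke k I) (inv I V) (inv I W) *:%R
    (inv_map_fun f) (inv_map_linear f).
Definition inv_map V W (f : rep_hom V W) : {linear inv I V -> inv I W} :=
  inv_map_fun f.

Lemma inv_map1 V : inv_map (rep_id V) = idfun.
Proof. by apply: linear_ext => v; exact: val_inj. Qed.
Lemma inv_mapM V W Z (g : rep_hom W Z) (f : rep_hom V W) :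
  inv_map (rep_comp g f) = (inv_map g \o inv_map f : {linear _ -> _}).
Proof. by apply: linear_ext => v; exact: val_inj. Qed.

Definition U : functor (Rep k G) (Mod (hecke k I)) :=
  @Functor (Rep k G) (Mod (hecke k I)) (fun V => inv I V : lmodType (hecke k I))
    inv_map inv_map1 inv_mapM.
End invariants.

(* The tensor product V (x)_R M over R = End_G(V)^op of a representation V
   with a left R-module M: its elements are the classes of finite formal sums of
   pairs (v, m), two formal sums being identified when every balanced
   biadditive map takes the same value on them. *)
Section tensor_product.
Variables (k : fieldType) (G : topGroupType) (V : smooth_rep k G).
Implicit Types M N P : lmodType (End_G V)^c.

Section tensor.
Variable M : lmodType (End_G V)^c.

Definition balanced (A : zmodType) (b : V -> M -> A) :=
  [/\ forall x y m, b (x + y) m = b x m + b y m,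
      forall x m n, b x (m + n) = b x m + b x n
    & forall (h : End_G V) x m, b (h x) m = b x ((h : (End_G V)^c) *: m)].

Definition formal_eval (A : zmodType) (b : V -> M -> A) (s : seq (V * M)) : A :=
  \sum_(t <- s) b t.1 t.2.

Definition tensor_rel (s t : seq (V * M)) :=
  `[< forall (A : zmodType) (b : V -> M -> A), balanced b ->
        formal_eval b s = formal_eval b t >].

Lemma tensor_equiv : equiv_class_of tensor_rel.
Proof.
split=> [s|s t|t s u]; first exact/asboolP.
  by apply: asbool_equiv_eq; split => H A b bb; rewrite H.
by move=> /asboolP st /asboolP tu; apply/asboolP => A b bb; rewrite st // tu.
Qed.
Canonical tensor_equiv_rel := EquivRelPack tensor_equiv.

Definition tensor := {eq_quot tensor_equiv_rel}%qT.
HB.instance Definition _ := Choice.on tensor.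
HB.instance Definition _ := EqQuotient.on tensor.

Definition tensor_class (s : seq (V * M)) : tensor := (\pi_tensor s)%qT.

Definition tensor_lift (A : zmodType) (b : V -> M -> A) (x : tensor) : A :=
  formal_eval b (repr x).

Lemma tensor_lift_class (A : zmodType) (b : V -> M -> A) s :
  balanced b -> tensor_lift b (tensor_class s) = formal_eval b s.
Proof.
move=> bb; rewrite /tensor_lift; have : tensor_class (repr (tensor_class s)) = tensor_class s.
  by rewrite /tensor_class reprK.
by move=> /eqmodP /asboolP; apply.
Qed.

Lemma tensor_ext (x y : tensor) :
  (forall (A : zmodType) (b : V -> M -> A), balanced b ->
     tensor_lift b x = tensor_lift b y) -> x = y.
Proof. by move=> H; rewrite -[x]reprK -[y]reprK; apply/eqmodP/asboolP. Qed.

Definition tensor_zero : tensor := tensor_class [::].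
Definition tensor_add (x y : tensor) : tensor := tensor_class (repr x ++ repr y).
Definition tensor_opp (x : tensor) : tensor :=
  tensor_class [seq (- t.1, t.2) | t <- repr x].

Section lift_ops.
Variables (A : zmodType) (b : V -> M -> A).
Hypothesis bb : balanced b.

Lemma balanced0 m : b 0 m = 0.
Proof. by case: bb => bD _ _; apply: (addIr (b 0 m)); rewrite -bD !add0r. Qed.
Lemma balancedN v m : b (- v) m = - b v m.
Proof.
by case: bb => bD _ _; apply: (addIr (b v m)); rewrite -bD !addNr balanced0.
Qed.
Lemma tensor_lift0 : tensor_lift b tensor_zero = 0.
Proof. by rewrite tensor_lift_class // /formal_eval big_nil. Qed.
Lemma tensor_liftD x y :
  tensor_lift b (tensor_add x y) = tensor_lift b x + tensor_lift b y.
Proof. by rewrite tensor_lift_class // /formal_eval big_cat. Qed.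
Lemma tensor_liftN x : tensor_lift b (tensor_opp x) = - tensor_lift b x.
Proof.
rewrite tensor_lift_class // /tensor_lift /formal_eval big_map -sumrN.
by apply: eq_bigr => t _; exact: balancedN.
Qed.
End lift_ops.

Lemma tensor_addA : associative tensor_add.
Proof. by move=> x y z; apply: tensor_ext => A b bb; rewrite !tensor_liftD // addrA. Qed.
Lemma tensor_addC : commutative tensor_add.
Proof. by move=> x y; apply: tensor_ext => A b bb; rewrite !tensor_liftD // addrC. Qed.
Lemma tensor_add0 : left_id tensor_zero tensor_add.
Proof.
by move=> x; apply: tensor_ext => A b bb; rewrite tensor_liftD // tensor_lift0 // add0r.
Qed.
Lemma tensor_addN : left_inverse tensor_zero tensor_opp tensor_add.
Proof.
move=> x; apply: tensor_ext => A b bb.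
by rewrite tensor_liftD // tensor_liftN // tensor_lift0 // addNr.
Qed.
HB.instance Definition _ := GRing.isZmodule.Build tensor
  tensor_addA tensor_addC tensor_add0 tensor_addN.
End tensor.

Definition pure_tensor (M : lmodType (End_G V)^c) (v : V) (m : M) : tensor M :=
  tensor_class [:: (v, m)].

Lemma pure_tensor_balanced M : balanced (@pure_tensor M).
Proof.
split=> [x y m|x m n|h x m]; apply: tensor_ext => A b bb;
  rewrite ?tensor_liftD // !tensor_lift_class // /formal_eval !big_seq1 /=;
  by case: bb.
Qed.

Lemma tensor_lift_pure M (A : zmodType) (b : V -> M -> A) v m :
  balanced b -> tensor_lift b (pure_tensor v m) = b v m.
Proof. by move=> bb; rewrite tensor_lift_class // /formal_eval big_seq1. Qed.

Lemma tensor_lift_unique M (A : zmodType) (b : V -> M -> A)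
    (f : {additive tensor M -> A}) :
  (forall v m, f (pure_tensor v m) = b v m) -> f =1 tensor_lift b.
Proof.
move=> fb x; rewrite /tensor_lift /formal_eval -{1}[x]reprK.
elim: (repr x) => [|[v m] s IH]; first by rewrite big_nil -(raddf0 f).
rewrite big_cons -IH -fb -raddfD /=; congr (f _).
apply: tensor_ext => B c cc; rewrite tensor_liftD // !tensor_lift_class //.
by rewrite /formal_eval big_cons big_seq1.
Qed.

Definition tensor_map (M N : lmodType (End_G V)^c) (phi : V -> V)
    (psi : M -> N) (x : tensor M) : tensor N :=
  tensor_class [seq (phi t.1, psi t.2) | t <- repr x].

Lemma tensor_lift_map M N phi psi (A : zmodType) (b : V -> N -> A) (x : tensor M) :
  balanced b -> tensor_lift b (tensor_map phi psi x) =
                tensor_lift (fun v m => b (phi v) (psi m)) x.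
Proof. by move=> bb; rewrite tensor_lift_class // /formal_eval big_map. Qed.

Lemma balanced_scale M (A : zmodType) (b : V -> M -> A) (a : k) :
  balanced b -> balanced (fun v m => b (a *: v) m).
Proof.
by move=> [b1 b2 b3]; split=> [x y m|x m n|h x m] //;
   rewrite ?scalerDr // -?b3 // linearZ.
Qed.

Lemma balanced_act M (A : zmodType) (b : V -> M -> A) (g : G) :
  balanced b -> balanced (fun v m => b (act V g v) m).
Proof.
by move=> [b1 b2 b3]; split=> [x y m|x m n|h x m] //;
   rewrite ?linearD // -?b3 // rep_mapJ.
Qed.

Lemma balanced_map M N (f : {linear M -> N}) (A : zmodType) (b : V -> N -> A) :
  balanced b -> balanced (fun v m => b v (f m)).
Proof.
by move=> [b1 b2 b3]; split=> [x y m|x m n|h x m] //;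
   rewrite ?linearD ?linearZ -?b3.
Qed.

Section tensor_rep.
Variable M : lmodType (End_G V)^c.

Definition tensor_scale (a : k) : tensor M -> tensor M := tensor_map ( *:%R a) id.

Lemma tensor_lift_scale (A : zmodType) (b : V -> M -> A) a x : balanced b ->
  tensor_lift b (tensor_scale a x) = tensor_lift (fun v m => b (a *: v) m) x.
Proof. exact: tensor_lift_map. Qed.

Lemma tensor_scaleA a b x :
  tensor_scale a (tensor_scale b x) = tensor_scale (a * b) x.
Proof.
apply: tensor_ext => A c cc; have ca := balanced_scale a cc.
rewrite !tensor_lift_scale //.
by apply: eq_bigr => t _; rewrite scalerA.
Qed.
Lemma tensor_scale1 : left_id 1 tensor_scale.
Proof.
move=> x; apply: tensor_ext => A c cc; rewrite tensor_lift_scale //.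
by apply: eq_bigr => t _; rewrite scale1r.
Qed.
Lemma tensor_scaleDr : right_distributive tensor_scale +%R.
Proof.
move=> a x y; apply: tensor_ext => A c cc; have ca := balanced_scale a cc.
by rewrite tensor_lift_scale // !tensor_liftD // !tensor_lift_scale.
Qed.
Lemma tensor_scaleDl x : {morph tensor_scale^~ x : a b / a + b}.
Proof.
move=> a b; apply: tensor_ext => A c cc.
rewrite tensor_liftD // !tensor_lift_scale // -big_split.
by apply: eq_bigr => t _ /=; rewrite scalerDl; case: cc.
Qed.
HB.instance Definition _ := GRing.Zmodule_isLmodule.Build k (tensor M)
  tensor_scaleA tensor_scale1 tensor_scaleDr tensor_scaleDl.

Definition tensor_act (g : G) : tensor M -> tensor M := tensor_map (act V g) id.

Lemma tensor_lift_act (A : zmodType) (b : V -> M -> A) g x : balanced b ->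
  tensor_lift b (tensor_act g x) = tensor_lift (fun v m => b (act V g v) m) x.
Proof. exact: tensor_lift_map. Qed.

Lemma tensor_act_linear g : linear (tensor_act g).
Proof.
move=> a x y; apply: tensor_ext => A c cc.
have cg := balanced_act g cc; have ca := balanced_scale a cc.
rewrite tensor_lift_act // !tensor_liftD // tensor_lift_act // !tensor_lift_scale //.
rewrite tensor_lift_act //; congr (_ + _).
by apply: eq_bigr => t _; rewrite linearZ.
Qed.
Lemma tensor_act1 x : tensor_act 1%g x = x.
Proof.
apply: tensor_ext => A c cc; rewrite tensor_lift_act //.
by apply: eq_bigr => t _; rewrite act1.
Qed.
Lemma tensor_actM g h x : tensor_act (g * h)%g x = tensor_act g (tensor_act h x).
Proof.
apply: tensor_ext => A c cc; have cg := balanced_act g cc.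
by rewrite !tensor_lift_act //; apply: eq_bigr => t _; rewrite actM.
Qed.
Lemma tensor_act_smooth x : open [set g | tensor_act g x = x].
Proof.
pose S := [set g | forall t, t \in repr x -> act V g t.1 = t.1].
apply: (@open_of_subgroup _ _ S).
- by move=> g h /= Hg Hh; rewrite tensor_actM Hh.
- rewrite /S; elim: (repr x) => [|a s IH].
    by rewrite (_ : [set _ | _] = setT); [exact: openT|apply/seteqP; split].
  rewrite (_ : [set _ | _] = [set g | act V g a.1 = a.1] `&`
     [set g | forall t, t \in s -> act V g t.1 = t.1]).
    by apply: openI => //; exact: act_smooth.
  apply/seteqP; split => g /=.
    move=> H; split; first by apply: H; rewrite mem_head.
    by move=> b bt; apply: H; rewrite inE bt orbT.
  by move=> [Ha Ht] b; rewrite inE => /predU1P[->//|]; exact: Ht.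
- by move=> t _; rewrite act1.
move=> g Sg; apply: tensor_ext => A c cc; rewrite tensor_lift_act //.
by rewrite /tensor_lift /formal_eval !big_seq; apply: eq_bigr => t /Sg ->.
Qed.

Definition tensor_rep : smooth_rep k G :=
  SmoothRep tensor_act_linear tensor_act1 tensor_actM tensor_act_smooth.
End tensor_rep.

Section tensor_rep_map.
Variables (M N : lmodType (End_G V)^c) (f : {linear M -> N}).
Definition tensor_rep_fun : tensor_rep M -> tensor_rep N := tensor_map id f.
Lemma tensor_lift_fun (A : zmodType) (b : V -> N -> A) x : balanced b ->
  tensor_lift b (tensor_rep_fun x) = tensor_lift (fun v m => b v (f m)) x.
Proof. exact: tensor_lift_map. Qed.

Lemma tensor_rep_fun_linear : linear tensor_rep_fun.
Proof.
move=> a x y; apply: tensor_ext => A c cc.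
have cf := balanced_map f cc; have ca := balanced_scale a cc.
rewrite tensor_lift_fun // !tensor_liftD // tensor_lift_fun // !tensor_lift_scale //.
by rewrite tensor_lift_fun.
Qed.
HB.instance Definition _ := GRing.isLinear.Build k (tensor_rep M) (tensor_rep N)
  *:%R tensor_rep_fun tensor_rep_fun_linear.
Lemma tensor_rep_funJ g x :
  tensor_rep_fun (act (tensor_rep M) g x) = act (tensor_rep N) g (tensor_rep_fun x).
Proof.
apply: tensor_ext => A c cc.
have cf := balanced_map f cc; have cg := balanced_act g cc.
by rewrite tensor_lift_fun // !tensor_lift_act // tensor_lift_fun.
Qed.
Definition tensor_rep_map : rep_hom (tensor_rep M) (tensor_rep N) :=
  RepHom tensor_rep_funJ.
End tensor_rep_map.

Lemma tensor_rep_map1 M : tensor_rep_map (idfun : {linear M -> M}) = rep_id _.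
Proof.
by apply: rep_ext => x; apply: tensor_ext => A c cc; rewrite tensor_lift_fun.
Qed.
Lemma tensor_rep_mapM M N P (g : {linear N -> P}) (f : {linear M -> N}) :
  tensor_rep_map (g \o f : {linear M -> P}) =
  rep_comp (tensor_rep_map g) (tensor_rep_map f).
Proof.
apply: rep_ext => x; apply: tensor_ext => A c cc.
by have cg := balanced_map g cc; rewrite !tensor_lift_fun.
Qed.
Lemma tensor_rep_mapD M N (f g : {linear M -> N}) :
  tensor_rep_map (f + g) = tensor_rep_map f + tensor_rep_map g.
Proof.
apply: rep_ext => x; apply: tensor_ext => A c cc.
rewrite tensor_liftD // !tensor_lift_fun // -big_split.
apply: eq_bigr => t _; case: cc => _ c2 _ /=. exact: c2.
Qed.
End tensor_product.

(* B_0 X = im(X_1 -> X_0) *)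
Section boundaries.
Variables (k : fieldType) (G : topGroupType).

Definition B0_ob (X : complex (Rep k G)) : smooth_rep k G := im (diff X 0).

Lemma B0_map_subproof (X Y : complex (Rep k G)) (f : chain_map X Y)
    (x : (X (0 + 1) : smooth_rep k G)) :
  (f 0 : rep_hom _ _) ((diff X 0 : rep_hom _ _) x) =
  (diff Y 0 : rep_hom _ _) ((f (0 + 1) : rep_hom _ _) x).
Proof. exact: (congr1 (fun h : rep_hom _ _ => h x) (cmap_diff f 0)). Qed.

Definition B0_map (X Y : complex (Rep k G)) (f : chain_map X Y) :
  rep_hom (B0_ob X) (B0_ob Y) := im_map (B0_map_subproof f).

Lemma B0_map1 (X : complex (Rep k G)) : B0_map (chain_id X) = rep_id (B0_ob X).
Proof. by apply: rep_ext => x; exact: val_inj. Qed.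
Lemma B0_mapM (X Y Z : complex (Rep k G)) (g : chain_map Y Z)
    (f : chain_map X Y) :
  B0_map (chain_comp g f) = rep_comp (B0_map g) (B0_map f).
Proof. by apply: rep_ext => x; exact: val_inj. Qed.

Definition B0 : functor (Ch (Rep k G)) (Rep k G) :=
  @Functor (Ch (Rep k G)) (Rep k G) B0_ob B0_map B0_map1 B0_mapM.
End boundaries.

Section gorenstein_functors.
Variables (k : fieldType) (G : topGroupType) (p : nat).
Variable I : open_pro_p_subgroup p G.
Local Notation H := (hecke k I).

Definition F : functor (Mod H) (Rep k G) :=
  @Functor (Mod H) (Rep k G) (fun M => @tensor_rep k G (ind k I) M)
    (fun M N f => tensor_rep_map f)
    (@tensor_rep_map1 k G (ind k I)) (@tensor_rep_mapM k G (ind k I)).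

Lemma F_additive : additive_functor F.
Proof. exact: (@tensor_rep_mapD k G (ind k I)). Qed.

Definition I_projective (V : Rep k G) :=
  exists P : lmodType H, projective P /\
  exists (s : hom V (F P)) (r : hom (F P) V), r ** s = idm V.

Definition I_exact_complex (X : complex (Rep k G)) :=
  forall i : int, exact_at (fmap (U k I) (diff X (i + 1))) (fmap (U k I) (diff X i)).

Definition short_I_exact : sequence_class (Rep k G) := fun V W Z f g =>
  g ** f = 0 /\ short_exact (fmap (U k I) f) (fmap (U k I) g).

Definition in_CG (V : Rep k G) :=
  exists X : complex (Rep k G),
    [/\ forall i, I_projective (X i), I_exact_complex X & isomorphic V (B0 k G X)].

Definition CG : preadditive := full_sub in_CG.
Definition CG_sequences : sequence_class CG := sub_sequence_class short_I_exact.

Definition GProj : preadditive := @full_sub (Mod H) (@gorenstein_projective H).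
Definition GProj_sequences : sequence_class GProj :=
  @sub_sequence_class (Mod H) (@gorenstein_projective H) (@short_exact H).

(* The functor M |-> Y^M obtained from functorial factorizations in the
   Gorenstein projective model structure, through its characteristic properties;
   [gres_inc] is the natural identification of M with ker(d_0) = im(d_1). *)
Record gorenstein_resolution := GorensteinResolution {
  gres :> functor (Mod H) (Ch (Mod H));
  gres_inc : forall M : Mod H, hom M ((gres M : complex (Mod H)) 0);
  gres_inc_natural : forall (M N : Mod H) (f : hom M N),
    (fmap gres f : chain_map _ _) 0 ** gres_inc M = gres_inc N ** f;
  gres_boundaries : forall M : Mod H, is_boundaries (gres_inc M);
  gres_acyclic : forall M : Mod H, acyclic (gres M);
  gres_projective : forall (M : Mod H) (i : int), 1 <= i ->
    projective ((gres M : complex (Mod H)) i);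
  gres_dimension : forall (M : Mod H) (i : int), i <= 0 ->
    finite_projective_dimension ((gres M : complex (Mod H)) i);
  gres_gorenstein : forall M : Mod H, gorenstein_projective M <->
    forall i : int, projective ((gres M : complex (Mod H)) i)
}.

(* M |-> B_0 F Y^M *)
Definition Fbb (Y : gorenstein_resolution) : functor (Mod H) (Rep k G) :=
  comp_functor (B0 k G) (comp_functor (Ch_functor F_additive) Y).

End gorenstein_functors.

(* Main.v *)
Require Import Defs.
From HB Require Import structures.
From mathcomp Require Import all_boot all_order all_algebra.
From mathcomp Require Import finmap all_classical.
Import Defs.

(* Over a Gorenstein ring a module is Gorenstein projective as soon as it is a
   syzygy of some acyclic complex of projectives: projectives have finite
   injective dimension (Baer's criterion, H being noetherian), hence Ext^1 from
   a syzygy to a projective vanishes by dimension shifting. Conversely, a class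
   of modules whose members embed in, and are quotients of, projectives with
   cokernel, respectively kernel, in the class consists of syzygies. Applied to
   horseshoes this shows that GProj(H) is closed under extensions, and makes it
   a weakly idempotent complete Frobenius category.

   This structure is carried over to C(G) along U. The unit M -> UFM is bijective
   for M projective, so the counit FUV -> V is bijective for V I-projective. If V
   is B_0 of an I-exact complex X of I-projectives, then UV is a syzygy of UX, the
   counit of V is onto, and its kernel is that of FUV -> FUX_0. As every map from
   UV to a projective extends to UX_0, that kernel is functorial in UV, so U is
   fully faithful on C(G). For M in GProj(H) the unit of Y^M_0 restricts to an
   isomorphism of M with U B_0 F Y^M; hence U is an equivalence and M |-> B_0 F Y^M
   a quasi-inverse. *)

Set Implicit Arguments.
Unset Strict Implicit.
Unset Printing Implicit Defensive.
Import GRing.Theory.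
Local Open Scope classical_set_scope.
Local Open Scope ring_scope.

(** * Linear maps and quotient modules *)

Section linear_maps.
Variable R : pzRingType.
Implicit Types A B C M N P : lmodType R.

(** On the side of representations the obstacle is that neither functor is exact in general: [U] is
    left exact, [F] is right exact, and a short [I]-exact sequence need not be exact in Rep(G). The
    axioms of an exact category are therefore never verified inside C(G), and the adjunction is used
    only where unit or counit can be computed, at projective modules and [I]-projective
    representations. For a general [M] in GProj(H), [F M] is replaced by its image in [F Y_0], a
    subrepresentation of an [I]-projective one.

    On the side of modules the obstacle is that projectives need not be finitely generated. A
    projective is a retract of the free module on its own elements, so a finite injective
    coresolution of [H] bounds the injective dimension of all projectives at once, provided that
    direct sums of injectives are injective. This is the role of the noetherian hypothesis. *)

Definition mk_linear M N (f : M -> N) (fL : linear f) : {linear M -> N} :=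
  HB.pack f (GRing.isLinear.Build R M N *:%R f fL).

Definition surjective M N (f : M -> N) := forall y, exists x, f x = y.

Lemma linear_eq_ker_inj M N (f : {linear M -> N}) :
  (forall x, f x = 0 -> x = 0) -> injective f.
Proof.
move=> f0 x y fxy; apply/eqP; rewrite -subr_eq0; apply/eqP/f0.
by rewrite linearB /= fxy subrr.
Qed.

Lemma lift_injective A B C (i : {linear A -> B}) (f : {linear C -> B}) :
  injective i -> (forall c, exists a, i a = f c) ->
  exists g : {linear C -> A}, forall c, i (g c) = f c.
Proof.
move=> inj /choice[g ig].
have gL : linear g by move=> a x y; apply: inj; rewrite linearP !ig linearP.
by exists (mk_linear gL).
Qed.

Lemma factor_surjective B C N (p : {linear B -> C}) (f : {linear B -> N}) :
  surjective p -> (forall b, p b = 0 -> f b = 0) ->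
  exists g : {linear C -> N}, forall b, g (p b) = f b.
Proof.
move=> /choice[s ps] pf.
have fE b c : p b = p c -> f b = f c.
  move=> pbc; apply/eqP; rewrite -subr_eq0 -linearB; apply/eqP/pf.
  by rewrite linearB /= pbc subrr.
have gL : linear (f \o s).
  by move=> a x y /=; rewrite -linearP; apply: fE; rewrite linearP !ps.
by exists (mk_linear gL) => b; apply: fE; rewrite ps.
Qed.

Lemma linear_inverse M N (f : {linear M -> N}) : injective f -> surjective f ->
  exists g : {linear N -> M}, cancel f g /\ cancel g f.
Proof.
move=> fI fS; have [|g gf] := @factor_surjective _ _ _ f idfun fS.
  by move=> b fb; apply: fI; rewrite fb linear0.
by exists g; split => // y; have [x <-] := fS y; rewrite gf.
Qed.

Lemma kernel_exists B C (f : {linear B -> C}) :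
  exists A (i : {linear A -> B}), injective i /\ exact_at i f.
Proof.
pose S : {pred B} := fun x => `[< f x = 0 >].
have Scl : submod_closed S.
  split; first by apply/asboolP; rewrite linear0.
  move=> a x y /asboolP fx /asboolP fy; apply/asboolP.
  by rewrite linearP fx fy scaler0 addr0.
have valL : linear (val : submod_of (Submod Scl) -> B) by exact: linearP.
exists (submod_of (Submod Scl)), (mk_linear valL); split; first exact: val_inj.
move=> y; split=> [fy|[[x /asboolP fx] <-]//].
by exists (exist _ y (introT (asboolP _) fy)).
Qed.

Lemma image_exists M N (f : {linear M -> N}) :
  exists C (p : {linear M -> C}) (i : {linear C -> N}),
    [/\ surjective p, injective i & forall x, i (p x) = f x].
Proof.
pose S : {pred N} := fun y => `[< exists x, f x = y >].
have Scl : submod_closed S.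
  split; first by apply/asboolP; exists 0; rewrite linear0.
  move=> a x y /asboolP[u <-] /asboolP[v <-]; apply/asboolP.
  by exists (a *: u + v); rewrite linearP.
have valL : linear (val : submod_of (Submod Scl) -> N) by exact: linearP.
have valI : injective (mk_linear valL) by exact: val_inj.
have [c|p pE] := @lift_injective _ _ _ (mk_linear valL) f valI.
  have fc : f c \in S by apply/asboolP; exists c.
  by exists (exist _ (f c) fc).
exists (submod_of (Submod Scl)), p, (mk_linear valL); split => // y.
have /asboolP[x fx] := valP y; exists x; apply: valI.
by rewrite pE fx.
Qed.

Section quotient.
Variables (B : lmodType R) (S : B -> Prop).
Hypotheses (S0 : S 0) (SP : forall a x y, S x -> S y -> S (a *: x + y)).

(* The quotient is carried by the coset representatives picked by [xget]. *)
Let rep (x : B) : B := xget 0 [set y | S (y - x)].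

Let SN x : S x -> S (- x).
Proof. by move=> Sx; rewrite -[- x]addr0 -scaleN1r; exact: SP. Qed.
Let SD x y : S x -> S y -> S (x + y).
Proof. by move=> Sx Sy; rewrite -[x]scale1r; exact: SP. Qed.

Let repP x : S (rep x - x).
Proof.
by apply: (@xgetPex _ 0 [set y | S (y - x)]); exists x; rewrite /= subrr.
Qed.

Let rep_eq x y : S (x - y) -> rep x = rep y.
Proof.
move=> Sxy; rewrite /rep; congr xget; apply/seteqP; split => z /= Sz.
  by rewrite -(subrKA x); exact: SD.
by rewrite -(subrKA y); apply: SD => //; rewrite -opprB; exact: SN.
Qed.

Let rep_inj x y : rep x = rep y -> S (x - y).
Proof.
move=> xy; rewrite -(subrKA (rep x)); apply: SD; last by rewrite xy.
by rewrite -opprB; exact: SN.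
Qed.

Let repK x : rep (rep x) = rep x. Proof. exact/rep_eq/repP. Qed.

Definition quot := {x : B | rep x == x}.
HB.instance Definition _ := Choice.on quot.

Let cls (x : B) : quot := exist _ (rep x) (introT eqP (repK x)).
Let cls_eq x y : S (x - y) -> cls x = cls y.
Proof. by move=> Sxy; apply: val_inj; exact: rep_eq. Qed.
Let cls_val (u : quot) : cls (val u) = u.
Proof. by apply: val_inj; apply/eqP; exact: (valP u). Qed.
Let S_cls x : S (val (cls x) - x). Proof. exact: repP. Qed.

Definition quot_add (u v : quot) := cls (val u + val v).
Definition quot_opp (u : quot) := cls (- val u).
Definition quot_scale (a : R) (u : quot) := cls (a *: val u).

Let addE x y : quot_add (cls x) (cls y) = cls (x + y).
Proof. by apply: cls_eq; rewrite opprD addrACA; apply: SD; exact: S_cls. Qed.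
Let oppE x : quot_opp (cls x) = cls (- x).
Proof. by apply: cls_eq; rewrite -opprD; exact/SN/S_cls. Qed.
Let scaleE a x : quot_scale a (cls x) = cls (a *: x).
Proof.
by apply: cls_eq; rewrite -scalerBr -[_ *: _]addr0; exact: SP.
Qed.
Let clsW (Q : quot -> Prop) : (forall x, Q (cls x)) -> forall u, Q u.
Proof. by move=> Qc u; rewrite -(cls_val u). Qed.

Lemma quot_addA : associative quot_add.
Proof.
by elim/clsW => x; elim/clsW => y; elim/clsW => z; rewrite !addE addrA.
Qed.
Lemma quot_addC : commutative quot_add.
Proof. by elim/clsW => x; elim/clsW => y; rewrite !addE addrC. Qed.
Lemma quot_add0 : left_id (cls 0) quot_add.
Proof. by elim/clsW => x; rewrite !addE add0r. Qed.
Lemma quot_addN : left_inverse (cls 0) quot_opp quot_add.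
Proof. by elim/clsW => x; rewrite oppE addE addNr. Qed.
HB.instance Definition _ := GRing.isZmodule.Build quot
  quot_addA quot_addC quot_add0 quot_addN.
Lemma quot_scaleA a b u :
  quot_scale a (quot_scale b u) = quot_scale (a * b) u.
Proof. by elim/clsW: u => x; rewrite !scaleE scalerA. Qed.
Lemma quot_scale1 : left_id 1 quot_scale.
Proof. by elim/clsW => x; rewrite !scaleE scale1r. Qed.
Lemma quot_scaleDr : right_distributive quot_scale +%R.
Proof.
move=> a; elim/clsW => x; elim/clsW => y.
by rewrite /GRing.add /= !(addE, scaleE) scalerDr.
Qed.
Lemma quot_scaleDl u : {morph quot_scale^~ u : a b / a + b}.
Proof.
move=> a b; elim/clsW: u => x; rewrite [in RHS]/GRing.add /= !(addE, scaleE).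
by rewrite scalerDl.
Qed.
HB.instance Definition _ := GRing.Zmodule_isLmodule.Build R quot
  quot_scaleA quot_scale1 quot_scaleDr quot_scaleDl.

Lemma quotient_exists : exists C (p : {linear B -> C}),
  surjective p /\ forall x, p x = 0 <-> S x.
Proof.
have cL : linear (cls : B -> quot).
  move=> a x y; rewrite /GRing.add /GRing.scale /=.
  by rewrite -addE -scaleE.
exists quot, (mk_linear cL); split.
  by move=> y; exists (val y); exact: cls_val.
move=> x; split => [/(congr1 val)|Sx]; last first.
  by apply: cls_eq; rewrite subr0.
by move=> /= /rep_inj; rewrite subr0.
Qed.
End quotient.

Lemma cokernel_exists A B (i : {linear A -> B}) :
  exists C (p : {linear B -> C}), exact_at i p /\ surjective p.
Proof.
have [||C [p [pS pE]]] := @quotient_exists B (fun y => exists x, i x = y).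
- by exists 0; rewrite linear0.
- by move=> a _ _ [u <-] [v <-]; exists (a *: u + v); rewrite linearP.
by exists C, p.
Qed.

End linear_maps.

(** * Direct sums, dual bases and Baer's criterion *)

Section direct_sums.
Variables (R : pzRingType) (S : choiceType).
Implicit Types A M N : lmodType R.

Definition support N (d : S -> N) : set S := [set s | d s != 0].

Definition dsum_pred N : {pred S -> N} := fun d => `[< finite_set (support d) >].

Lemma support_lin N a (x y : S -> N) :
  support (a *: x + y) `<=` support x `|` support y.
Proof.
move=> s /= nz.
have [x0|] := eqVneq (x s) 0; last by left.
have [y0|] := eqVneq (y s) 0; last by right.
case/eqP: nz; change (a *: x s + y s = 0).
by rewrite x0 y0 scaler0 addr0.
Qed.

Lemma dsum_closed N : submod_closed (@dsum_pred N).
Proof.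
split.
  apply/asboolP; rewrite (_ : support _ = set0) //.
  by apply/seteqP; split => s //=; rewrite /support /= eqxx.
move=> a x y /asboolP fx /asboolP fy; apply/asboolP.
by apply: sub_finite_set (@support_lin _ _ _ _) _; rewrite finite_setU.
Qed.

Definition dsum N : lmodType R := submod_of (Submod (@dsum_closed N)).

Definition mk_dsum N (d : S -> N) (fd : finite_set (support d)) : dsum N :=
  exist _ d (introT (asboolP _) fd).

Lemma dsum_finite N (d : dsum N) : finite_set (support (val d)).
Proof. by have /asboolP := valP d. Qed.

Lemma dsumP N (c d : dsum N) : (forall s, val c s = val d s) -> c = d.
Proof. by move=> cd; apply: val_inj; apply/funext. Qed.

Lemma dsum_lin N a (x y : dsum N) s :
  val (a *: x + y) s = a *: val x s + val y s.
Proof. exact: (congr1 (fun u : S -> N => u s) (linearP val a x y)). Qed.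

Lemma dsum_support_lin N a (x y : dsum N) :
  support (val (a *: x + y)) `<=` support (val x) `|` support (val y).
Proof.
have -> : val (a *: x + y) = a *: val x + val y.
  by apply/funext => s; exact: dsum_lin.
exact: support_lin.
Qed.

Lemma dsum0 N s : val (0 : dsum N) s = 0. Proof. by []. Qed.

Lemma dsum_coord_lin N s : linear (fun d : dsum N => val d s).
Proof. by move=> a x y; exact: dsum_lin. Qed.
Definition dsum_coord N s : {linear dsum N -> N} := mk_linear (@dsum_coord_lin N s).

Lemma dsum_map_finite M N (f : {linear M -> N}) (d : dsum M) :
  finite_set (support (fun s => f (val d s))).
Proof.
apply: sub_finite_set (dsum_finite d) => s; rewrite /support /=.
by apply: contra_neq => ->; rewrite linear0.
Qed.
Lemma dsum_map_linear M N (f : {linear M -> N}) :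
  linear (fun d => mk_dsum (dsum_map_finite f d)).
Proof.
by move=> a x y; apply: dsumP => s; rewrite [RHS]dsum_lin -linearP -dsum_lin.
Qed.
Definition dsum_map M N (f : {linear M -> N}) : {linear dsum M -> dsum N} :=
  mk_linear (dsum_map_linear f).

Lemma dsum_short_exact A M N (i : {linear A -> M}) (p : {linear M -> N}) :
  short_exact i p -> short_exact (dsum_map i) (dsum_map p).
Proof.
move=> [iI ip pS]; split.
- move=> x y /(congr1 val) xy; apply: dsumP => s; apply: iI.
  exact: (congr1 (@^~ s) xy).
- move=> y; split=> [/(congr1 val) py|[x <-]]; last first.
    by apply: dsumP => s /=; apply/ip; exists (val x s).
  have /choice[x xy] : forall s, exists x, i x = val y s.
    by move=> s; apply/ip; exact: (congr1 (@^~ s) py).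
  have fx : finite_set (support x).
    apply: sub_finite_set (dsum_finite y) => s; rewrite /support /= -xy.
    by apply: contra_neq => ix; apply: iI; rewrite ix linear0.
  by exists (mk_dsum fx); apply: dsumP => s /=.
move=> z; have /choice[y yz] : forall s, exists y, p y = val z s by move=> s.
(* The chosen preimages of zero coordinates may be nonzero; they are reset to 0 to keep the support
   finite. *)
have fy : finite_set (support (fun s => if val z s == 0 then 0 else y s)).
  apply: sub_finite_set (dsum_finite z) => s; rewrite /support /=.
  by case: ifP => //; rewrite eqxx.
exists (mk_dsum fy); apply: dsumP => s /=.
by case: eqP => [->|_]; rewrite ?linear0.
Qed.
End direct_sums.

Section free_modules.
Variables (R : pzRingType) (P : lmodType R).
Local Notation free := (@dsum R P R^o).

Definition comb (d : free) : P := \sum_(s \in [set: P]) (val d s : R) *: s.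

Lemma combE (d : free) D : finite_set D -> support (val d) `<=` D ->
  comb d = \sum_(s <- fset_set D) (val d s : R) *: s.
Proof.
move=> fD dD; rewrite -fsbig_finite // /comb; apply/esym/fsbig_widen => //.
move=> s [_ /= nDs]; apply: contrapT => nz; apply: nDs; apply: dD.
by apply/eqP => ds0; apply: nz; rewrite ds0 scale0r.
Qed.

Lemma comb_linear : linear comb.
Proof.
move=> a x y.
have fD : finite_set (support (val x) `|` support (val y)).
  by rewrite finite_setU; split; exact: dsum_finite.
rewrite (@combE (a *: x + y) _ fD); last exact: dsum_support_lin.
rewrite (@combE x _ fD); last by move=> s xs; left.
rewrite (@combE y _ fD); last by move=> s ys; right.
rewrite scaler_sumr -big_split; apply: eq_bigr => s _.
by rewrite dsum_lin scalerDl scalerA.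
Qed.

Lemma comb_surjective : surjective comb.
Proof.
move=> m.
have supp : support (fun s : P => (if s == m then 1 else 0) : R^o) `<=` [set m].
  by move=> s; rewrite /support /=; case: (s =P m) => // _; rewrite eqxx.
have fd := sub_finite_set supp (finite_set1 m).
exists (mk_dsum fd).
rewrite (@combE (mk_dsum fd) _ (finite_set1 m) supp) fset_set1 big_seq_fset1 /=.
by rewrite eqxx scale1r.
Qed.

Lemma projective_retract : projective P ->
  exists s : {linear P -> free}, forall m, comb (s m) = m.
Proof.
by move=> /(_ _ _ (mk_linear comb_linear) comb_surjective idfun)[s]; exists s.
Qed.

(** The expansion is stated for every duplicate-free list containing [t], because two expansions can
    then be added along a common list; [unit_surjective] relies on this form. *)
Lemma dual_basis : projective P ->
  exists phi : P -> {linear P -> R^o}, forall m, exists t : seq P,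
    forall t', uniq t' -> {subset t <= t'} ->
      m = \sum_(s <- t') (phi s m : R) *: s.
Proof.
move=> /projective_retract[sg sgK].
exists (fun s => (@dsum_coord _ _ R^o s) \o sg) => m.
exists (fset_set (support (val (sg m)))) => t' ut' tt'.
rewrite -[LHS]sgK (@combE _ [set` t']); last 2 first.
- exact: finite_seq.
- by move=> s /= ss; apply: tt'; rewrite in_fset_set ?inE //; exact: dsum_finite.
have tt : perm_eq (fset_set [set` t']) t'.
  apply: uniq_perm => // s.
  by rewrite in_fset_set ?inE; [apply/idP/idP; rewrite inE|exact: finite_seq].
by rewrite (perm_big _ tt).
Qed.
End free_modules.

Section baer_criterion.
Variable R : pzRingType.

(* Linear maps from a left ideal of [R] to [D] are given by their graphs. *)
Definition baer (D : lmodType R) := forall Phi : R -> D -> Prop, Phi 0 0 ->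
  (forall c a b x y, Phi a x -> Phi b y -> Phi (c * a + b) (c *: x + y)) ->
  (forall x, Phi 0 x -> x = 0) ->
  exists e, forall a x, Phi a x -> x = a *: e.

(** The graph [Phi] is a linear map on the left ideal of its first components; [e] is the value at 1
    of an extension of that map to [R]. *)
Lemma injective_baer (E : lmodType R) : injective_module E -> baer E.
Proof.
move=> injE Phi Phi0 PhiP Phiu.
have uniqPhi a x y : Phi a x -> Phi a y -> x = y.
  move=> ax ay; apply/eqP; rewrite -subr_eq0 addrC -scaleN1r; apply/eqP/Phiu.
  by rewrite -(addNr a) -[- a]mulN1r; apply: PhiP.
pose S : {pred R^o} := fun a => `[< exists x, Phi a x >].
have Scl : submod_closed S.
  split; first by apply/asboolP; exists 0.
  move=> c a b /asboolP[x ax] /asboolP[y y_b]; apply/asboolP.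
  by exists (c *: x + y); exact: PhiP.
have valL : linear (val : submod_of (Submod Scl) -> R^o) by exact: linearP.
have /choice[f fP] : forall u : submod_of (Submod Scl), exists x, Phi (val u) x.
  by move=> u; have /asboolP := valP u.
have fL : linear f.
  move=> c u v; apply: (uniqPhi (val (c *: u + v))) => //.
  by rewrite (valL c u v : _ = c * _ + _); exact: PhiP.
have [|h hE] := injE _ _ (mk_linear valL) _ (mk_linear fL); first exact: val_inj.
exists (h 1) => a x ax.
have aS : a \in S by apply/asboolP; exists x.
have -> : a *: h 1 = h a by rewrite -linearZ; congr (h _); exact: mulr1.
apply: (uniqPhi a) => //; have /= -> := hE (exist _ a aS).
exact: (fP (exist _ a aS)).
Qed.

Section extension.
Variables (D M N : lmodType R) (g : {linear M -> N}) (f : {linear M -> D}).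
Hypotheses (baerD : baer D) (gI : injective g).

(** Graphs of linear maps from submodules of [N] to [D] that extend [f] along [g]. By linearity, the
    last condition says that the graph is single-valued. *)
Let good (X : set (N * D)) :=
  [/\ forall m, X (g m, f m),
      forall c u v, X u -> X v -> X (c *: u + v)
    & forall x, X (0, x) -> x = 0].

Let good_union (F : set (set (N * D))) X0 : F `<=` good -> F X0 ->
  total_on F subset -> good (\bigcup_(X in F) X).
Proof.
move=> Fg FX0 tot; split=> [m|c u v [X FX Xu] [Y FY Yv]|x [X FX Xx]].
- by exists X0 => //; have [] := Fg _ FX0.
- have [XY|YX] := tot _ _ FX FY.
    by exists Y => //; have [_ lin _] := Fg _ FY; apply: lin => //; exact: XY.
  by exists X => //; have [_ lin _] := Fg _ FX; apply: lin => //; exact: YX.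
by have [_ _ ] := Fg _ FX; apply.
Qed.

Let good_start : good [set (g m, f m) | m in [set: M]].
Proof.
split=> [m|c _ _ [m _ <-] [m' _ <-]|x [m _ [gm <-]]]; first by exists m.
  by exists (c *: m + m') => //; rewrite !linearP.
by have -> : m = 0; [apply: gI; rewrite gm linear0|rewrite linear0].
Qed.

Let good_max : exists X, good X /\ forall Y, good Y -> X `<=` Y -> Y `<=` X.
Proof.
have [F Fg tot|X [[X0|Xg] Xmax]] := @Zorn_bigcup _ [set X | X = set0 \/ good X].
- have [[X0 FX0 X0n]|none] := pselect (exists2 X0, F X0 & X0 !=set0); last first.
    left; apply/seteqP; split => // x [X FX Xx]; apply: none.
    by exists X => //; exists x.
  right; rewrite (_ : \bigcup_(X in F) X = \bigcup_(X in F `&` good) X).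
    apply: (@good_union _ X0) => [X []//||X Y [FX _] [FY _]]; last exact: tot.
    split => //; have [X00|//] := Fg _ FX0.
    by move: X0n; rewrite X00 => -[].
  apply/seteqP; split => x [X]; last by move=> [FX _]; exists X.
  move=> FX Xx; exists X => //; split => //.
  by have [X00|//] := Fg _ FX; rewrite X00 in Xx.
- exfalso; apply: Xmax (or_intror good_start); rewrite X0; split => //.
  by move=> /(_ (g 0, f 0)); apply; exists 0.
exists X; split => // Y Yg XY; apply: contrapT => nYX.
by apply: Xmax (or_intror Yg); split.
Qed.

Lemma baer_extension : exists h : {linear N -> D}, h \o g =1 f.
Proof.
have [X [[Xgf Xlin X0] Xmax]] := good_max.
have X00 : X (0, 0) by have := Xgf 0; rewrite !linear0.
have XZ c u : X u -> X (c *: u) by move=> Xu; rewrite -[_ *: _]addr0; exact: Xlin.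
have XB u v : X u -> X v -> X (u - v).
  by move=> Xu Xv; rewrite addrC -scaleN1r; exact: Xlin.
have Xu n x y : X (n, x) -> X (n, y) -> x = y.
  move=> nx ny; apply/eqP; rewrite -subr_eq0; apply/eqP/X0.
  by have : X (n - n, x - y) := XB _ _ nx ny; rewrite subrr.
have total n : exists x, X (n, x).
  (* The scalars [a] with [a *: n] in the domain of [X] form a left ideal. An element [e]
     representing the induced map on this ideal is a consistent value at [n], so [Y] is again a
     graph and maximality puts [(n, e)] in [X]. *)
  have [|c a b x y|x|e eE] := baerD (Phi := fun a x => X (a *: n, x)).
  - by rewrite scale0r.
  - move=> ax b_y; rewrite scalerDl -scalerA.
    exact: (Xlin c (a *: n, x) (b *: n, y)).
  - by rewrite scale0r; exact: X0.
  pose Y : set (N * D) := [set u | exists2 v, X v & exists a, u = v + a *: (n, e)].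
  exists e; apply: (Xmax Y); last by exists 0 => //; exists 1; rewrite add0r scale1r.
    split=> [m|c _ _ [u Xu' [a ->]] [v Xv [b ->]]|x [[w z] Xv [a]]].
    - by exists (g m, f m) => //; exists 0; rewrite scale0r addr0.
    - exists (c *: u + v); first exact: Xlin.
      by exists (c * a + b); rewrite scalerDr scalerA addrACA scalerDl.
    rewrite /GRing.add /GRing.scale /= /add_pair /scale_pair /= => -[w0 ->].
    have wE : w = (- a) *: n by apply/eqP; rewrite scaleNr -addr_eq0 -w0.
    rewrite wE in Xv; rewrite (eE _ _ Xv) -scalerDl addNr scale0r //.
  by move=> u Xu'; exists u => //; exists 0; rewrite scale0r addr0.
have /choice[h hP] := total.
have hL : linear h.
  move=> c x y; apply: (Xu (c *: x + y)) => //.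
  exact: (Xlin c (x, h x) (y, h y)).
by exists (mk_linear hL) => m /=; apply: (Xu (g m)).
Qed.
End extension.

Lemma baer_injective (D : lmodType R) : baer D -> injective_module D.
Proof. by move=> bD M N g gI f; exact: baer_extension. Qed.

(* A linear map from a left ideal to [dsum S E] meets only finitely many
   summands: otherwise the subideals mapped into the first n of infinitely many
   summands form a strictly increasing chain. *)
Lemma dsum_injective (S : choiceType) (E : lmodType R) : left_noetherian R ->
  injective_module E -> injective_module (@dsum R S E).
Proof.
move=> noeth injE; apply: baer_injective => Phi Phi0 PhiP Phiu.
have uniqPhi a x y : Phi a x -> Phi a y -> x = y.
  move=> ax ay; apply/eqP; rewrite -subr_eq0 addrC -scaleN1r; apply/eqP/Phiu.
  by rewrite -(addNr a) -[- a]mulN1r; apply: PhiP.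
pose T : set S := [set s | exists a d, Phi a d /\ val d s != 0].
have finT : finite_set T.
  apply: contrapT => /infiniteP/card_leP[s_].
  pose s n := val (s_ (SigSub (mem_set (I : [set: nat] n)))).
  have sI : injective s.
    by move=> m n /val_inj /(inj (in_setT _) (in_setT _)) /(congr1 val).
  have sT n : T (s n).
    by have := valP (s_ (SigSub (mem_set (I : [set: nat] n)))); rewrite inE.
  pose J n : set R := [set a | exists d,
    Phi a d /\ forall m, (n <= m)%N -> val d (s m) = 0].
  have [n|n a|m Jm] := noeth J.
  - split; first by exists 0.
      move=> a b [d [ad d0]] [e [be e0]]; exists (1 *: d + e); split.
        by rewrite -[a]mul1r; exact: PhiP.
      by move=> m nm; rewrite dsum_lin d0 // e0 // scaler0 addr0.
    move=> c a [d [ad d0]]; exists (c *: d + 0); split.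
      by rewrite -[_ * _]addr0; exact: PhiP.
    by move=> m nm; rewrite dsum_lin d0 // scaler0 addr0.
  - by move=> [d [ad d0]]; exists d; split => // m nm; apply: d0; exact: ltnW.
  (* The image of this [a] has a nonzero coordinate at [s m]. Finite support puts [a] in some [J n]
     with [m <= n], hence in [J m], where that coordinate must vanish. *)
  have [a [d [ad dm]]] := sT m.
  suff [d' [ad' d0]] : J m a by move: dm; rewrite (uniqPhi _ _ _ ad ad') d0 ?eqxx.
  have [n [dn mn]] : exists n, (forall l, (n <= l)%N -> val d (s l) = 0) /\ (m <= n)%N.
    have fin : finite_set (s @^-1` support (val d)).
      by apply: finite_preimage; [move=> x y _ _; exact: sI|exact: dsum_finite].
    have [b bP] : exists b, forall l, val d (s l) != 0 -> (l < b)%N.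
      exists (\max_(l <- fset_set (s @^-1` support (val d))) l.+1) => l dl.
      rewrite (bigD1_seq l) ?fset_uniq ?in_fset_set ?inE //.
      exact: leq_maxl.
    exists (maxn m b); split; last exact: leq_maxl.
    move=> l; rewrite geq_max => /andP[_ bl]; apply/eqP; apply: contraT => /bP.
    by rewrite ltnNge bl.
  by rewrite -(Jm n mn); exists d.
(* Baer's criterion for [E] is applied one coordinate at a time. Outside [T] every element would not
   do: 0 is imposed there so that the family [e] has finite support. *)
have /choice[e eE] : forall s, exists es, (~ T s -> es = 0) /\
    forall a d, Phi a d -> val d s = a *: es.
  move=> s; have [Ts|nTs] := pselect (T s); last first.
    exists 0; split => // a d ad; rewrite scaler0; apply: contrapT => nz.
    by apply: nTs; exists a, d; split => //; apply/eqP.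
  have [||x [d [d0 <-]]|es esE] := injective_baer injE
      (Phi := fun a x => exists d, Phi a d /\ val d s = x).
  - by exists 0.
  - move=> c a b _ _ [x [ax <-]] [y [y_b <-]]; exists (c *: x + y).
    by split; [exact: PhiP|exact: dsum_lin].
  - by rewrite (Phiu _ d0).
  by exists es; split => // a d ad; apply: esE; exists d.
have fe : finite_set (support e).
  apply: sub_finite_set finT => s /= nz; apply: contrapT => nT.
  by rewrite /support /= (eE s).1 // eqxx in nz.
exists (mk_dsum fe) => a d ad; apply: dsumP => s.
rewrite ((eE s).2 _ _ ad).
by rewrite -[a *: mk_dsum fe]addr0 dsum_lin dsum0 addr0.
Qed.
End baer_criterion.

(** * Syzygies of acyclic complexes of projectives *)

Lemma dependent_choice (T : Type) (S : T -> Type) (Q : forall t, S t -> Prop) :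
  (forall t, exists s, Q t s) -> exists f : forall t, S t, forall t, Q t (f t).
Proof. by move=> H; exists (fun t => sval (cid (H t))) => t; exact: svalP. Qed.

Section short_exact_sequences.
Variable R : pzRingType.
Implicit Types A B C D E M N P Q : lmodType R.

Lemma exact_at_comp0 A B C (i : {linear A -> B}) (p : {linear B -> C}) a :
  exact_at i p -> p (i a) = 0.
Proof. by move=> ip; apply/ip; exists a. Qed.

Lemma short_exact_kernel B C (p : {linear B -> C}) : surjective p ->
  exists A (i : {linear A -> B}), short_exact i p.
Proof. by have [A [i [iI ip]]] := kernel_exists p; exists A, i. Qed.

Lemma short_exact_cokernel A B (i : {linear A -> B}) : injective i ->
  exists C (p : {linear B -> C}), short_exact i p.
Proof. by have [C [p [ip pS]]] := cokernel_exists i; exists C, p. Qed.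

Lemma trivial_module_exists : exists Z : lmodType R, trivial_module Z.
Proof.
have [Z [i [iI ip]]] := kernel_exists (idfun : {linear R^o -> R^o}).
exists Z => x; apply: iI; rewrite linear0; apply/ip; by exists x.
Qed.

Lemma short_exact_id_l (Z M : lmodType R) : trivial_module Z ->
  short_exact (\0 : {linear Z -> M}) (idfun : {linear M -> M}).
Proof.
move=> Z0; split=> [x y _|y|z]; first by rewrite (Z0 x) (Z0 y).
  by split=> [/= ->|[x <-]//]; exists 0.
by exists z.
Qed.

Lemma short_exact_id_r (Z M : lmodType R) : trivial_module Z ->
  short_exact (idfun : {linear M -> M}) (\0 : {linear M -> Z}).
Proof.
move=> Z0; split=> [x y //|y|z]; last by exists 0; rewrite (Z0 z).
by split=> // _; exists y.
Qed.

(** Third isomorphism theorem: [Q] is D/A, with submodule B/A and quotient D/B. An extension-closed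
    class containing [C] and [E] thus contains the cokernel of the composite. *)
Lemma short_exact_mono_comp A B C D E (i : {linear A -> B}) (p : {linear B -> C})
    (j : {linear B -> D}) (q : {linear D -> E}) :
  short_exact i p -> short_exact j q ->
  exists Q (r : {linear D -> Q}) (u : {linear C -> Q}) (v : {linear Q -> E}),
    short_exact (j \o i : {linear A -> D}) r /\ short_exact u v.
Proof.
move=> [iI ip pS] [jI jq qS].
have jiI : injective (j \o i : {linear A -> D}) by move=> x y /jI/iI.
have [Q [r [_ jir rS]]] := short_exact_cokernel jiI.
have rji a : r (j (i a)) = 0 by apply/jir; exists a.
have [|u uE] := @factor_surjective _ _ _ _ p (r \o j : {linear B -> Q}) pS.
  by move=> b /ip[a <-] /=.
have [|v vE] := @factor_surjective _ _ _ _ r q rS.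
  by move=> d /jir[a <-] /=; apply/jq; exists (i a).
exists Q, r, u, v; split=> //; split.
- apply: linear_eq_ker_inj => c; have [b <-] := pS c.
  by rewrite uE /= => /jir[a /= /jI <-]; exact: exact_at_comp0.
- move=> z; have [d <-] := rS z; rewrite vE; split=> [/jq[b <-]|[c]].
    by exists (p b); rewrite uE.
  by have [b <-] := pS c; rewrite uE /= -vE => <-; rewrite vE; apply/jq; exists b.
by move=> z; have [d <-] := qS z; exists (r d).
Qed.

(** Dual form: the kernel of the composite is the preimage of [A] under [q], hence an extension of
    [A] by [D]. *)
Lemma short_exact_epi_comp A B C D E (i : {linear A -> B}) (p : {linear B -> C})
    (j : {linear D -> E}) (q : {linear E -> B}) :
  short_exact i p -> short_exact j q ->
  exists (K : lmodType R) (k : {linear K -> E}) (u : {linear D -> K})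
      (v : {linear K -> A}),
    short_exact k (p \o q : {linear E -> C}) /\ short_exact u v.
Proof.
move=> [iI ip pS] [jI jq qS].
have pqS : surjective (p \o q : {linear E -> C}).
  by move=> c; have [b <-] := pS c; have [e <-] := qS b; exists e.
have [K [k [kI kpq _]]] := short_exact_kernel pqS.
have [|u uE] := @lift_injective _ _ _ _ k j kI.
  by move=> d; apply/kpq; rewrite /= (exact_at_comp0 d jq) linear0.
have [|v vE] := @lift_injective _ _ _ _ i (q \o k : {linear K -> B}) iI.
  by move=> x /=; apply/ip; apply/kpq; exists x.
exists K, k, u, v; split=> //; split.
- by move=> x y xy; apply: jI; rewrite -!uE xy.
- move=> x; split=> [vx|[d <-]].
    have /jq[d dE] : q (k x) = 0 by have := vE x; rewrite vx linear0.
    by exists d; apply: kI; rewrite uE.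
  by apply: iI; rewrite vE /= uE linear0; exact: exact_at_comp0.
move=> a; have [e eE] := qS (i a).
have /kpq[x xe] : p (q e) = 0 by rewrite eE; exact: exact_at_comp0.
by exists x; apply: iI; rewrite vE /= xe.
Qed.

Lemma projective_sub_retract P Q (s : {linear P -> Q}) (r : {linear Q -> P}) :
  cancel s r -> projective Q -> projective P.
Proof.
move=> sr prQ M N g gS f.
have [h hE] := prQ _ _ _ gS (f \o r : {linear Q -> N}).
by exists (h \o s : {linear P -> M}) => x; have /= -> := hE (s x); rewrite sr.
Qed.

Lemma projective_trivial (Z : lmodType R) : trivial_module Z -> projective Z.
Proof.
by move=> Z0 M N g gS f; exists \0 => x /=; rewrite (Z0 x) !linear0.
Qed.

Lemma pair0r_linear M N : linear (fun x : M => (x, 0) : M * N).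
Proof.
move=> a x y; rewrite /GRing.add /GRing.scale /= /add_pair /scale_pair /=.
by rewrite scaler0 addr0.
Qed.
Lemma pair0l_linear M N : linear (fun y : N => (0, y) : M * N).
Proof.
move=> a x y; rewrite /GRing.add /GRing.scale /= /add_pair /scale_pair /=.
by rewrite scaler0 addr0.
Qed.
Definition pair_inl M N : {linear M -> (M * N)%type} := mk_linear (@pair0r_linear M N).
Definition pair_inr M N : {linear N -> (M * N)%type} := mk_linear (@pair0l_linear M N).

Lemma projective_pair P Q : projective P -> projective Q ->
  projective (P * Q)%type.
Proof.
move=> prP prQ M N g gS f.
have [h1 h1E] := prP _ _ _ gS (f \o pair_inl P Q : {linear P -> N}).
have [h2 h2E] := prQ _ _ _ gS (f \o pair_inr P Q : {linear Q -> N}).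
have L : linear (fun x : P * Q => h1 x.1 + h2 x.2).
  by move=> a x y; rewrite /= !linearP scalerDr addrACA.
exists (mk_linear L) => -[x y] /=; rewrite linearD.
have /= -> := h1E x; have /= -> := h2E y; rewrite -linearD.
by rewrite /GRing.add /= /add_pair /= addr0 add0r.
Qed.

(** Vanishing of Ext^1(C, N), expressed without a resolution: the obstruction to extending a map
    into [N] along a monomorphism with cokernel [C] lies in that group. *)
Definition ext1_zero C N := forall A B (i : {linear A -> B}) (p : {linear B -> C}),
  short_exact i p -> forall f : {linear A -> N}, exists h : {linear B -> N},
  forall a, h (i a) = f a.

Lemma ext1_zero_retract C N P (s : {linear P -> N}) (r : {linear N -> P}) :
  cancel s r -> ext1_zero C N -> ext1_zero C P.
Proof.
move=> sr eN A B i p ip f.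
have [h hE] := eN _ _ _ _ ip (s \o f : {linear A -> N}).
by exists (r \o h : {linear B -> P}) => a /=; rewrite hE /= sr.
Qed.

(** Injective dimension at most [n], unfolded one cosyzygy at a time, so that dimension shifting is
    an induction on [n] that carries no coresolution along. *)
Fixpoint idim_le n N := if n is n'.+1 then
    exists E N' (i : {linear N -> E}) (p : {linear E -> N'}),
      [/\ injective_module E, short_exact i p & idim_le n' N']
  else injective_module N.

Lemma dsum_idim_le (S : choiceType) n N : left_noetherian R ->
  idim_le n N -> idim_le n (@dsum R S N).
Proof.
move=> noeth; elim: n N => [|n IH] N /=; first exact: dsum_injective.
move=> [E [N' [i [p [injE ip N'n]]]]].
exists (dsum S E), (dsum S N'), (dsum_map S i), (dsum_map S p).
split; [exact: dsum_injective|exact: dsum_short_exact|exact: IH].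
Qed.

Lemma finite_injective_dimension_idim_le N :
  finite_injective_dimension N -> exists n, idim_le n N.
Proof.
move=> [E [d [eta [injE etaI eta0 dE [n En]]]]]; exists n.
elim: n N E d eta injE etaI eta0 dE En => [|n IH] N E d eta injE etaI eta0 dE En /=.
  have etaS : surjective eta.
    by move=> y; apply/eta0; apply: En.
  have [g [eg ge]] := linear_inverse etaI etaS.
  move=> A B i iI f; have [h hE] := injE 0 _ _ _ iI (eta \o f : {linear A -> E 0}).
  by exists (g \o h : {linear B -> N}) => x /=; have /= -> := hE x.
have [N' [p [i [pS iI ipE]]]] := image_exists (d 0).
exists (E 0), N', eta, p; split => //.
  split => // y; rewrite -eta0 -ipE; split=> [->|iy]; first exact: linear0.
  by apply: iI; rewrite linear0.
apply: (IH N' (fun n => E n.+1) (fun n => d n.+1) i) => //.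
- move=> y; rewrite dE; split=> [[x <-]|[x <-]].
    by exists (p x); rewrite ipE.
  by have [z <-] := pS x; exists z; rewrite ipE.
- by move=> m mn; apply: En.
Qed.

End short_exact_sequences.

Section syzygies.
Variable R : pzRingType.
Implicit Types A B C M N P Q : lmodType R.

(** Exactness under Hom into projectives is left out. The degree is arbitrary, so that one complex
    exhibits the images of all its differentials as syzygies. *)
Definition syzygy M := exists Y : complex (Mod R),
  [/\ acyclic Y, forall i, projective (Y i) &
    exists i (e : {linear M -> Y i}), injective e /\
      forall y, (exists m, e m = y) <-> (exists x, (diff Y i : {linear _ -> _}) x = y)].

Definition proj_step A C := exists P (i : {linear A -> P}) (p : {linear P -> C}),
  projective P /\ short_exact i p.

Lemma syzygy_left M : syzygy M -> exists M', syzygy M' /\ proj_step M' M.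
Proof.
move=> [Y [acY prY [i [e [eI eE]]]]].
have [M' [p [j [pS jI jp]]]] := image_exists (diff Y (i + 1) : {linear _ -> _}).
exists M'; split.
  exists Y; split => //; exists (i + 1), j; split => // y.
  split=> [[m <-]|[x <-]]; last by exists (p x).
  by have [x <-] := pS m; exists x; rewrite jp.
have [|q qE] := @lift_injective _ _ _ _ e (diff Y i : {linear _ -> _}) eI.
  by move=> x; apply/eE; exists x.
exists (Y (i + 1)), j, q; split => //; split => // [y|m].
  split=> [qy|[x <-]].
    have /acY[x <-] : (diff Y i : {linear _ -> _}) y = 0 by rewrite -qE qy linear0.
    by exists (p x); rewrite jp.
  apply: eI; rewrite qE linear0; apply/acY.
  by have [z <-] := pS x; exists z; rewrite jp.
have /eE[x xE] : exists m', e m' = e m by exists m.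
by exists x; apply: eI; rewrite qE.
Qed.

Lemma syzygy_right M : syzygy M -> exists M', syzygy M' /\ proj_step M M'.
Proof.
(* [diff Y i] starts in degree [i + 1]; the degree is rewritten in this form to make the outgoing
   differential available. *)
move=> [Y [acY prY [i]]]; rewrite -(subrK 1 i); move: (i - 1) => {}i [e [eI eE]].
have [M' [p [j [pS jI jp]]]] := image_exists (diff Y i : {linear _ -> _}).
exists M'; split.
  exists Y; split => //; exists i, j; split => // y.
  split=> [[m <-]|[x <-]]; last by exists (p x).
  by have [x <-] := pS m; exists x; rewrite jp.
exists (Y (i + 1)), e, p; split => //; split => // y.
rewrite eE; rewrite -(acY i y) -jp; split => [->|jpy]; first exact: linear0.
by apply: jI; rewrite jpy linear0.
Qed.

Lemma complete_resolution_coind (K : lmodType R -> Prop) :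
  (forall M, K M -> exists M', K M' /\ proj_step M' M) ->
  (forall M, K M -> exists M', K M' /\ proj_step M M') ->
  forall M, K M -> exists Y : complex (Mod R),
    [/\ acyclic Y, forall i, projective (Y i) &
      exists e : {linear M -> Y 0}, is_boundaries e].
Proof.
move=> KL KR M KM.
pose T := {N : lmodType R | K N}.
have /choice[l lP] : forall N : T, exists N' : T, proj_step (sval N') (sval N).
  by move=> [N KN]; have [N' [KN' NN']] := KL _ KN; exists (exist _ N' KN').
have /choice[r rP] : forall N : T, exists N' : T, proj_step (sval N) (sval N').
  by move=> [N KN]; have [N' [KN' NN']] := KR _ KN; exists (exist _ N' KN').
pose T0 : T := exist _ M KM.
(* [M] sits at index 1 because im(d_0) is [Z (0 + 1)] below. *)
pose Z (i : int) : T := match i with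
  | Posz 0 => r T0 | Posz n.+1 => iter n l T0 | Negz n => iter n.+2 r T0 end.
have ZP i : proj_step (sval (Z (i + 1))) (sval (Z i)).
  case: i => [[|n]|[|n]]; [exact: rP| |exact: rP|].
    rewrite (_ : n.+1%:Z + 1 = n.+2%:Z) ?[LHS]addnC //.
      exact: lP.
    by rewrite -PoszD addn1.
  rewrite (_ : Negz n.+1 + 1 = Negz n); first exact: rP.
  by rewrite !NegzE -[n.+2]addn1 PoszD opprD subrK.
have /choice[P /dependent_choice[e /dependent_choice[q PP]]] := ZP.
(* Splicing: [q (i + 1)] is onto [Z (i + 1)] and [e i] embeds it in [P i], so the image of [d i] is
   [Z (i + 1)], which is also the kernel of [q i]. *)
pose d i : {linear P (i + 1) -> P i} := (e i \o q (i + 1) : {linear _ -> _}).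
have qe i x : q i (e i x) = 0.
  by have [_ [_ eq _]] := PP i; apply/eq; exists x.
have d2 i : (@Defs.comp (Mod R) (P (i+1+1)) (P (i+1)) (P i) (d i) (d (i + 1))) = 0.
  by apply: linear_ext => x /=; rewrite qe linear0.
exists (@Complex (Mod R) P d d2); split.
- move=> i y /=; have [_ [eI _ _]] := PP i.
  have [_ [eI1 eq1 _]] := PP (i + 1); have [_ [_ _ qS]] := PP (i + 1 + 1).
  split=> [ey|[x <-]]; last by rewrite qe linear0.
  have /eq1[z <-] : q (i + 1) y = 0 by apply: eI; rewrite ey linear0.
  by have [x <-] := qS z; exists x.
- by move=> i; have [] := PP i.
exists (e 0); have [_ [eI _ _]] := PP 0; have [_ [_ _ qS]] := PP (0 + 1).
split => // y /=; split=> [[m <-]|[x <-]]; last by exists (q (0 + 1) x).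
by have [x <-] := qS m; exists x.
Qed.

Lemma syzygy_coind (K : lmodType R -> Prop) :
  (forall M, K M -> exists M', K M' /\ proj_step M' M) ->
  (forall M, K M -> exists M', K M' /\ proj_step M M') ->
  forall M, K M -> syzygy M.
Proof.
move=> KL KR M /(complete_resolution_coind KL KR)[Y [acY prY [e eE]]].
by exists Y; split => //; exists 0, e.
Qed.

Lemma proj_step_projective (Z : lmodType R) P : trivial_module Z -> projective P ->
  proj_step Z P /\ proj_step P Z.
Proof.
move=> Z0 prP; split.
  by exists P, \0, idfun; split => //; exact: short_exact_id_l.
by exists P, idfun, \0; split => //; exact: short_exact_id_r.
Qed.

Lemma projective_syzygy P : projective P -> syzygy P.
Proof.
have [Z Z0] := trivial_module_exists R.
have prZ := projective_trivial Z0.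
apply: syzygy_coind => M prM; exists Z; split => //.
  by case: (proj_step_projective Z0 prM).
by case: (proj_step_projective Z0 prM).
Qed.

(** Only [A] needs new neighbours. As a quotient of [B] it is covered by a projective mapping onto
    [B], and the kernel is an extension of [C] by a syzygy. As a submodule of [B] it embeds in a
    projective containing [B], and the cokernel is an extension of a syzygy by [C]. Both are
    syzygies, so [A] together with all syzygies satisfies the two closure conditions. *)
Lemma syzygy_split A B C (i : {linear A -> B}) (p : {linear B -> C})
    (j : {linear C -> B}) (q : {linear B -> A}) :
  short_exact i p -> short_exact j q ->
  (forall A' B' C' (i' : {linear A' -> B'}) (p' : {linear B' -> C'}),
     short_exact i' p' -> syzygy A' -> syzygy C' -> syzygy B') ->
  syzygy B -> syzygy C -> syzygy A.
Proof.
move=> ip jq ext sB sC.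
apply: (@syzygy_coind (fun M => M = A \/ syzygy M)); last by left.
- move=> M [->|sM]; last first.
    by have [M' [sM' step]] := syzygy_left sM; exists M'; split => //; right.
  have [B' [sB' [P [k [r [prP kr]]]]]] := syzygy_left sB.
  have [K [l [u [v [lqr uv]]]]] := short_exact_epi_comp jq kr.
  exists K; split; first by right; exact: ext uv _ _.
  by exists P, l, (q \o r : {linear _ -> _}).
move=> M [->|sM]; last first.
  by have [M' [sM' step]] := syzygy_right sM; exists M'; split => //; right.
have [B' [sB' [P [k [r [prP kr]]]]]] := syzygy_right sB.
have [Q [l [u [v [kil uv]]]]] := short_exact_mono_comp ip kr.
exists Q; split; first by right; exact: ext uv _ _.
by exists P, (k \o i : {linear _ -> _}), l.
Qed.

(* Dimension shifting: up along the coresolution of [N] by injectives, down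
   along that of [C] by projectives. *)
Lemma syzygy_ext1_zero n C N : syzygy C -> idim_le n N -> ext1_zero C N.
Proof.
elim: n C N => [|n IH] C N sC /=.
  by move=> injN A B i p [iI _ _] f; exact: injN.
move=> [E [N' [j [q [injE [jI jq qS] N'n]]]]] A B i p [iI ip pS] f.
have [h hE] := injE _ _ _ iI (j \o f : {linear A -> E}).
have [|phi phiE] := @factor_surjective _ _ _ _ p (q \o h : {linear B -> N'}) pS.
  by move=> b /ip[a <-] /=; have /= -> := hE a; exact: exact_at_comp0.
(* [phi] measures the failure of [h] to land in [N]. It extends to [P] because Ext^1(C', N') = 0 by
   induction, and the extension lifts to [E] because [P] is projective. *)
have [C' [sC' [P [k [r [prP kr]]]]]] := syzygy_right sC.
have [psi psiE] := IH _ _ sC' N'n _ _ _ _ kr phi.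
have [psi' psi'E] := prP _ _ _ qS psi.
(* The correction factors through [p], so the values on [A] are unchanged, while [q] now annihilates
   the map and its image lies in [N]. *)
pose g : {linear B -> E} := h \- (psi' \o k \o p : {linear B -> E}).
have [|g' g'E] := @lift_injective _ _ _ _ j g jI.
  move=> b; apply/jq; rewrite /g /= linearB /=.
  by have /= -> := psi'E (k (p b)); rewrite psiE phiE /= subrr.
exists g' => a; apply: jI; rewrite g'E.
change (h (i a) - psi' (k (p (i a))) = j (f a)).
by rewrite (exact_at_comp0 a ip) !linear0 addr0; exact: hE.
Qed.

Lemma syzygy_projective_ext1_zero C P : left_noetherian R ->
  finite_injective_dimension (R^o : lmodType R) ->
  syzygy C -> projective P -> ext1_zero C P.
Proof.
move=> noeth /finite_injective_dimension_idim_le[n Rn] sC /projective_retract[s sK].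
apply: (@ext1_zero_retract _ _ _ _ s (mk_linear (@comb_linear R P))) => //.
by apply: (@syzygy_ext1_zero n) => //; exact: dsum_idim_le.
Qed.

(** * Extensions of syzygies and exactness under Hom into projectives *)

Section extensions.
Hypothesis ext1_syzygy : forall C P, syzygy C -> projective P -> ext1_zero C P.

(** Projectivity of [PC] lifts its map onto [C] to a map into [B]; together with [PA -> A -> B] it
    covers [B] by [PA * PC], and [B'] is the kernel. *)
Lemma horseshoe_left A A' B C C' (i : {linear A -> B}) (p : {linear B -> C}) :
  short_exact i p -> proj_step A' A -> proj_step C' C ->
  exists B' (i' : {linear A' -> B'}) (p' : {linear B' -> C'}),
    short_exact i' p' /\ proj_step B' B.
Proof.
move=> [iI ip pS] [PA [iA [pA [prA [iAI ipA pAS]]]]] [PC [iC [pC [prC [iCI ipC pCS]]]]].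
have [l lE] := prC _ _ _ pS pC.
have piL : linear (fun u : PA * PC => i (pA u.1) + l u.2).
  by move=> a x y; rewrite /= !linearP scalerDr addrACA.
have piS : surjective (mk_linear piL).
  move=> b; have [y yE] := pCS (p b).
  have /ip[a aE] : p (b - l y) = 0 by rewrite linearB; have /= -> := lE y;
    rewrite yE subrr.
  have [x xE] := pAS a; exists (x, y) => /=.
  by rewrite xE aE subrK.
have [B' [k [kI kpi _]]] := short_exact_kernel piS.
have [|i' i'E] := @lift_injective _ _ _ _ k (pair_inl PA PC \o iA : {linear _ -> _}) kI.
  by move=> a; apply/kpi; rewrite /= (exact_at_comp0 a ipA) !linear0 addr0.
have sndL : linear (fun b : B' => (k b).2) by move=> a x y; rewrite linearP.
have [|p' p'E] := @lift_injective _ _ _ _ iC (mk_linear sndL) iCI.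
  move=> b /=; apply/ipC; have /= <- := lE (k b).2.
  have : p (i (pA (k b).1) + l (k b).2) = 0.
    by rewrite (_ : _ + _ = 0) ?linear0 //; apply/(kpi (k b)); exists b.
  by rewrite linearD (exact_at_comp0 _ ip) add0r.
exists B', i', p'; split; last first.
  by exists (PA * PC)%type, k, (mk_linear piL); split => //; exact: projective_pair.
split.
- by move=> x y xy; apply: iAI; have := i'E x; rewrite xy i'E => -[].
- move=> b; split=> [p'b|[a <-]]; last first.
    by apply: iCI; rewrite p'E linear0 /= i'E.
  have kb2 : (k b).2 = 0 by have /= <- := p'E b; rewrite p'b linear0.
  have : i (pA (k b).1) + l (k b).2 = 0 by apply/(kpi (k b)); exists b.
  rewrite kb2 linear0 addr0 => ipAkb.
  have /ipA[a aE] : pA (k b).1 = 0 by apply: iI; rewrite ipAkb linear0.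
  by exists a; apply: kI; rewrite i'E /= aE -kb2 -surjective_pairing.
move=> c; have /ip[a aE] : p (l (iC c)) = 0.
  by have /= -> := lE (iC c); exact: exact_at_comp0.
have [x xE] := pAS a.
have /kpi[b bE] : mk_linear piL (- x, iC c) = 0.
  by rewrite /= !linearN xE aE addNr.
by exists b; apply: iCI; rewrite p'E /= bE.
Qed.

(** Projectives need not be injective, so extending [A -> PA] over [B] is not automatic: it is
    possible because Ext^1(C, PA) = 0. The extension and [B -> C -> PC] embed [B] in [PA * PC]. *)
Lemma horseshoe_right A A' B C C' (i : {linear A -> B}) (p : {linear B -> C}) :
  short_exact i p -> syzygy C -> proj_step A A' -> proj_step C C' ->
  exists B' (i' : {linear A' -> B'}) (p' : {linear B' -> C'}),
    short_exact i' p' /\ proj_step B B'.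
Proof.
move=> ipx sC [PA [iA [pA [prA [iAI ipA pAS]]]]] [PC [iC [pC [prC [iCI ipC pCS]]]]].
have [iI ip pS] := ipx.
have [h hE] := ext1_syzygy sC prA ipx iA.
have jL : linear (fun b => (h b, iC (p b)) : PA * PC).
  by move=> a x y; rewrite !linearP.
have jI : injective (mk_linear jL).
  apply: linear_eq_ker_inj => b /= -[hb pb].
  have /ip[a aE] : p b = 0 by apply: iCI; rewrite pb linear0.
  have a0 : a = 0 by apply: iAI; rewrite -hE aE hb linear0.
  by rewrite -aE a0 linear0.
have [B' [q [_ jq qS]]] := short_exact_cokernel jI.
have [|i' i'E] := @factor_surjective _ _ _ _ pA (q \o pair_inl PA PC : {linear _ -> _}) pAS.
  move=> x /ipA[a <-] /=; apply/jq; exists (i a) => /=.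
  by rewrite hE (exact_at_comp0 a ip) linear0.
have sndL : linear (fun u : PA * PC => pC u.2) by move=> a x y; rewrite linearP.
have [|p' p'E] := @factor_surjective _ _ _ _ q (mk_linear sndL) qS.
  by move=> x /jq[b <-] /=; exact: exact_at_comp0.
exists B', i', p'; split; last first.
  by exists (PA * PC)%type, (mk_linear jL), q; split => //; exact: projective_pair.
split.
- apply: linear_eq_ker_inj => a'; have [x <-] := pAS a'.
  rewrite i'E /= => /jq[b /= [hb pb]].
  have /ip[a aE] : p b = 0 by apply: iCI; rewrite pb linear0.
  by apply/ipA; exists a; rewrite -hE aE.
- move=> z; split=> [|[a' <-]]; last first.
    by have [x <-] := pAS a'; rewrite i'E /= p'E /= linear0.
  have [[x y] <-] := qS z; rewrite p'E /= => /ipC[c cE].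
  (* Modulo the image of [b], the pair [(x, y)] equals [(x - h b, 0)], since [y] is [iC (p b)]. *)
  have [b bE] := pS c; exists (pA (x - h b)); rewrite i'E /=.
  have qj : q (h b, iC (p b)) = 0 by apply/jq; exists b.
  rewrite -[RHS]subr0 -qj -linearB; congr (q _).
  by rewrite bE cE [RHS]/GRing.add /= /add_pair /= subrr.
move=> c'; have [y <-] := pCS c'; exists (q (0, y)).
by rewrite p'E.
Qed.

Lemma syzygy_extension A B C (i : {linear A -> B}) (p : {linear B -> C}) :
  short_exact i p -> syzygy A -> syzygy C -> syzygy B.
Proof.
move=> ip sA sC; pose K M := exists A C (i : {linear A -> M}) (p : {linear M -> C}),
  [/\ short_exact i p, syzygy A & syzygy C].
apply: (@syzygy_coind K); last by exists A, C, i, p.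
- move=> {A B C i p ip sA sC} M [A [C [i [p [ip sA sC]]]]].
  have [A' [sA' AA']] := syzygy_left sA; have [C' [sC' CC']] := syzygy_left sC.
  have [M' [i' [p' [ip' MM']]]] := horseshoe_left ip AA' CC'.
  by exists M'; split => //; exists A', C', i', p'.
move=> {A B C i p ip sA sC} M [A [C [i [p [ip sA sC]]]]].
have [A' [sA' AA']] := syzygy_right sA; have [C' [sC' CC']] := syzygy_right sC.
have [M' [i' [p' [ip' MM']]]] := horseshoe_right ip sC AA' CC'.
by exists M'; split => //; exists A', C', i', p'.
Qed.

(** A cocycle factors through the image [A] of a differential. The quotient by [A] of the module
    that contains it is the next image, a syzygy, so the factored map extends by vanishing of
    Ext^1. *)
Lemma acyclic_hom_exact (Y : complex (Mod R)) P : acyclic Y ->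
  (forall i, projective (Y i)) -> projective P -> hom_exact Y P.
Proof.
move=> acY prY prP i; rewrite -(subrK 1 i); move: (i - 1) => {}i f fd.
have [C [p [j [pS jI jp]]]] := image_exists (diff Y i : {linear _ -> _}).
have [A [q [k [qS kI kq]]]] := image_exists (diff Y (i + 1) : {linear _ -> _}).
have kp : short_exact k p.
  split => // y; rewrite (_ : p y = 0 <-> (diff Y i : {linear _ -> _}) y = 0); last first.
    by rewrite -jp; split=> [->|jpy]; [exact: linear0|apply: jI; rewrite jpy linear0].
  rewrite (acY i y); split=> [[x <-]|[a <-]]; first by exists (q x); rewrite kq.
  by have [x <-] := qS a; exists x; rewrite kq.
have sC : syzygy C.
  exists Y; split => //; exists i, j; split => // y.
  split=> [[c <-]|[x <-]]; last by exists (p x).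
  by have [x <-] := pS c; exists x; rewrite jp.
have [|g gE] := @factor_surjective _ _ _ _ q f qS.
  move=> x qx; have /acY[z <-] : (diff Y (i + 1) : {linear _ -> _}) x = 0.
    by rewrite -kq qx linear0.
  exact: fd.
have [h hE] := ext1_syzygy sC prP kp g.
by exists h => x /=; rewrite -kq hE gE.
Qed.

Lemma gorenstein_projectiveP M : gorenstein_projective M <-> syzygy M.
Proof.
split=> [[Y [acY prY _ [e eE]]]|sM]; first by exists Y; split => //; exists 0, e.
(* The complex given by [sM] may show [M] in any degree; a new one with [M] in degree 0 is built
   instead of shifting it. *)
have [Y [acY prY [e eE]]] := complete_resolution_coind syzygy_left syzygy_right sM.
exists Y; split => // [P prP|]; last by exists e.
exact: acyclic_hom_exact.
Qed.

End extensions.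
End syzygies.

(** * Exact structure on Gorenstein projective modules *)

Section exact_subcategories.
Variables (R : pzRingType) (K : Mod R -> Prop).
Hypothesis K_ext : forall (A B C : lmodType R) (i : {linear A -> B})
  (p : {linear B -> C}), short_exact i p -> K A -> K C -> K B.
Hypothesis K_trivial : forall Z : lmodType R, trivial_module Z -> K Z.

Local Notation KMod := (@full_sub (Mod R) K).
Local Notation E := (@sub_sequence_class (Mod R) K (@short_exact R)).
Local Notation lin f := (f : {linear _ -> _}).

Lemma homE (M N : lmodType R) (f g : {linear M -> N}) : f = g -> f =1 g.
Proof. by move=> ->. Qed.

(** [B] is an extension of the zero module by [A]. *)
Lemma extension_closed_iso (A B : lmodType R) (f : {linear A -> B}) :
  injective f -> surjective f -> K A -> K B.
Proof.
move=> fI fS KA; have [Z Z0] := trivial_module_exists R.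
apply: (@K_ext A B Z f \0) => //; last exact: K_trivial.
split; [exact: fI| |by move=> z; exists 0; rewrite (Z0 z)].
by move=> y; split=> // _; exact: fS.
Qed.

Lemma full_sub_isoP (a b : KMod) (f : hom a b) :
  is_iso f <-> injective (lin f) /\ surjective (lin f).
Proof.
split=> [[g [gf fg]]|[fI fS]].
  have gfE : cancel (lin f) (lin g) := homE gf.
  have fgE : cancel (lin g) (lin f) := homE fg.
  by split=> [|y]; [exact: can_inj gfE|exists ((g : {linear _ -> _}) y); exact: fgE].
have [g [fg gf]] := linear_inverse fI fS.
by exists g; split; apply: linear_ext.
Qed.

Lemma short_exact_iso (A B C A' B' C' : lmodType R)
    (i : {linear A -> B}) (p : {linear B -> C})
    (i' : {linear A' -> B'}) (p' : {linear B' -> C'})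
    (u : {linear A -> A'}) (v : {linear B -> B'}) (w : {linear C -> C'}) :
  surjective u -> injective v -> surjective v -> injective w -> surjective w ->
  (forall x, i' (u x) = v (i x)) -> (forall y, p' (v y) = w (p y)) ->
  short_exact i p -> short_exact i' p'.
Proof.
move=> uS vI vS wI wS iu pv [iI ip pS]; split.
- apply: linear_eq_ker_inj => x'; have [x <-] := uS x'.
  rewrite iu -(linear0 v) => /vI ix; suff -> : x = 0 by rewrite linear0.
  by apply: iI; rewrite ix linear0.
- move=> y'; have [y <-] := vS y'; rewrite pv; split=> [|[x']].
    by rewrite -(linear0 w) => /wI/ip[x <-]; exists (u x).
  have [x <-] := uS x'; rewrite iu => /vI <-.
  by rewrite (exact_at_comp0 x ip) linear0.
move=> z'; have [z <-] := wS z'; have [y <-] := pS z.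
by exists (v y); rewrite pv.
Qed.

Lemma full_sub_kernel (a b c : KMod) (i : hom a b) (p : hom b c) :
  short_exact (lin i) (lin p) -> is_kernel i p.
Proof.
move=> [iI ip pS]; split.
  by apply: linear_ext => x; exact: exact_at_comp0.
move=> x f pf; have [|g gE] := @lift_injective _ _ _ _ (lin i) (lin f) iI.
  by move=> y; apply/ip; exact: (homE pf).
exists g; split=> [|h hE]; first exact: linear_ext.
by apply: linear_ext => y; apply: iI; rewrite gE -hE.
Qed.

Lemma full_sub_cokernel (a b c : KMod) (i : hom a b) (p : hom b c) :
  short_exact (lin i) (lin p) -> is_cokernel i p.
Proof.
move=> [iI ip pS]; split.
  by apply: linear_ext => x; exact: exact_at_comp0.
move=> x f fi; have [|g gE] := @factor_surjective _ _ _ _ (lin p) (lin f) pS.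
  by move=> y /ip[z <-]; exact: (homE fi).
exists g; split=> [|h hE]; first exact: linear_ext.
by apply: linear_ext => y; have [z <-] := pS y; rewrite gE -hE.
Qed.

Lemma short_exact_pair (A B : lmodType R) :
  short_exact (pair_inl A B) (snd : {linear (A * B)%type -> B}).
Proof.
split=> [x y [->]//|[x y] /=|y]; last by exists (0, y).
by split=> [->|[z [_ <-]]//]; exists x.
Qed.

Lemma full_sub_additive : is_additive_category KMod.
Proof.
split.
  have [Z Z0] := trivial_module_exists R.
  exists (exist K Z (K_trivial Z0)); by apply: linear_ext => x; exact: Z0.
move=> [A KA] [B KB].
have KAB : K (A * B)%type by exact: K_ext (short_exact_pair A B) KA KB.
exists (exist K _ KAB), (pair_inl A B), (pair_inr A B),
  (fst : {linear (A * B)%type -> A}), (snd : {linear (A * B)%type -> B}).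
split; apply: linear_ext => // -[x y] /=.
rewrite /GRing.add /= /add_pair /=; congr pair; first exact: addr0.
exact: add0r.
Qed.

(** The pushout is the cokernel of [(f, - i)]. The row [A' -> B' -> C] is produced along with it
    because it places [B'] in an extension-closed class. *)
Lemma pushout_exists (A B C A' : lmodType R) (i : {linear A -> B})
    (p : {linear B -> C}) (f : {linear A -> A'}) : short_exact i p ->
  exists (B' : lmodType R) (i' : {linear A' -> B'}) (f' : {linear B -> B'})
      (p' : {linear B' -> C}),
    [/\ short_exact i' p', forall a, i' (f a) = f' (i a) &
      forall (X : lmodType R) (u : {linear A' -> X}) (v : {linear B -> X}),
        (forall a, u (f a) = v (i a)) ->
        exists w : {linear B' -> X}, [/\ forall x, w (i' x) = u x,
          forall x, w (f' x) = v x & forall w' : {linear B' -> X},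
            (forall x, w' (i' x) = u x) -> (forall x, w' (f' x) = v x) -> w' =1 w]].
Proof.
move=> [iI ip pS].
have jL : linear (fun a => (f a, - i a) : (A' * B)%type).
  by move=> a x y; rewrite !linearP.
have jI : injective (mk_linear jL) by move=> x y [_ /oppr_inj/iI].
have [B' [q [_ jq qS]]] := short_exact_cokernel jI.
have [i' i'E] : exists i' : {linear A' -> B'}, forall x, i' x = q (x, 0).
  by exists (q \o pair_inl A' B).
have [f' f'E] : exists f' : {linear B -> B'}, forall y, f' y = q (0, y).
  by exists (q \o pair_inr A' B).
have qE x y : q (x, y) = i' x + f' y.
  rewrite i'E f'E -linearD; congr (q _).
  by rewrite /GRing.add /= /add_pair /= addr0 add0r.
have psL : linear (fun u : (A' * B)%type => p u.2) by move=> a x y; rewrite linearP.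
have [|p' p'E] := @factor_surjective _ _ _ _ q (mk_linear psL) qS.
  by move=> x /jq[a <-] /=; rewrite linearN (exact_at_comp0 a ip) oppr0.
have fi a : i' (f a) = f' (i a).
  apply/eqP; rewrite -subr_eq0 -linearN -qE; apply/eqP/jq.
  by exists a.
exists B', i', f', p'; split => //.
  split.
  - apply: linear_eq_ker_inj => x; rewrite i'E => /jq[a [<- /eqP]].
    rewrite oppr_eq0 => /eqP ia.
    by rewrite (_ : a = 0) ?linear0 //; apply: iI; rewrite ia linear0.
  - move=> z; split=> [|[x <-]]; last by rewrite i'E p'E /= linear0.
    have [[x y] <-] := qS z; rewrite p'E /= => /ip[a <-].
    by exists (x + f a); rewrite qE linearD fi.
  by move=> c; have [b <-] := pS c; exists (f' b); rewrite f'E p'E.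
move=> X u v uv; have wL : linear (fun x : (A' * B)%type => u x.1 + v x.2).
  by move=> a x y; rewrite /= !linearP scalerDr addrACA.
have [|w wE] := @factor_surjective _ _ _ _ q (mk_linear wL) qS.
  by move=> x /jq[a <-] /=; rewrite uv linearN subrr.
exists w; split=> [x|x|w' w'u w'v z].
- by rewrite i'E wE /= linear0 addr0.
- by rewrite f'E wE /= linear0 add0r.
have [[x y] <-] := qS z.
by rewrite wE /= qE linearD w'u w'v.
Qed.

Lemma pullback_exists (A B C C' : lmodType R) (i : {linear A -> B})
    (p : {linear B -> C}) (f : {linear C' -> C}) : short_exact i p ->
  exists (B' : lmodType R) (i' : {linear A -> B'}) (p' : {linear B' -> C'})
      (f' : {linear B' -> B}),
    [/\ short_exact i' p', forall b, f (p' b) = p (f' b) &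
      forall (X : lmodType R) (u : {linear X -> C'}) (v : {linear X -> B}),
        (forall x, f (u x) = p (v x)) ->
        exists w : {linear X -> B'}, [/\ forall x, p' (w x) = u x,
          forall x, f' (w x) = v x & forall w' : {linear X -> B'},
            (forall x, p' (w' x) = u x) -> (forall x, f' (w' x) = v x) -> w' =1 w]].
Proof.
move=> [iI ip pS].
have dL : linear (fun u : (B * C')%type => p u.1 - f u.2).
  by move=> a x y; rewrite /= !linearP addrACA -scalerDr.
have [B' [k [kI kd]]] := kernel_exists (mk_linear dL).
have kdP b c : p b = f c <-> exists x, k x = (b, c).
  rewrite -kd /=; split=> [->|/eqP]; first exact: subrr.
  by rewrite subr_eq0 => /eqP.
pose f' : {linear B' -> B} := fst \o k.
pose p' : {linear B' -> C'} := snd \o k.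
have kE x : k x = (f' x, p' x) by exact: surjective_pairing.
have [|i' i'E] := @lift_injective _ _ _ _ k (pair_inl B C' \o i : {linear _ -> _}) kI.
  by move=> a; apply/kdP; rewrite linear0; exact: exact_at_comp0.
have pf b : f (p' b) = p (f' b) by apply/esym/kdP; exists b.
exists B', i', p', f'; split => //.
  split.
  - by move=> x y xy; apply: iI; have := i'E x; rewrite xy i'E => -[].
  - move=> z; split=> [p'z|[a <-]]; last by rewrite /p' /= i'E.
    have /ip[a aE] : p (f' z) = 0 by rewrite -pf p'z linear0.
    by exists a; apply: kI; rewrite i'E kE p'z -aE.
  move=> c; have [b bE] := pS (f c); have /kdP[x xE] := bE.
  by exists x; rewrite /p' /= xE.
move=> X u v uv; have wL : linear (fun x => (v x, u x) : (B * C')%type).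
  by move=> a x y; rewrite !linearP.
have [|w wE] := @lift_injective _ _ _ _ k (mk_linear wL) kI.
  by move=> x; apply/kdP; rewrite uv.
exists w; split=> [x|x|w' w'u w'v x]; [by rewrite /p' /= wE|by rewrite /f' /= wE|].
by apply: kI; rewrite wE kE w'u w'v.
Qed.

(** Every construction is made in Mod(R). Composites, pushouts and pullbacks each come with a short
    exact sequence having outer terms in [K], so closure under extensions keeps them in the
    subcategory. *)
Lemma full_sub_exact : is_exact_category E.
Proof.
have [Z Z0] := trivial_module_exists R.
split.
- exact: full_sub_additive.
- by move=> a b c i p; exact: full_sub_kernel.
- by move=> a b c i p; exact: full_sub_cokernel.
- move=> a b c a' b' c' i p i' p' u v w /full_sub_isoP[_ uS] /full_sub_isoP[vI vS].
  move=> /full_sub_isoP[wI wS] iu pv ip.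
  by apply: (short_exact_iso uS vI vS wI wS (homE iu) (homE pv) ip).
- move=> a; exists (exist K Z (K_trivial Z0)), (\0 : {linear sval a -> Z}).
  exact: short_exact_id_r.
- move=> a; exists (exist K Z (K_trivial Z0)), (\0 : {linear Z -> sval a}).
  exact: short_exact_id_l.
- move=> [a Ka] [b Kb] [d Kd] i j [[c Kc] [p ip]] [[e Ke] [q jq]].
  have [Q [r [u [v [jir uv]]]]] := short_exact_mono_comp ip jq.
  have KQ : K Q by exact: K_ext uv Kc Ke.
  by exists (exist K Q KQ), r.
- move=> [e Ke] [b Kb] [c Kc] q p [[d Kd] [j jq]] [[a Ka] [i ip]].
  have [Q [k [u [v [kpq uv]]]]] := short_exact_epi_comp ip jq.
  have KQ : K Q by exact: K_ext uv Kd Ka.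
  by exists (exist K Q KQ), k.
- move=> [a Ka] [b Kb] [a' Ka'] i f [[c Kc] [p ip]].
  have [B' [i' [f' [p' [ip' fi univ]]]]] := pushout_exists f ip.
  have KB' : K B' by exact: K_ext ip' Ka' Kc.
  exists (exist K B' KB'), i', f'; split; last by exists (exist K c Kc), p'.
  split; first exact: linear_ext.
  move=> x u v uv; have [w [wu wv wP]] := univ _ _ _ (homE uv).
  exists w; split; first by split; apply: linear_ext.
  by move=> w' [/homE w'u /homE w'v]; apply: linear_ext => z; rewrite -(wP w').
move=> [b Kb] [c Kc] [c' Kc'] p f [[a Ka] [i ip]].
have [B' [i' [p' [f' [ip' fp univ]]]]] := pullback_exists f ip.
have KB' : K B' by exact: K_ext ip' Ka Kc'.
exists (exist K B' KB'), p', f'; split; last by exists (exist K a Ka), i'.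
split; first exact: linear_ext.
move=> x u v uv; have [w [wu wv wP]] := univ _ _ _ (homE uv).
exists w; split; first by split; apply: linear_ext.
by move=> w' [/homE w'u /homE w'v]; apply: linear_ext => z; rewrite -(wP w').
Qed.

(** The kernel of a retraction [r] with section [s] appears in two sequences: as the kernel of [r],
    and as the cokernel of [s] through the projection [1 - s r]. Closure of [K] is requested for
    exactly this situation. *)
Lemma full_sub_weakly_idempotent_complete :
  (forall (A B C : lmodType R) (i : {linear A -> B}) (p : {linear B -> C})
    (j : {linear C -> B}) (q : {linear B -> A}),
    short_exact i p -> short_exact j q -> K B -> K C -> K A) ->
  weakly_idempotent_complete KMod.
Proof.
move=> K_split [b Kb] [c Kc] r s rs.
have rsE : cancel (lin s) (lin r) by exact: homE rs.
have rS : surjective (lin r) by move=> y; exists (lin s y).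
have [A [i ir]] := short_exact_kernel rS.
have [iI irE _] := ir.
have [|q qE] := @lift_injective _ _ _ _ i (idfun \- (lin s \o lin r) : {linear b -> b}) iI.
  by move=> x /=; apply/irE; rewrite linearB /= rsE subrr.
have sq : short_exact (lin s) q.
  split; first exact: can_inj rsE.
  - move=> x; split=> [qx|[y <-]]; last first.
      by apply: iI; rewrite qE /= rsE subrr linear0.
    exists (lin r x); apply/esym/eqP; rewrite -subr_eq0; apply/eqP.
    by have := qE x; rewrite qx linear0 => /esym.
  move=> a; exists (i a); apply: iI.
  by rewrite qE /= (exact_at_comp0 a irE) linear0 subr0.
by exists (exist K A (K_split _ _ _ _ _ _ _ ir sq Kb Kc)), i; exact: full_sub_kernel.
Qed.

End exact_subcategories.

(** * The Frobenius category of Gorenstein projective modules *)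

Section gorenstein_projective_modules.
Variable R : pzRingType.
Hypothesis gorR : gorenstein_ring R.
Local Notation GP := (@full_sub (Mod R) (@gorenstein_projective R)).
Local Notation E :=
  (@sub_sequence_class (Mod R) (@gorenstein_projective R) (@short_exact R)).
Local Notation lin f := (f : {linear _ -> _}).

Let ext1 (C P : lmodType R) : syzygy C -> projective P -> ext1_zero C P.
Proof. by case: gorR => *; exact: syzygy_projective_ext1_zero. Qed.

Lemma gp_syzygyP (M : lmodType R) : gorenstein_projective M <-> syzygy M.
Proof. exact: gorenstein_projectiveP ext1 M. Qed.

Lemma gp_extension (A B C : lmodType R) (i : {linear A -> B})
  (p : {linear B -> C}) : short_exact i p ->
  gorenstein_projective A -> gorenstein_projective C -> gorenstein_projective B.
Proof. by rewrite !gp_syzygyP; exact: syzygy_extension. Qed.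

Lemma projective_gp (P : lmodType R) : projective P -> gorenstein_projective P.
Proof. by move=> prP; apply/gp_syzygyP/projective_syzygy. Qed.

Lemma gp_iso (A B : lmodType R) (f : {linear A -> B}) :
  injective f -> surjective f -> gorenstein_projective A -> gorenstein_projective B.
Proof.
apply: (extension_closed_iso (@gp_extension)) => Z Z0.
exact/projective_gp/projective_trivial.
Qed.

Lemma gp_exact : is_exact_category E.
Proof.
apply: (full_sub_exact (@gp_extension)) => Z Z0.
exact/projective_gp/projective_trivial.
Qed.

Lemma gp_weakly_idempotent_complete : weakly_idempotent_complete GP.
Proof.
apply: full_sub_weakly_idempotent_complete => A B C i p j q ip jq; rewrite !gp_syzygyP.
exact: syzygy_split ip jq (@syzygy_extension _ ext1).
Qed.

Lemma gp_rel_projective (x : GP) : projective (sval x) -> rel_projective E x.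
Proof.
move=> prx b c p [a [i [_ _ pS]]] f.
by have [g gE] := prx _ _ _ pS f; exists g; apply: linear_ext.
Qed.

(** The cokernel of an admissible monomorphism is again Gorenstein projective, so its Ext^1 into a
    projective vanishes. *)
Lemma gp_rel_injective (x : GP) : projective (sval x) -> rel_injective E x.
Proof.
move=> prx a b i [[c gpc] [p ip]] f.
have [|h hE] := ext1 _ prx ip f; first exact/gp_syzygyP.
by exists h; apply: linear_ext.
Qed.

Lemma gp_cover (c : GP) : exists (b : GP) (p : hom b c),
  projective (sval b) /\ admissible_epi E p.
Proof.
case: c => c gpc.
have /gp_syzygyP/syzygy_left[M' [/gp_syzygyP gpM' [P [i [p [prP ip]]]]]] := gpc.
by exists (exist _ P (projective_gp prP)), p; split => //; exists (exist _ M' gpM'), i.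
Qed.

Lemma gp_hull (c : GP) : exists (b : GP) (i : hom c b),
  projective (sval b) /\ admissible_mono E i.
Proof.
case: c => c gpc.
have /gp_syzygyP/syzygy_right[M' [/gp_syzygyP gpM' [P [i [p [prP ip]]]]]] := gpc.
by exists (exist _ P (projective_gp prP)), i; split => //; exists (exist _ M' gpM'), p.
Qed.

Lemma gp_rel_projectiveP (x : GP) : rel_projective E x <-> projective (sval x).
Proof.
split; last exact: gp_rel_projective.
have [b [p [prb pE]]] := gp_cover x.
move=> /(_ _ _ p pE (idm x))[g /homE gE].
exact: projective_sub_retract gE prb.
Qed.

Lemma gp_rel_injectiveP (x : GP) : rel_injective E x <-> projective (sval x).
Proof.
split; last exact: gp_rel_injective.
have [b [i [prb iE]]] := gp_hull x.
move=> /(_ _ _ i iE (idm x))[g /homE gE].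
exact: projective_sub_retract gE prb.
Qed.

Lemma gp_frobenius : is_frobenius_category E.
Proof.
split; first exact: gp_exact.
- move=> c; have [b [p [prb pE]]] := gp_cover c.
  by exists b, p; split => //; apply/gp_rel_projectiveP.
- move=> c; have [b [i [prb iE]]] := gp_hull c.
  by exists b, i; split => //; apply/gp_rel_injectiveP.
by move=> x; rewrite gp_rel_projectiveP gp_rel_injectiveP.
Qed.
End gorenstein_projective_modules.

(** * Transport along equivalences *)

(** Bilinearity is an axiom about [pcomp]; this form rewrites under the composition [**] of the
    underlying category. *)
Lemma compDl (C : preadditive) (a b c : C) (f g : hom b c) (h : hom a b) :
  @comp C a b c (f + g) h = f ** h + g ** h.
Proof. exact: pcompDl. Qed.
Lemma compDr (C : preadditive) (a b c : C) (f : hom b c) (g h : hom a b) :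
  @comp C a b c f (g + h) = f ** g + f ** h.
Proof. exact: pcompDr. Qed.
Lemma comp0m (C : preadditive) (a b c : C) (h : hom a b) :
  @comp C a b c 0 h = 0.
Proof. by apply: (addIr (@comp C a b c 0 h)); rewrite -compDl !add0r. Qed.
Lemma compm0 (C : preadditive) (a b c : C) (f : hom b c) :
  @comp C a b c f 0 = 0.
Proof. by apply: (addIr (@comp C a b c f 0)); rewrite -compDr !add0r. Qed.

Section equivalence_transport.
Variables (A B : preadditive) (K : functor A B).
Hypothesis K_additive : additive_functor K.
Hypothesis K_full : forall (a b : A) (g : hom (K a) (K b)), exists f, fmap K f = g.
Hypothesis K_faithful : forall (a b : A) (f g : hom a b), fmap K f = fmap K g -> f = g.
Hypothesis K_surj : forall b : B, exists (a : A) (f : hom (K a) b) (g : hom b (K a)),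
  g ** f = idm (K a) /\ f ** g = idm b.
Variables (EA : sequence_class A) (EB : sequence_class B).
Hypothesis EAB : forall (a b c : A) (i : hom a b) (p : hom b c),
  EA i p <-> EB (fmap K i) (fmap K p).

Lemma is_iso_id (C : category) (a : C) : is_iso (idm a).
Proof. by exists (idm a); rewrite comp1m. Qed.

Lemma functor_iso (C D : category) (L : functor C D) (a b : C) (f : hom a b) :
  is_iso f -> is_iso (fmap L f).
Proof.
by move=> [g [gf fg]]; exists (fmap L g); rewrite -!fmapM gf fg !fmap1.
Qed.

Let K0 (a b : A) : fmap K (0 : hom a b) = 0.
Proof. exact: additive_functor0. Qed.

Lemma reflect_kernel (a b c : A) (i : hom a b) (p : hom b c) :
  is_kernel (fmap K i) (fmap K p) -> is_kernel i p.
Proof.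
move=> [pi univ]; split; first by apply: K_faithful; rewrite fmapM pi K0.
move=> x f pf; have [|g [gf guniq]] := univ _ (fmap K f); first by rewrite -fmapM pf K0.
have [g0 g0E] := K_full g; exists g0; split.
  by apply: K_faithful; rewrite fmapM g0E.
by move=> h hf; apply: K_faithful; rewrite g0E; apply: guniq; rewrite -fmapM hf.
Qed.

Lemma reflect_cokernel (a b c : A) (i : hom a b) (p : hom b c) :
  is_cokernel (fmap K i) (fmap K p) -> is_cokernel i p.
Proof.
move=> [pi univ]; split; first by apply: K_faithful; rewrite fmapM pi K0.
move=> x f pf; have [|g [gf guniq]] := univ _ (fmap K f); first by rewrite -fmapM pf K0.
have [g0 g0E] := K_full g; exists g0; split.
  by apply: K_faithful; rewrite fmapM g0E.
by move=> h hf; apply: K_faithful; rewrite g0E; apply: guniq; rewrite -fmapM hf.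
Qed.

Lemma reflect_biproduct (a b s : A) : is_biproduct (K a) (K b) (K s) -> is_biproduct a b s.
Proof.
move=> [ia [ib [pa [pb []]]]].
have [ia' <-] := K_full ia; have [ib' <-] := K_full ib.
have [pa' <-] := K_full pa; have [pb' <-] := K_full pb.
rewrite -!fmapM => aa bb ab ba sE; exists ia', ib', pa', pb'.
by split; apply: K_faithful; rewrite ?fmap1 ?K0 // -sE K_additive.
Qed.

Lemma biproduct_iso (C : preadditive) (a b s t : C) (f : hom t s) (g : hom s t) :
  g ** f = idm t -> f ** g = idm s -> is_biproduct a b s -> is_biproduct a b t.
Proof.
move=> gf fg [ia [ib [pa [pb [aa bb ab ba sE]]]]].
exists (g ** ia), (g ** ib), (pa ** f), (pb ** f).
have mid v w (x : hom s w) (y : hom v s) : x ** f ** (g ** y) = x ** y.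
  by rewrite compmA -(compmA x) fg compm1.
rewrite !mid; split => //.
have <- : g ** (ia ** pa + ib ** pb) ** f = idm t by rewrite sE compm1.
by rewrite compDr compDl !compmA.
Qed.

Lemma iso_closed_mono (a b b' : B) (i : hom a b) (f : hom b b') (g : hom b' b) :
  closed_under_iso EB -> g ** f = idm b -> f ** g = idm b' ->
  admissible_mono EB i -> admissible_mono EB (f ** i).
Proof.
move=> isoE gf fg [c [p ip]]; exists c, (p ** g).
apply: (isoE _ _ _ _ _ _ _ _ _ _ (idm a) f (idm c)) ip.
- exact: is_iso_id.
- by exists g.
- exact: is_iso_id.
- by rewrite compm1.
by rewrite comp1m -compmA gf compm1.
Qed.

Lemma iso_closed_epi (b b' c : B) (p : hom b c) (f : hom b b') (g : hom b' b) :
  closed_under_iso EB -> g ** f = idm b -> f ** g = idm b' ->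
  admissible_epi EB p -> admissible_epi EB (p ** g).
Proof.
move=> isoE gf fg [a [i ip]]; exists a, (f ** i).
apply: (isoE _ _ _ _ _ _ _ _ _ _ (idm a) f (idm c)) ip.
- exact: is_iso_id.
- by exists g.
- exact: is_iso_id.
- by rewrite compm1.
by rewrite comp1m -compmA gf compm1.
Qed.

Lemma iso_closed_epi_codomain (b c c' : B) (p : hom b c) (f : hom c c') (g : hom c' c) :
  closed_under_iso EB -> g ** f = idm c -> f ** g = idm c' ->
  admissible_epi EB p -> admissible_epi EB (f ** p).
Proof.
move=> isoE gf fg [a [i ip]]; exists a, i.
apply: (isoE _ _ _ _ _ _ _ _ _ _ (idm a) (idm b) f) ip.
- exact: is_iso_id.
- exact: is_iso_id.
- by exists g.
- by rewrite compm1 comp1m.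
by rewrite compm1.
Qed.

Lemma iso_closed_mono_domain (a a' b : B) (i : hom a b) (f : hom a a') (g : hom a' a) :
  closed_under_iso EB -> g ** f = idm a -> f ** g = idm a' ->
  admissible_mono EB i -> admissible_mono EB (i ** g).
Proof.
move=> isoE gf fg [c [p ip]]; exists c, p.
apply: (isoE _ _ _ _ _ _ _ _ _ _ f (idm b) (idm c)) ip.
- by exists g.
- exact: is_iso_id.
- exact: is_iso_id.
- by rewrite comp1m -compmA gf compm1.
by rewrite compm1 comp1m.
Qed.

(** The third term of a sequence in [B] need not be in the image of [K]; closure under isomorphism
    allows it to be exchanged for one that is. *)
Lemma admissible_monoP (a b : A) (i : hom a b) : closed_under_iso EB ->
  admissible_mono EA i <-> admissible_mono EB (fmap K i).
Proof.
move=> isoE; split=> [[c [p /EAB ip]]|[c [p ip]]]; first by exists (K c), (fmap K p).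
have [c' [f [g [gf fg]]]] := K_surj c; have [p' p'E] := K_full (g ** p).
exists c', p'; apply/EAB; rewrite p'E.
apply: (isoE _ _ _ _ _ _ _ _ _ _ (idm _) (idm _) g) ip.
- exact: is_iso_id.
- exact: is_iso_id.
- by exists f.
- by rewrite compm1 comp1m.
by rewrite compm1.
Qed.

Lemma admissible_epiP (b c : A) (p : hom b c) : closed_under_iso EB ->
  admissible_epi EA p <-> admissible_epi EB (fmap K p).
Proof.
move=> isoE; split=> [[a [i /EAB ip]]|[a [i ip]]]; first by exists (K a), (fmap K i).
have [a' [f [g [gf fg]]]] := K_surj a; have [i' i'E] := K_full (i ** f).
exists a', i'; apply/EAB; rewrite i'E.
apply: (isoE _ _ _ _ _ _ _ _ _ _ g (idm _) (idm _)) ip.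
- by exists f.
- exact: is_iso_id.
- exact: is_iso_id.
- by rewrite comp1m -compmA fg compm1.
by rewrite compm1 comp1m.
Qed.

Lemma equivalence_exact : is_exact_category EB -> is_exact_category EA.
Proof.
move=> exB; have isoE := exact_iso exB; split.
- have [[z z0] biprod] := exact_additive exB; split.
    have [a [f [g [gf fg]]]] := K_surj z; exists a; apply: K_faithful.
    by rewrite fmap1 K0 -gf -[f]comp1m z0 !comp0m compm0.
  move=> a b; have [s abs] := biprod (K a) (K b).
  have [t [f [g [gf fg]]]] := K_surj s; exists t.
  by apply: reflect_biproduct; exact: biproduct_iso gf fg abs.
- by move=> a b c i p /EAB/(exact_kernel exB); exact: reflect_kernel.
- by move=> a b c i p /EAB/(exact_cokernel exB); exact: reflect_cokernel.
- move=> a b c a' b' c' i p i' p' u v w ui vi wi iu pv /EAB ip; apply/EAB.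
  apply: isoE (functor_iso K ui) (functor_iso K vi) (functor_iso K wi) _ _ ip.
    by rewrite -!fmapM iu.
  by rewrite -!fmapM pv.
- by move=> a; apply/admissible_monoP => //; rewrite fmap1; exact: exact_E0 exB _.
- by move=> a; apply/admissible_epiP => //; rewrite fmap1; exact: exact_E0op exB _.
- move=> a b c i j /(admissible_monoP _ isoE) Ki /(admissible_monoP _ isoE) Kj.
  by apply/admissible_monoP => //; rewrite fmapM; exact: exact_E1 exB _ _ _ _ _ Ki Kj.
- move=> a b c i j /(admissible_epiP _ isoE) Ki /(admissible_epiP _ isoE) Kj.
  by apply/admissible_epiP => //; rewrite fmapM; exact: exact_E1op exB _ _ _ _ _ Ki Kj.
- move=> a b a' i f /(admissible_monoP _ isoE) Ki.
  (* The pushout is formed in [B]. Only its corner [s] may lie outside the image of [K], and it is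
     exchanged for [K b'] along [x] and [y]. *)
  have [s [i' [f' [[comm univ] i'E]]]] := exact_E2 exB (fmap K f) Ki.
  have [b' [x [y [yx xy]]]] := K_surj s.
  have [j jE] := K_full (y ** i'); have [h hE] := K_full (y ** f').
  exists b', j, h; split; last first.
    by apply/admissible_monoP => //; rewrite jE; exact: iso_closed_mono isoE xy yx i'E.
  split; first by apply: K_faithful; rewrite !fmapM jE hE -!compmA comm.
  move=> z u v uv.
  have [|w [[wu wv] wuniq]] := univ _ (fmap K u) (fmap K v).
    by rewrite -!fmapM uv.
  have [w' w'E] := K_full (w ** x); exists w'; split.
    split; apply: K_faithful; rewrite fmapM w'E ?jE ?hE.
      by rewrite compmA -(compmA w) xy compm1.
    by rewrite compmA -(compmA w) xy compm1.
  move=> w2 [w2u w2v]; apply: K_faithful; rewrite w'E.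
  rewrite (wuniq (fmap K w2 ** y)); first by rewrite -compmA yx compm1.
  by rewrite -!compmA -jE -hE -!fmapM w2u w2v.
move=> b c c' p f /(admissible_epiP _ isoE) Kp.
have [s [p' [f' [[comm univ] p'E]]]] := exact_E2op exB (fmap K f) Kp.
have [b' [x [y [yx xy]]]] := K_surj s.
have [q qE] := K_full (p' ** x); have [h hE] := K_full (f' ** x).
exists b', q, h; split; last first.
  by apply/admissible_epiP => //; rewrite qE; exact: iso_closed_epi isoE xy yx p'E.
split; first by apply: K_faithful; rewrite !fmapM qE hE !compmA comm.
move=> z u v uv.
have [|w [[wu wv] wuniq]] := univ _ (fmap K u) (fmap K v).
  by rewrite -!fmapM uv.
have [w' w'E] := K_full (y ** w); exists w'; split.
  split; apply: K_faithful; rewrite fmapM w'E ?qE ?hE.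
    by rewrite compmA -(compmA p') xy compm1.
  by rewrite compmA -(compmA f') xy compm1.
move=> w2 [w2u w2v]; apply: K_faithful; rewrite w'E.
rewrite (wuniq (x ** fmap K w2)); first by rewrite compmA yx comp1m.
by rewrite !compmA -qE -hE -!fmapM w2u w2v.
Qed.

Lemma rel_projectiveP (x : A) : closed_under_iso EB ->
  rel_projective EA x <-> rel_projective EB (K x).
Proof.
move=> isoE; split=> prx b c p pE f; last first.
  have [g gE] := prx _ _ _ ((admissible_epiP _ isoE).1 pE) (fmap K f).
  by have [g' g'E] := K_full g; exists g'; apply: K_faithful; rewrite fmapM g'E.
have [b0 [s [t [ts st]]]] := K_surj b; have [c0 [u [v [vu uv]]]] := K_surj c.
have [p0 p0E] := K_full (v ** p ** s); have [f0 f0E] := K_full (v ** f).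
have p0A : admissible_epi EA p0.
  apply/admissible_epiP => //; rewrite p0E; apply: (iso_closed_epi isoE st ts _).
  exact: iso_closed_epi_codomain isoE uv vu pE.
have [g gE] := prx _ _ _ p0A f0; exists (s ** fmap K g).
have : u ** fmap K (p0 ** g) = f by rewrite gE f0E compmA uv comp1m.
by rewrite fmapM p0E !compmA uv comp1m.
Qed.

Lemma rel_injectiveP (x : A) : closed_under_iso EB ->
  rel_injective EA x <-> rel_injective EB (K x).
Proof.
move=> isoE; split=> injx a b i iE f; last first.
  have [g gE] := injx _ _ _ ((admissible_monoP _ isoE).1 iE) (fmap K f).
  by have [g' g'E] := K_full g; exists g'; apply: K_faithful; rewrite fmapM g'E.
have [b0 [s [t [ts st]]]] := K_surj b; have [a0 [u [v [vu uv]]]] := K_surj a.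
have [i0 i0E] := K_full (t ** i ** u); have [f0 f0E] := K_full (f ** u).
have i0A : admissible_mono EA i0.
  apply/admissible_monoP => //; rewrite i0E; apply: (iso_closed_mono_domain isoE uv vu _).
  exact: iso_closed_mono isoE st ts iE.
have [g gE] := injx _ _ _ i0A f0; exists (fmap K g ** t).
have : fmap K (g ** i0) ** v = f by rewrite gE f0E -compmA uv compm1.
by rewrite fmapM i0E -!compmA uv compm1.
Qed.

Lemma equivalence_frobenius : is_frobenius_category EB -> is_frobenius_category EA.
Proof.
move=> [exB prB injB coinc]; have isoE := exact_iso exB; split.
- exact: equivalence_exact.
- move=> c; have [b [p [prb pE]]] := prB (K c).
  have [b0 [s [t [ts st]]]] := K_surj b; have [p0 p0E] := K_full (p ** s).
  exists b0, p0; split; last first.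
    by apply/admissible_epiP => //; rewrite p0E; exact: iso_closed_epi isoE st ts pE.
  apply/rel_projectiveP => // y z q qE f; have [g gE] := prb _ _ _ qE (f ** t).
  by exists (g ** s); rewrite compmA gE -compmA ts compm1.
- move=> c; have [b [i [injb iE]]] := injB (K c).
  have [b0 [s [t [ts st]]]] := K_surj b; have [i0 i0E] := K_full (t ** i).
  exists b0, i0; split; last first.
    by apply/admissible_monoP => //; rewrite i0E; exact: iso_closed_mono isoE st ts iE.
  apply/rel_injectiveP => // y z q qE f; have [g gE] := injb _ _ _ qE (s ** f).
  by exists (t ** g); rewrite -compmA gE compmA ts comp1m.
by move=> x; rewrite rel_projectiveP // rel_injectiveP // coinc.
Qed.

Lemma equivalence_weakly_idempotent_complete :
  weakly_idempotent_complete B -> weakly_idempotent_complete A.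
Proof.
move=> wicB b c r s rs; have [|a [i [ri univ]]] := wicB _ _ (fmap K r) (fmap K s).
  by rewrite -fmapM rs fmap1.
have [a0 [u [v [vu uv]]]] := K_surj a; have [i0 i0E] := K_full (i ** u).
exists a0, i0; apply: reflect_kernel; rewrite i0E; split.
  by rewrite compmA ri comp0m.
move=> x f rf; have [g [gf guniq]] := univ _ _ rf; exists (v ** g); split.
  by rewrite -compmA (compmA u) uv comp1m.
move=> h hf; rewrite (guniq (u ** h)) ?compmA ?vu ?comp1m //.
Qed.

End equivalence_transport.

(** * Recognition of a quasi-inverse *)

Section quasi_inverse.
Variables (A B : preadditive) (K : functor A B) (L : functor B A).
Hypothesis K_additive : additive_functor K.
Hypothesis K_full : forall (a b : A) (g : hom (K a) (K b)), exists f, fmap K f = g.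
Hypothesis K_faithful : forall (a b : A) (f g : hom a b), fmap K f = fmap K g -> f = g.
Variable s : forall b : B, hom b (K (L b)).
Hypothesis s_iso : forall b, is_iso (s b).
Hypothesis s_natural : forall (b c : B) (f : hom b c), s c ** f = fmap K (fmap L f) ** s b.

(** Full faithfulness supplies the other natural isomorphism: at [a] it is the preimage under [K] of
    the inverse of [s] at [K a], and naturality is checked after applying [K]. *)
Lemma quasi_inverse_equivalences : inverse_equivalences L K.
Proof.
have [t ts] : exists t : forall b, hom (K (L b)) b,
    forall b, t b ** s b = idm b /\ s b ** t b = idm (K (L b)).
  by exists (fun b => sval (cid (s_iso b))) => b; exact: (svalP (cid (s_iso b))).
have t_natural (b c : B) (f : hom b c) : t c ** fmap K (fmap L f) = f ** t b.
  have [_ stb] := ts b; have [tsc _] := ts c.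
  by rewrite -[fmap K _]compm1 -stb (compmA (fmap K _)) -s_natural !compmA tsc comp1m.
split.
  exists t; split => [b|b c f]; last exact: t_natural.
  by have [tsb stb] := ts b; exists (s b).
have [r rE] : exists r : forall a, hom (L (K a)) a, forall a, fmap K (r a) = t (K a).
  exists (fun a => sval (cid (K_full (t (K a))))) => a.
  exact: (svalP (cid (K_full (t (K a))))).
exists r; split=> [a|a b f] /=.
  have [g gE] := K_full (s (K a)); have [tsa sta] := ts (K a).
  by exists g; split; apply: K_faithful; rewrite fmapM gE rE fmap1.
by apply: K_faithful; rewrite !fmapM !rE t_natural.
Qed.

Lemma quasi_inverse_additive : additive_functor L.
Proof.
move=> a b f g; apply: K_faithful.
have [t [ts st]] := s_iso a.
suff E : fmap K (fmap L (f + g)) ** s a = fmap K (fmap L f + fmap L g) ** s a.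
  by rewrite -[LHS]compm1 -[RHS]compm1 -st !compmA E.
by rewrite -s_natural K_additive compDr compDl !s_natural.
Qed.

Variables (EA : sequence_class A) (EB : sequence_class B).
Hypothesis EAB : forall (a b c : A) (i : hom a b) (p : hom b c),
  EA i p <-> EB (fmap K i) (fmap K p).

(** [K] carries the image under [L] of a sequence to a sequence isomorphic through [s] to the given
    one, and [K] reflects admissible sequences. *)
Lemma quasi_inverse_exact : closed_under_iso EB -> is_exact_functor EB EA L.
Proof.
move=> isoE; split; first exact: quasi_inverse_additive.
move=> a b c i p ip; apply/EAB.
by apply: isoE (s_iso a) (s_iso b) (s_iso c) _ _ ip; rewrite s_natural.
Qed.
End quasi_inverse.

(** * The adjunction between F and U *)

Section tensor_computations.
Variables (k : fieldType) (G : topGroupType) (V : smooth_rep k G).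
Implicit Types M N : lmodType (End_G V)^c.

(** Elements are classes of finite formal sums. The empty sum is [pure_tensor 0 0], so 0 is no
    separate case. *)
Lemma tensor_pure_ind M (Q : tensor M -> Prop) :
  (forall v m, Q (pure_tensor v m)) -> (forall x y, Q x -> Q y -> Q (x + y)) ->
  forall x, Q x.
Proof.
move=> Qpure QD x; rewrite -[x]reprK; elim: (repr x) => [|[v m] s IH].
  suff -> : (\pi_(tensor M) [::])%qT = pure_tensor 0 0 by exact: Qpure.
  apply: tensor_ext => A b bb; rewrite tensor_lift_pure // balanced0 //.
  exact: tensor_lift0.
suff -> : (\pi_(tensor M) ((v, m) :: s))%qT = pure_tensor v m + tensor_class s.
  exact: QD.
apply: tensor_ext => A b bb; rewrite tensor_liftD // !tensor_lift_class //.
by rewrite /formal_eval big_cons big_seq1.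
Qed.

Lemma tensor_rep_map_pure M N (f : {linear M -> N}) v m :
  tensor_rep_map f (pure_tensor v m) = pure_tensor v (f m).
Proof.
apply: tensor_ext => A b bb; have bf := balanced_map f bb.
by rewrite tensor_lift_fun // !tensor_lift_pure.
Qed.

Lemma tensor_act_pure M g v (m : M) :
  act (tensor_rep M) g (pure_tensor v m) = pure_tensor (act V g v) m.
Proof.
apply: tensor_ext => A b bb; have bg := balanced_act g bb.
by rewrite tensor_lift_act // !tensor_lift_pure.
Qed.

Lemma tensor_scale_pure M a v (m : M) :
  a *: (pure_tensor v m : tensor_rep M) = pure_tensor (a *: v) m.
Proof.
apply: tensor_ext => A b bb; have ba := balanced_scale a bb.
by rewrite tensor_lift_scale // !tensor_lift_pure.
Qed.

Lemma pure_tensorDl M v w (m : M) :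
  pure_tensor (v + w) m = pure_tensor v m + pure_tensor w m.
Proof. by have [-> _ _] := @pure_tensor_balanced _ _ V M. Qed.
Lemma pure_tensorDr M v (m n : M) :
  pure_tensor v (m + n) = pure_tensor v m + pure_tensor v n.
Proof. by have [_ -> _] := @pure_tensor_balanced _ _ V M. Qed.
Lemma pure_tensorH M (h : End_G V) v (m : M) :
  pure_tensor (h v) m = pure_tensor v ((h : (End_G V)^c) *: m).
Proof. by have [_ _ ->] := @pure_tensor_balanced _ _ V M. Qed.
Lemma pure_tensor0r M v : pure_tensor v (0 : M) = 0.
Proof. by apply: (addIr (pure_tensor v 0)); rewrite -pure_tensorDr !add0r. Qed.

Lemma tensor_hom_ext M (W : smooth_rep k G) (f g : rep_hom (tensor_rep M) W) :
  (forall v m, f (pure_tensor v m) = g (pure_tensor v m)) -> f = g.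
Proof.
move=> fg; apply: rep_ext; apply: tensor_pure_ind => [|x y fx fy]; first exact: fg.
by rewrite !linearD fx fy.
Qed.

Section tensor_hom.
Variables (M : lmodType (End_G V)^c) (W : smooth_rep k G) (b : V -> M -> W).
Hypotheses (bb : balanced b) (bZ : forall a v m, b (a *: v) m = a *: b v m)
  (bJ : forall g v m, b (act V g v) m = act W g (b v m)).

Lemma tensor_lift_linear : linear (tensor_lift b : tensor_rep M -> W).
Proof.
move=> a x y; rewrite tensor_liftD //; congr (_ + _).
elim/tensor_pure_ind: x => [v m|u v IHu IHv].
  by rewrite tensor_scale_pure !tensor_lift_pure.
by rewrite scalerDr !tensor_liftD // IHu IHv scalerDr.
Qed.

Lemma tensor_liftJ g x :
  mk_linear tensor_lift_linear (act (tensor_rep M) g x) =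
  act W g (mk_linear tensor_lift_linear x).
Proof.
elim/tensor_pure_ind: x => [v m|u v IHu IHv].
  by rewrite tensor_act_pure /= !tensor_lift_pure.
by rewrite !linearD IHu IHv.
Qed.

Definition tensor_hom : rep_hom (tensor_rep M) W := RepHom tensor_liftJ.

Lemma tensor_hom_pure v m : tensor_hom (pure_tensor v m) = b v m.
Proof. exact: tensor_lift_pure. Qed.
End tensor_hom.
End tensor_computations.

Section adjunction.
Variables (k : fieldType) (G : topGroupType) (p : nat).
Variable I : open_pro_p_subgroup p G.
Local Notation X := (ind k I).
Local Notation H := (hecke k I).
Local Notation F := (@F k G p I).
Local Notation U := (@U k G p I).
Local Notation lin f := (f : {linear _ -> _}).
Local Notation rep f := (f : rep_hom _ _).
Local Notation chi := (char_I k I).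
Implicit Types (M N P : lmodType H) (V W : smooth_rep k G).

Lemma U_additive : additive_functor U.
Proof. by move=> V W f g; apply: linear_ext => v; exact: val_inj. Qed.

Lemma hom_of_inv_val V (v : inv I V) : hom_of_inv v chi = val v.
Proof. by have /(congr1 val) := hom_of_invK v. Qed.

(** By Frobenius reciprocity: [chi] generates [X] as a representation. *)
Lemma ind_hom_ext V (f g : rep_hom X V) : f chi = g chi -> f = g.
Proof. by move=> fg; apply: (can_inj (@eval_charK _ _ _ I V)); exact: val_inj. Qed.

Lemma hecke_scaleE V (h : H) (v : inv I V) :
  val (h *: v) = hom_of_inv v ((h : End_G X) chi).
Proof. by []. Qed.

Lemma unit_subproof M (m : M) : (pure_tensor chi m : F M) \in submod_pred (inv_submod I (F M)).
Proof. by apply/asboolP => i Ji; rewrite tensor_act_pure char_I_J. Qed.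
Definition unit_fun M (m : M) : inv I (F M) :=
  exist (fun v => v \in submod_pred (inv_submod I (F M))) _ (unit_subproof m).

Lemma hom_of_unit M (m : M) x : hom_of_inv (unit_fun m) x = pure_tensor x m.
Proof.
have L : linear (fun x : X => pure_tensor x m : tensor_rep M).
  by move=> a x' y; rewrite pure_tensorDl tensor_scale_pure.
have J g x' : mk_linear L (act X g x') = act (tensor_rep M) g (mk_linear L x').
  exact/esym/tensor_act_pure.
suff -> : hom_of_inv (unit_fun m) = RepHom J by [].
by apply: ind_hom_ext; rewrite hom_of_inv_val.
Qed.

(** The invariant attached to [m] corresponds to the map sending [x] to [pure_tensor x m], so [h]
    takes it to [pure_tensor (h chi) m], and balancing moves [h] over to [m]. *)
Lemma unit_linear M : linear (@unit_fun M : M -> U (F M)).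
Proof.
move=> h m n; apply: val_inj.
rewrite [LHS]/= pure_tensorDr; congr (_ + _).
by rewrite [RHS]hecke_scaleE hom_of_unit pure_tensorH.
Qed.
Definition unit M : {linear M -> U (F M)} := mk_linear (@unit_linear M).

Lemma unit_natural M N (f : {linear M -> N}) m :
  lin (fmap U (fmap F f)) (unit M m) = unit N (f m).
Proof. by apply: val_inj; rewrite /= tensor_rep_map_pure. Qed.

Section counit.
Variable V : smooth_rep k G.
Let b (x : X) (v : inv I V) : V := hom_of_inv v x.

Let b_balanced : @balanced k G X (U V) V b.
Proof.
split=> [x y v|x v w|h x v]; rewrite /b; first exact: linearD.
  by rewrite hom_of_inv_add.
change (rep_comp (hom_of_inv v) h x =
  hom_of_inv (eval_char (rep_comp (hom_of_inv v) h)) x).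
by rewrite eval_charK.
Qed.
Let bZ a x v : b (a *: x) v = a *: b x v. Proof. exact: linearZ. Qed.
Let bJ g x v : b (act X g x) v = act V g (b x v). Proof. exact: rep_mapJ. Qed.

(** Under the identification of V^I with Hom_G(X, V) this is evaluation of homomorphisms. *)
Definition counit : rep_hom (F (U V)) V := tensor_hom b_balanced bZ bJ.

Lemma counit_pure x v : counit (pure_tensor x v) = hom_of_inv v x.
Proof. exact: tensor_hom_pure. Qed.
End counit.

Lemma counit_natural V W (f : rep_hom V W) x :
  counit W (rep (fmap F (fmap U f)) x) = f (counit V x).
Proof.
suff : rep_comp (counit W) (fmap F (fmap U f)) = rep_comp f (counit V).
  by move=> /(congr1 (fun h : rep_hom _ _ => h x)).
apply: tensor_hom_ext => y v.
change (counit W (tensor_rep_map (inv_map I f) (pure_tensor y v)) =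
  f (counit V (pure_tensor y v))).
rewrite tensor_rep_map_pure !counit_pure.
by rewrite -(@hom_of_inv_natural _ _ _ I V W f v (inv_map_fun f v)).
Qed.

(** A triangle identity of the adjunction. It makes the counit at [F M] bijective as soon as
    [unit M] is. *)
Lemma counit_unit M (x : F M) : counit (F M) (rep (fmap F (unit M)) x) = x.
Proof.
suff : rep_comp (counit (F M)) (fmap F (unit M)) = rep_id _.
  by move=> /(congr1 (fun h : rep_hom _ _ => h x)).
apply: tensor_hom_ext => y v.
change (counit (F M) (tensor_rep_map (unit M) (pure_tensor y v)) = pure_tensor y v).
rewrite tensor_rep_map_pure counit_pure.
exact: hom_of_unit.
Qed.

(* [x] is expanded along a dual basis of [P]; its coordinates are elements of
   X, and for [x] fixed by [I] they are of the form h(chi) with h in [H]. *)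
Section unit_projective.
Variable P : lmodType H.
Hypothesis prP : projective P.

Let coord_balanced (f : {linear P -> H^o}) :
  @balanced k G X P X (fun x m => (f m : End_G X) x).
Proof.
split=> [x y m|x m n|h x m]; first exact: linearD.
  by rewrite linearD.
by rewrite linearZ.
Qed.

Let coordZ (f : {linear P -> H^o}) a x m :
  (f m : End_G X) (a *: x) = a *: (f m : End_G X) x.
Proof. exact: linearZ. Qed.
Let coordJ (f : {linear P -> H^o}) g x m :
  (f m : End_G X) (act X g x) = act X g ((f m : End_G X) x).
Proof. exact: rep_mapJ. Qed.

(** This is [F f] followed by the evaluation isomorphism from [F H] to [X]; applied to a dual basis
    it gives coordinates on [F P]. *)
Definition tensor_coord (f : {linear P -> H^o}) : rep_hom (F P) X :=
  tensor_hom (coord_balanced f) (coordZ f) (coordJ f).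

Lemma tensor_coord_pure f x m : tensor_coord f (pure_tensor x m) = (f m : End_G X) x.
Proof. exact: tensor_hom_pure. Qed.

(** If [pure_tensor chi m] is 0, each coordinate [phi s m] is an endomorphism of [X] killing the
    generator [chi], hence 0. *)
Lemma unit_injective : injective (unit P).
Proof.
have [phi phiE] := dual_basis prP.
apply: linear_eq_ker_inj => m /(congr1 val) /= m0.
have [t tE] := phiE m; rewrite (tE (undup t)) ?undup_uniq //; last first.
  by move=> s; rewrite mem_undup.
rewrite big1 // => s _; suff -> : phi s m = 0 by exact: scale0r.
apply: ind_hom_ext; rewrite -tensor_coord_pure.
have := congr1 (tensor_coord (phi s)) m0; rewrite linear0.
by [].
Qed.

Lemma unit_surjective : surjective (unit P).
Proof.
have [phi phiE] := dual_basis prP.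
move=> u.
pose c s := tensor_coord (phi s).
have expand : forall x : F P, exists t : seq P, forall t', uniq t' ->
    {subset t <= t'} -> x = \sum_(s <- t') pure_tensor (c s x) s.
  apply: tensor_pure_ind => [y m|x y [t tE] [t' t'E]].
    have [t tE] := phiE m; exists t => t' ut' tt'.
    rewrite [in LHS](tE _ ut' tt').
    transitivity (\sum_(s <- t') pure_tensor y ((phi s m : H) *: s)).
      elim/big_rec2: _ => [|s u1 u2 _ <-]; first exact: pure_tensor0r.
      exact: pure_tensorDr.
    by apply: eq_bigr => s _; rewrite /c tensor_coord_pure pure_tensorH.
  exists (t ++ t') => t2 ut2 tt2.
  rewrite [in LHS](tE _ ut2) => [|s st]; last by apply: tt2; rewrite mem_cat st.
  rewrite [in X in _ + X](t'E _ ut2) => [|s st]; last by apply: tt2; rewrite mem_cat st orbT.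
  rewrite -big_split; apply: eq_bigr => s _.
  by rewrite linearD pure_tensorDl.
have [t tE] := expand (val u).
pose h s : H := hom_of_inv (inv_map_fun (c s) u).
exists (\sum_(s <- undup t) h s *: s); apply: val_inj => /=.
rewrite [RHS](tE (undup t)) ?undup_uniq //; last by move=> s; rewrite mem_undup.
elim/big_rec2: _ => [|s u1 u2 _ <-]; first exact: pure_tensor0r.
rewrite pure_tensorDr -pure_tensorH; congr (_ + _).
by rewrite /h hom_of_inv_val.
Qed.
End unit_projective.

End adjunction.

(** * The category C(G) *)

Section representations_CG.
Variables (k : fieldType) (G : topGroupType) (p : nat).
Variable I : open_pro_p_subgroup p G.
Hypothesis gorH : gorenstein_ring (hecke k I).
Local Notation X := (ind k I).
Local Notation H := (hecke k I).
Local Notation F := (@F k G p I).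
Local Notation U := (@U k G p I).
Local Notation lin f := (f : {linear _ -> _}).
Local Notation rep f := (f : rep_hom _ _).
Implicit Types (M N P : lmodType H) (V W : smooth_rep k G).

Lemma repE V W (f g : rep_hom V W) : f = g -> f =1 g.
Proof. by move=> ->. Qed.

Lemma fmapUM V W Z (f : rep_hom V W) (g : rep_hom W Z) v :
  lin (fmap U (rep_comp g f)) v = lin (fmap U g) (lin (fmap U f) v).
Proof. exact: val_inj. Qed.

Lemma fmapFM M N P (f : {linear M -> N}) (g : {linear N -> P}) x :
  rep (fmap F (g \o f : {linear M -> P})) x = rep (fmap F g) (rep (fmap F f) x).
Proof. exact: repE (fmapM F g f) x. Qed.

Lemma unit_inverse P : projective P -> exists g : {linear U (F P) -> P},
  cancel (unit P) g /\ cancel g (unit P).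
Proof.
by move=> prP; apply: linear_inverse; [exact: unit_injective|exact: unit_surjective].
Qed.

Lemma I_projective_U V : I_projective I V -> projective (U V : lmodType H).
Proof.
move=> [P [prP [s [r rs]]]]; have [g [ug gu]] := unit_inverse prP.
apply: (@projective_sub_retract _ _ _ (g \o fmap U s : {linear U V -> P})
  (lin (fmap U r) \o unit P : {linear P -> U V}) _ prP) => v.
change (lin (fmap U r) (unit P (g (lin (fmap U s) v))) = v).
by rewrite gu -fmapUM; apply: val_inj; exact: repE rs _.
Qed.

Lemma counit_projective_injective P : projective P -> injective (counit I (F P)).
Proof.
move=> prP; have [g [ug gu]] := unit_inverse prP.
have surj y : rep (fmap F (unit P)) (rep (fmap F g) y) = y.
  rewrite -fmapFM (_ : (unit P \o g : {linear _ -> _}) = idfun).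
    exact: repE (fmap1 F (U (F P))) y.
  exact: linear_ext.
by move=> x y; rewrite -(surj x) -(surj y) !counit_unit => ->.
Qed.

Lemma counit_I_projective_injective V : I_projective I V -> injective (counit I V).
Proof.
move=> [P [prP [s [r rs]]]] x y xy.
have sE : rep (fmap F (fmap U s)) x = rep (fmap F (fmap U s)) y.
  by apply: (counit_projective_injective prP); rewrite !counit_natural xy.
have rsE z : rep (fmap F (fmap U r)) (rep (fmap F (fmap U s)) z) = z.
  rewrite -fmapFM; have -> : (lin (fmap U r) \o lin (fmap U s) : {linear _ -> _}) = idfun.
    by apply: linear_ext => v; apply: val_inj; exact: repE rs _.
  exact: repE (fmap1 F (U V)) z.
by rewrite -(rsE x) sE rsE.
Qed.

Lemma counit_I_projective_surjective V : I_projective I V ->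
  forall v, exists x, counit I V x = v.
Proof.
move=> [P [prP [s [r rs]]]] v.
exists (rep (fmap F (fmap U r)) (rep (fmap F (unit P)) (rep s v))).
by rewrite counit_natural counit_unit; exact: repE rs v.
Qed.

Section image_factorization.
Variables (V W : smooth_rep k G) (f : rep_hom V W).

Lemma im_incl_linear : linear (val : im f -> W). Proof. exact: linearP. Qed.
Lemma im_inclJ g (w : im f) : mk_linear im_incl_linear (act (im f) g w) = act W g (val w).
Proof. by []. Qed.
Definition im_incl : rep_hom (im f) W := RepHom im_inclJ.

Lemma im_proj_subproof (x : V) : f x \in im_pred f.
Proof. by apply/asboolP; exists x. Qed.
Definition im_proj_fun (x : V) : im f :=
  exist (fun w => w \in im_pred f) _ (im_proj_subproof x).
Lemma im_proj_linear : linear im_proj_fun.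
Proof. by move=> a x y; apply: val_inj; rewrite /= linearP. Qed.
Lemma im_projJ g x : mk_linear im_proj_linear (act V g x) = act (im f) g (im_proj_fun x).
Proof. by apply: val_inj; rewrite /= rep_mapJ. Qed.
Definition im_proj : rep_hom V (im f) := RepHom im_projJ.

Lemma im_incl_injective : injective im_incl. Proof. exact: val_inj. Qed.
Lemma im_proj_surjective w : exists x, im_proj x = w.
Proof.
by have /asboolP[x xw] := valP w; exists x; apply: val_inj.
Qed.
End image_factorization.

Lemma U_injective V W (f : rep_hom V W) : injective f -> injective (lin (fmap U f)).
Proof. by move=> fI u v /(congr1 val) /fI uv; exact: val_inj. Qed.

Lemma im_incl_B0_map (Y Z : complex (Rep k G)) (f : chain_map Y Z) w :
  im_incl (rep (diff Z 0)) (B0_map f w) = rep (f 0) (im_incl (rep (diff Y 0)) w).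
Proof. by []. Qed.

(** * Invariants of [I]-exact complexes of [I]-projectives *)

Section I_exact_complexes.
Variable Y : complex (Rep k G).
Hypotheses (prY : forall i, I_projective I (Y i)) (exY : I_exact_complex I Y).
Let UY := map_complex (@U_additive k G p I) Y.

Lemma UY_acyclic : acyclic UY. Proof. exact: exY. Qed.
Lemma UY_projective i : projective (UY i : lmodType H).
Proof. exact: I_projective_U. Qed.

(** [U] need not preserve surjections. Here an invariant of [B_0], viewed in [Y_0], is killed by the
    outgoing differential, and [I]-exactness in degree 0 lifts it to an invariant of [Y_1]. *)
Lemma U_im_proj_surjective : surjective (lin (fmap U (im_proj (rep (diff Y 0))))).
Proof.
move=> u; set j := im_incl (rep (diff Y 0)).
have jI := U_injective (@im_incl_injective _ _ (rep (diff Y 0))).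
have [x xE] := im_proj_surjective (val u).
(* The source of [diff Y (-1)] has degree [-1 + 1], which computes to 0. *)
have ju : lin (fmap U (diff Y (-1))) (lin (fmap U j) u) = 0.
  apply: val_inj; change (rep (diff Y (-1)) (im_incl _ (val u)) = 0).
  by rewrite -xE; exact: repE (diff2 Y (-1)) x.
have [w wE] := (@exY (-1) (lin (fmap U j) u)).1 ju.
by exists w; apply: jI; apply: etrans wE; exact: val_inj.
Qed.

Lemma U_im_boundaries :
  @is_boundaries H UY (U (B0 k G Y)) (fmap U (im_incl (rep (diff Y 0)))).
Proof.
split; first exact/U_injective/im_incl_injective.
move=> y; split=> [[m <-]|[x <-]].
  by have [x <-] := U_im_proj_surjective m; exists x; exact: val_inj.
by exists (lin (fmap U (im_proj (rep (diff Y 0)))) x); exact: val_inj.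
Qed.

Lemma UY_hom_exact P : projective P -> hom_exact UY P.
Proof.
move=> prP; apply: acyclic_hom_exact => //; last exact: UY_projective.
by case: gorH => *; exact: syzygy_projective_ext1_zero.
Qed.

Lemma U_im_gp : gorenstein_projective (U (B0 k G Y) : lmodType H).
Proof.
exists UY; split; [exact: UY_acyclic|exact: UY_projective|exact: UY_hom_exact|].
by exists (fmap U (im_incl (rep (diff Y 0)))); exact: U_im_boundaries.
Qed.

(** Precomposed with the surjection from [U Y_1], [phi] becomes a cocycle of Hom(UY, P), hence a
    coboundary; the map on [U Y_0] exhibiting this is the extension. *)
Lemma U_im_extension P (phi : {linear U (B0 k G Y) -> P}) : projective P ->
  exists psi : {linear U (Y 0) -> P}, forall v,
    psi (lin (fmap U (im_incl (rep (diff Y 0)))) v) = phi v.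
Proof.
move=> prP.
have [|psi psiE] := UY_hom_exact prP (i := 0)
    (f := phi \o lin (fmap U (im_proj (rep (diff Y 0))))).
  move=> x /=; rewrite (_ : fmap U _ _ = 0) ?linear0 //.
  apply: val_inj; apply: val_inj.
  exact: repE (diff2 Y 0) (val x).
exists psi => v; have [w <-] := U_im_proj_surjective v.
by apply: etrans (psiE w); congr (psi _); exact: val_inj.
Qed.
End I_exact_complexes.

(** Membership in C(G) gives only an isomorphism with some [B_0]. What is used later is transported
    along it once, so that the complex is not reopened. *)
Lemma CG_presentation V : in_CG I V ->
  gorenstein_projective (U V : lmodType H) /\
  exists (V1 V0 : smooth_rep k G) (c : rep_hom V1 V) (e : rep_hom V V0),
    [/\ I_projective I V1, I_projective I V0, forall v, exists x, c x = v,
        injective e &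
        forall P (phi : {linear U V -> P}), projective P ->
          exists psi : {linear U V0 -> P}, forall v, psi (lin (fmap U e) v) = phi v].
Proof.
move=> [Y [prY exY [f [g [gf fg]]]]].
have fK : cancel (rep f) (rep g) by exact: repE gf.
have gK : cancel (rep g) (rep f) by exact: repE fg.
have gUK : cancel (lin (fmap U g)) (lin (fmap U f)) by move=> v; apply: val_inj; exact: gK.
have fUK : cancel (lin (fmap U f)) (lin (fmap U g)) by move=> v; apply: val_inj; exact: fK.
split.
  apply: (gp_iso gorH (f := lin (fmap U g))) (U_im_gp prY exY).
    exact: can_inj gUK.
  by move=> v; exists (lin (fmap U f) v).
exists (Y (0 + 1)), (Y 0), (rep_comp g (im_proj (rep (diff Y 0)))),
  (rep_comp (im_incl (rep (diff Y 0))) f); split => //.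
- move=> v; have [x xE] := im_proj_surjective (rep f v).
  by exists x; rewrite /= -[RHS]fK -xE.
- by move=> x y /im_incl_injective /(can_inj fK).
move=> P phi prP.
have [psi psiE] := U_im_extension prY exY (phi \o lin (fmap U g) : {linear _ -> _}) prP.
by exists psi => v; rewrite fmapUM psiE /= fUK.
Qed.

Lemma counit_CG_surjective V : in_CG I V -> forall v, exists x, counit I V x = v.
Proof.
move=> /CG_presentation[_ [V1 [V0 [c [e [prV1 _ cS _ _]]]]]] v.
have [x <-] := cS v; have [y <-] := counit_I_projective_surjective prV1 x.
by exists (rep (fmap F (fmap U c)) y); rewrite counit_natural.
Qed.

Lemma U_faithful V W (f g : rep_hom V W) : in_CG I V ->
  fmap U f = fmap U g -> f = g.
Proof.
move=> VC fg; apply: rep_ext => v; have [x <-] := counit_CG_surjective VC v.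
by rewrite -!counit_natural fg.
Qed.

(* The kernel of the counit at [V] consists of the elements killed by F phi for
   every phi : U V -> P with P projective, hence is functorial in U V. *)
Lemma U_full V W (phi : {linear U V -> U W}) : in_CG I V -> in_CG I W ->
  exists f : rep_hom V W, fmap U f = phi.
Proof.
move=> VC WC.
have [_ [V1 [V0 [c [e [_ prV0 _ _ eP]]]]]] := CG_presentation VC.
have [_ [W1 [W0 [d [i [_ prW0 _ iI _]]]]]] := CG_presentation WC.
have [psi psiE] := eP _ (lin (fmap U i) \o phi : {linear _ -> _}) (I_projective_U prW0).
pose h : rep_hom (F (U V)) W := rep_comp (counit I W) (fmap F phi).
have [||f fE] := @factor_surjective _ _ _ _
    (counit I V : {linear _ -> _}) (h : {linear _ -> _}).
- exact: counit_CG_surjective.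
(* After [i], the map [h] is the counit at [W0] composed with [F psi] and [F (U e)]. The last one
   already kills [x]: the counit at [V0] is injective and sends the image of [x] to
   [e (counit V x) = 0]. *)
- move=> x Vx; apply: iI; rewrite linear0 /= -counit_natural -fmapFM.
  have <- : (psi \o lin (fmap U e) : {linear _ -> _}) = lin (fmap U i) \o phi.
    by apply: linear_ext => v; exact: psiE.
  rewrite fmapFM; have -> : rep (fmap F (fmap U e)) x = 0.
    apply: (counit_I_projective_injective prV0).
    by rewrite counit_natural Vx !linear0.
  by rewrite !linear0.
have fJ g v : f (act V g v) = act W g (f v).
  have [x <-] := counit_CG_surjective VC v.
  by rewrite -rep_mapJ !fE rep_mapJ.
exists (RepHom fJ); apply: linear_ext => v; apply: val_inj.
change (f (val (v : inv I V)) = val (phi v)).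
(* The other triangle identity: an invariant is the value of the counit at its own unit, where [f]
   is given by [phi]. *)
have -> : val (v : inv I V) = counit I V (pure_tensor (char_I k I) v).
  by rewrite counit_pure hom_of_inv_val.
rewrite fE.
change (counit I W (tensor_rep_map phi (pure_tensor (char_I k I) v)) = val (phi v)).
by rewrite tensor_rep_map_pure counit_pure hom_of_inv_val.
Qed.

(** * Representations built from complete resolutions *)

Section complete_resolutions.
Variables (Y : complex (Mod H)) (M : lmodType H) (e : {linear M -> Y 0}).
Hypotheses (prY : forall i, projective (Y i : lmodType H)) (acY : acyclic Y)
  (eY : is_boundaries e).
Let FY := map_complex (@F_additive k G p I) Y.

Lemma FY_I_projective i : I_projective I (FY i).
Proof.
by exists (Y i); split => //; exists (idm _), (idm _); rewrite comp1m.
Qed.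

(** The unit is natural, and bijective at each projective term, so it identifies [Y] with [U F Y]
    and carries acyclicity over. *)
Lemma FY_I_exact : I_exact_complex I FY.
Proof.
move=> i y; have [z zE] := unit_surjective (@prY (i + 1)) y; subst y.
rewrite (unit_natural (diff Y i : {linear _ -> _})).
split=> [dz|[x]].
  have /acY[w <-] : (diff Y i : {linear _ -> _}) z = 0.
    by apply: (unit_injective (@prY i)); rewrite dz linear0.
  by exists (unit _ w); exact: (unit_natural (diff Y (i + 1) : {linear _ -> _})).
have [w <-] := unit_surjective (@prY (i + 1 + 1)) x.
rewrite (unit_natural (diff Y (i + 1) : {linear _ -> _})).
move=> /(unit_injective (@prY (i + 1))) <-.
by rewrite (exact_at_comp0 w (@acY i)) linear0.
Qed.

Lemma B0FY_CG : in_CG I (B0 k G FY).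
Proof.
exists FY; split; [exact: FY_I_projective|exact: FY_I_exact|].
by exists (idm _); exact: is_iso_id.
Qed.

(** The last clause determines [s], the inclusion being injective on invariants; naturality of [s]
    in [M] is deduced from it in [FC_unit]. *)
Lemma U_B0FY : exists s : {linear M -> U (B0 k G FY)},
  [/\ injective s, surjective s &
    forall m, lin (fmap U (im_incl (rep (diff FY 0)))) (s m) = unit (Y 0) (e m)].
Proof.
have [eI eE] := eY.
have incI := U_injective (@im_incl_injective _ _ (rep (diff FY 0))).
have [|s sE] := @lift_injective _ _ _ _
  (lin (fmap U (im_incl (rep (diff FY 0))))) (unit (Y 0) \o e : {linear _ -> _}) incI.
  move=> m; have /eE[x xE] : exists m', e m' = e m by exists m.
  exists (lin (fmap U (im_proj (rep (diff FY 0)))) (unit _ x)).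
  rewrite /= -xE; apply: etrans (unit_natural (diff Y 0 : {linear _ -> _}) _).
  exact: val_inj.
exists s; split => //.
- by move=> x y xy; apply/eI/(unit_injective (@prY 0)); move: (sE x); rewrite xy sE.
move=> u; have [w <-] := U_im_proj_surjective FY_I_exact u.
have [x <-] := unit_surjective (@prY (0 + 1)) w.
have /eE[m mE] : exists x', lin (diff Y 0) x' = lin (diff Y 0) x by exists x.
exists m; apply: incI; rewrite sE /= mE.
apply: etrans (esym (unit_natural (diff Y 0 : {linear _ -> _}) _)) _.
exact: val_inj.
Qed.
End complete_resolutions.

(** * The restricted functors as equivalences *)

Lemma U_CG_gp (V : Rep k G) : in_CG I V -> gorenstein_projective (U V : lmodType H).
Proof. by move=> /CG_presentation[]. Qed.

Definition UC : functor (CG k I) (GProj k I) := restrict_functor U_CG_gp.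

Lemma UC_additive : additive_functor UC.
Proof. by move=> a b f g; exact: U_additive. Qed.

Lemma UC_full (a b : CG k I) (g : hom (UC a) (UC b)) : exists f, fmap UC f = g.
Proof. by case: a b g => V VC [W WC] g; exact: U_full. Qed.

Lemma UC_faithful (a b : CG k I) (f g : hom a b) : fmap UC f = fmap UC g -> f = g.
Proof. by case: a b f g => V VC [W WC] f g; exact: U_faithful. Qed.

(** Any complete resolution of the module serves here, so the exact structure on C(G) is obtained
    without a functorial choice of resolutions. *)
Lemma UC_surj (b : GProj k I) : exists (a : CG k I) (f : hom (UC a) b) (g : hom b (UC a)),
  g ** f = idm (UC a) /\ f ** g = idm b.
Proof.
case: b => M gpM; have [Y [acY prY _ [e eY]]] := gpM.
have [s [sI sS _]] := U_B0FY prY acY eY.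
have [t [st ts]] := linear_inverse sI sS.
exists (exist _ _ (B0FY_CG prY acY)), t, s.
by split; apply: linear_ext.
Qed.

(** A short [I]-exact sequence must also be a complex of representations; from right to left this
    follows from faithfulness of [U] on C(G). *)
Lemma UC_sequences (a b c : CG k I) (i : hom a b) (q : hom b c) :
  CG_sequences i q <-> GProj_sequences (fmap UC i) (fmap UC q).
Proof.
split=> [[_]//|iq]; split => //.
apply: (@UC_faithful a c); apply: linear_ext => v.
have := exact_at_comp0 v (match iq with And3 _ e _ => e end).
by rewrite -fmapUM => ->; apply: val_inj.
Qed.

Lemma CG_frobenius : is_frobenius_category (@CG_sequences k G p I).
Proof.
apply: (equivalence_frobenius UC_additive UC_full UC_faithful UC_surj UC_sequences).
exact: gp_frobenius.
Qed.

Lemma CG_weakly_idempotent_complete : weakly_idempotent_complete (CG k I).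
Proof.
apply: (equivalence_weakly_idempotent_complete UC_additive UC_full UC_faithful UC_surj).
exact: gp_weakly_idempotent_complete.
Qed.

Section resolution_functor.
Variable Y : gorenstein_resolution k I.

Lemma Fbb_CG (M : Mod H) : gorenstein_projective M -> in_CG I (Fbb Y M).
Proof.
by move=> /(gres_gorenstein Y M) prY; apply: B0FY_CG => //; exact: gres_acyclic.
Qed.

Definition FC : functor (GProj k I) (CG k I) := restrict_functor Fbb_CG.

Lemma FC_unit : exists s : forall M : GProj k I, hom M (UC (FC M)),
  (forall a, is_iso (s a)) /\
  forall (M N : GProj k I) (f : hom M N), s N ** f = fmap UC (fmap FC f) ** s M.
Proof.
have /dependent_choice[s sP] : forall M : GProj k I,
    exists s : {linear sval M -> U (Fbb Y (sval M))},
  [/\ injective s, surjective s & forall m,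
    lin (fmap U (im_incl (rep (fmap F (diff (gres Y (sval M) : complex _) 0))))) (s m) =
    unit _ (lin (gres_inc Y (sval M)) m)].
  move=> [M gpM]; apply: U_B0FY.
  - exact/gres_gorenstein.
  - exact: gres_acyclic.
  - exact: gres_boundaries.
exists s; split=> [M|M N f].
  have [sI sS _] := sP M; have [t [st ts]] := linear_inverse sI sS.
  by exists t; split; apply: linear_ext.
apply: linear_ext => m; have [_ _ sM] := sP M; have [_ _ sN] := sP N.
(* Naturality is tested in the invariants of [F Y^N_0], where it reduces to naturality of [gres_inc]
   and of the unit. *)
apply: (U_injective (@im_incl_injective _ _
  (rep (fmap F (diff (gres Y (sval N) : complex _) 0))))).
rewrite [LHS]sN.
have -> : lin (gres_inc Y (sval N)) (lin f m) =
   lin ((fmap Y f : chain_map _ _) 0) (lin (gres_inc Y (sval M)) m).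
  by apply/esym; exact: homE (gres_inc_natural Y f) m.
rewrite -unit_natural -sM; apply: val_inj.
exact: (im_incl_B0_map (map_chain_map (@F_additive k G p I) (fmap Y f))
  (val (s M m : inv I _))).
Qed.
End resolution_functor.

End representations_CG.

Theorem corollary5p9 (k : fieldType) (p : nat) (charkp : p \in [pchar k])
    (G : topGroupType) (I : open_pro_p_subgroup p G)
    (gorH : gorenstein_ring (hecke k I)) :
  [/\ is_frobenius_category (@CG_sequences k G p I),
      weakly_idempotent_complete (CG k I)
    & forall Y : gorenstein_resolution k I,
        exists (FGProj : forall M : Mod (hecke k I),
                  gorenstein_projective M -> in_CG I (Fbb Y M))
               (UCG : forall V : Rep k G,
                  in_CG I V -> gorenstein_projective (U k I V)),
        let FY : functor (GProj k I) (CG k I) :=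
          restrict_functor FGProj in
        let UC : functor (CG k I) (GProj k I) :=
          restrict_functor UCG in
        [/\ is_exact_functor (@GProj_sequences k G p I) (@CG_sequences k G p I) FY,
            is_exact_functor (@CG_sequences k G p I) (@GProj_sequences k G p I) UC
          & inverse_equivalences FY UC]].
Proof.
split; [exact: CG_frobenius|exact: CG_weakly_idempotent_complete|move=> Y].
exists (@Fbb_CG k G p I Y), (@U_CG_gp k G p I gorH).
have [s [s_iso s_natural]] := FC_unit gorH Y.
split.
- apply: (quasi_inverse_exact (UC_additive gorH) (@UC_faithful _ _ _ _ gorH) s_iso s_natural
    (UC_sequences gorH)).
  exact: exact_iso (gp_exact gorH).
- by split; [exact: UC_additive|move=> a b c i q /(UC_sequences gorH)].
exact: (@quasi_inverse_equivalences _ _ (UC gorH) (FC Y) (@UC_full _ _ _ _ gorH)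
  (@UC_faithful _ _ _ _ gorH) s s_iso s_natural).
Qed.
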